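(* For every integer $n\ge 6$, $$ex_{\mathcal{P}}(n,\{K_4,\Theta_6^2\})\le \tfrac{12}{5}(n-2),$$ and equality holds whenever $n\ge 12$ and $n\equiv 2 \pmod{10}$.
   Context: All graphs are simple, finite and undirected. $\Theta_6^2$ is the graph obtained from a cycle $C_6$ by adding an edge joining two vertices at distance $2$ on the cycle (equivalently, a cycle of length $3$ and a cycle of length $5$ sharing exactly one edge and its two endpoints). For a family $\mathcal{H}$ of graphs, a graph is $\mathcal{H}$-free if it contains no subgraph (not necessarily induced) isomorphic to a member of $\mathcal{H}$. The planar Turán number $ex_{\mathcal{P}}(n,\mathcal{H})$ is the maximum number of edges in an $\mathcal{H}$-free planar graph on $n$ vertices. *)

(* Defs.v *)
From mathcomp Require Import all_boot all_order all_algebra.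
From mathcomp Require Import all_classical all_reals all_analysis.
Import Order.TTheory GRing.Theory Num.Theory numFieldNormedType.Exports.

Set Implicit Arguments.
Unset Strict Implicit.
Unset Printing Implicit Defensive.

Local Open Scope classical_set_scope.
Local Open Scope ring_scope.

(* A simple graph with vertex set T is given by its edges, which are unordered
   pairs of distinct vertices. *)
Definition simple_edges (T : finType) (E : {set {set T}}) : bool :=
  [forall e in E, #|e| == 2%N].

Definition graph (T : finType) := {E : {set {set T}} | simple_edges E}.

Definition edges (T : finType) (G : graph T) : {set {set T}} := val G.

Definition edges_of_rel (T : finType) (r : rel T) : {set {set T}} :=
  [set e : {set T} | [exists x, exists y,
     [&& x != y, r x y & e == [set x; y]%SET]]]%SET.

Lemma simple_edges_of_rel (T : finType) (r : rel T) :
  simple_edges (edges_of_rel r).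
Proof.
apply/forall_inP => e; rewrite inE => /existsP[x /existsP[y]].
by case/and3P=> xy _ /eqP ->; rewrite cards2 xy.
Qed.

(* The loopless symmetric closure of r. *)
Definition graph_of_rel (T : finType) (r : rel T) : graph T :=
  exist _ (edges_of_rel r) (simple_edges_of_rel r).

Definition complete_graph (n : nat) : graph 'I_n :=
  graph_of_rel (fun _ _ => true).

(* The 6-cycle 0, 1, ..., 5 with the chord {0, 2}. *)
Definition theta62 : graph 'I_6 :=
  graph_of_rel (fun i j : 'I_6 =>
    (j == ordS i) || ((i == 0%N :> nat) && (j == 2%N :> nat))).

(* G has a not necessarily induced subgraph isomorphic to H. *)
Definition contains_copy (S T : finType) (H : graph S) (G : graph T) : Prop :=
  exists f : S -> T, injective f /\
    forall e : {set S}, e \in edges H -> (f @: e)%SET \in edges G.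

(* Up to isomorphism, every finite graph has vertex set 'I_m for some m. *)
Definition some_graph := {m : nat & graph 'I_m}.

Definition free_of (F : set some_graph) (T : finType) (G : graph T) : Prop :=
  forall H : some_graph, F H -> ~ contains_copy (tagged H) G.

(* A drawing of G in the plane R * R without crossings: p places the vertices,
   and each edge e is the simple arc c e, parametrized by [0, 1]. *)
Definition plane_drawing (R : realType) (T : finType) (G : graph T)
    (p : T -> R * R) (c : {set T} -> R -> R * R) : Prop :=
  [/\ injective p,
      forall e, e \in edges G ->
        [/\ {within `[0, 1], continuous (c e)},
            {in `[0, 1] &, injective (c e)} &
            exists x y, [/\ e = [set x; y]%SET, c e 0 = p x & c e 1 = p y]],
      forall e x, e \in edges G -> {in `]0, 1[, forall t, c e t <> p x} &
      forall e f, e \in edges G -> f \in edges G -> e <> f ->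
        {in `]0, 1[ &, forall s t, c e s <> c f t}].

Definition planar (R : realType) (T : finType) (G : graph T) : Prop :=
  exists (p : T -> R * R) (c : {set T} -> R -> R * R), plane_drawing G p c.

(* The planar Turan number ex_P(n, F). The default value 0 of \max over an empty
   range only matters if no planar graph on n vertices is F-free. *)
Definition planar_turan (R : realType) (n : nat) (F : set some_graph) : nat :=
  (\max_(G : graph 'I_n | `[< planar R G /\ free_of F G >]) #|edges G|)%N.

Definition K4_theta62 : set some_graph :=
  [set Tagged (fun m => graph 'I_m) (complete_graph 4);
       Tagged (fun m => graph 'I_m) theta62].

(* Main.v *)
Require Import Defs.
From mathcomp Require Import all_boot boolp.
From mathcomp Require Import zify.

Set Implicit Arguments.
Unset Strict Implicit.
Unset Printing Implicit Defensive.

(** Upper bound.  Let a planar graph have [V] vertices and [E] edges, and give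
    every face of length [L] the charge [7 L - 24].  The bound
    [5 E + 24 <= 12 V] follows from Euler's formula once the total charge
    [14 E - 24 F] is nonnegative.  Only triangles are negative, at [-3], and the
    charge is moved so that nobody stays negative: a face of length at least 6
    gives 3 to every adjacent triangle, a pentagon gives 2, a quadrilateral 2 or
    1.  Excluding [K_4] and the hexagon with a short chord leaves only four
    shapes for a cluster of adjacent triangles: a single triangle, a pair, a fan
    of three, and the wheel with four spokes.  The forbidden subgraphs also
    limit which faces surround each cluster, and those faces give enough
    ([local_charge], [discharging]).  This needs minimum degree 3 and a
    2-connected graph; vertices of degree at most 2 and cut vertices are removed
    by induction ([dual_edge_bound]).

    Of plane topology the argument uses one fact: the graph has an abstract dual
    ([has_dual]), that is, faces on the two sides of every edge such that the
    boundaries of sets of faces are exactly the even edge sets.  Counting even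
    sets replaces Euler's formula ([face_count]), and the rotation of the edges
    around a vertex is replaced by the remark that a family of edges at a vertex
    closing up with the faces around it contains all edges at that vertex
    ([umbrella_set]).

    The dual comes from a drawing by arbitrary continuous arcs as follows
    ([drawing_has_dual]).  By compactness the arcs keep a positive distance from
    each other outside small discs around the vertices.  On a fine enough
    square grid the sampled arcs become lattice paths that are disjoint outside
    boxes around the vertices ([samples_has_dual]).  In the grid, an even finite
    set of unit segments bounds a set of squares ([even_chain_bdry], the discrete
    Jordan theorem), so an even edge set, prolonged to a set of closed lattice
    walks, separates the squares into two classes ([lattice_has_dual]).

    Equality.  A ring consists of three wheels with four spokes, glued like the
    sides of a triangle: each two of them share one rim vertex.  Chaining [k]
    rings between consecutive ends, all with the same apex, gives [10 k + 2]
    vertices and [24 k] edges.  Every triangle and every pentagon lies inside one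
    wheel ([linked_triangle], [linked_pentagon]), which has too few vertices for
    a hexagon.  A straight-line drawing of the chain in a vertical strip, with
    the edges to the apex leaving across both borders, is closed up by a map that
    sends both borders to one point ([loop_map], [ring_graph_planar]). *)

(** * Parity sums *)

Lemma big_addb_odd (I : finType) (A : {set I}) (P : pred I) :
  \big[addb/false]_(e in A) P e = odd #|[set e in A | P e]|.
Proof.
rewrite -sum1dep_card (big_morph odd oddD (erefl : odd 0 = false)) big_mkcondr /=.
by apply: eq_bigr => e _; case: (P e).
Qed.

Lemma big_addb_eq (I : eqType) (s : seq I) (b : I) :
  uniq s -> \big[addb/false]_(v <- s) (b == v) = (b \in s).
Proof.
elim: s => [|v s IH] /=; first by rewrite big_nil.
by case/andP=> vs us; rewrite big_cons IH // in_cons; case: eqP vs => //= -> /negbTE ->.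
Qed.

Lemma big_addb_symm0 (I : Type) (s : seq I) (F : I -> I -> bool) :
  (forall x y, F x y = F y x) -> (forall x, F x x = false) ->
  \big[addb/false]_(x <- s) \big[addb/false]_(y <- s) F x y = false.
Proof.
move=> Fs F0; elim: s => [|v s IH]; first by rewrite big_nil.
rewrite big_cons big_cons F0 addFb.
under [X in addb _ X]eq_bigr do rewrite big_cons.
rewrite big_split /= IH addbF (eq_bigr (fun i => F i v)) ?addbb // => x _; exact: Fs.
Qed.

(** * The square lattice *)

Definition grid_pt := (nat * nat)%type.

Definition nbrs (a : grid_pt) : seq grid_pt :=
  [:: (a.1.+1, a.2); (a.1.-1, a.2); (a.1, a.2.+1); (a.1, a.2.-1)].

Definition step : rel grid_pt := fun a b => b \in nbrs a.

Definition inner (a : grid_pt) := (0 < a.1) && (0 < a.2).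

Definition deep (a : grid_pt) := (1 < a.1) && (1 < a.2).

Lemma deep_inner a : deep a -> inner a.
Proof. by rewrite /deep /inner; lia. Qed.

Lemma stepP (a b : grid_pt) :
  reflect ([\/ b = (a.1.+1, a.2), b = (a.1.-1, a.2), b = (a.1, a.2.+1) |
              b = (a.1, a.2.-1)]) (step a b).
Proof.
rewrite /step /nbrs !inE; apply: (iffP idP).
  by case/or4P=> /eqP ->; [constructor 1|constructor 2|constructor 3|constructor 4].
by case=> ->; rewrite eqxx ?orbT.
Qed.

Lemma step_sym a b : inner a -> step a b -> step b a.
Proof.
case: a => a1 a2; rewrite /inner /= => /andP[a1p a2p] /stepP /= H.
by apply/stepP; case: H => -> /=; rewrite ?prednK //;
  [constructor 2|constructor 1|constructor 4|constructor 3].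
Qed.

Lemma step_symE a b : inner a -> inner b -> step a b = step b a.
Proof. by move=> ia ib; apply/idP/idP; exact: step_sym. Qed.

Lemma nbrs_uniq a : inner a -> uniq (nbrs a).
Proof.
case: a => [[|i] [|j]] //= _; rewrite !inE !xpair_eqE /= !negb_or !negb_and.
by apply/and4P; split=> //; lia.
Qed.

Lemma step_irr a : inner a -> step a a = false.
Proof.
case: a => [[|i] [|j]] //= _; apply/negbTE.
by rewrite /step !inE !xpair_eqE /=; lia.
Qed.

(** A square is named after its lower left corner; these are the two squares on
    either side of the unit segment from [a] to its neighbour [b]. *)
Definition flank (a b : grid_pt) : grid_pt * grid_pt :=
  let m := (minn a.1 b.1, minn a.2 b.2) in
  (m, if a.1 == b.1 then (m.1.-1, m.2) else (m.1, m.2.-1)).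

Lemma flankC a b : flank a b = flank b a.
Proof. by rewrite /flank minnC (minnC a.2) eq_sym. Qed.

Definition bdry (s : grid_pt -> bool) (a b : grid_pt) : bool :=
  s (flank a b).1 (+) s (flank a b).2.

Lemma bdryC s a b : bdry s a b = bdry s b a.
Proof. by rewrite /bdry flankC. Qed.

Definition star_sum (c : grid_pt -> grid_pt -> bool) (a : grid_pt) : bool :=
  \big[addb/false]_(b <- nbrs a) c a b.

Lemma star_sum4 c a : star_sum c a =
  c a (a.1.+1, a.2) (+) (c a (a.1.-1, a.2) (+)
  (c a (a.1, a.2.+1) (+) c a (a.1, a.2.-1))).
Proof. by rewrite /star_sum /nbrs !big_cons big_nil addbF. Qed.

(** Around a lattice point every one of the four squares is met twice. *)
Lemma star_sum_bdry s a : inner a -> star_sum (bdry s) a = false.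
Proof.
case: a => [[|i] [|j]] //= _; rewrite star_sum4 /bdry /flank /=.
rewrite !minnn.
have -> : minn i.+1 i.+2 = i.+1 by lia.
have -> : minn j.+1 j.+2 = j.+1 by lia.
have -> : minn i.+1 i = i by lia.
have -> : minn j.+1 j = j by lia.
have -> : (i.+1 == i.+2) = false by lia.
have -> : (i.+1 == i) = false by lia.
rewrite !eqxx /=.
by do 4 case: (s _).
Qed.

(** A discrete Jordan theorem: an even finite set of unit segments is the
    boundary of the set of those squares from which a downward ray crosses it
    an odd number of times. *)
Lemma even_chain_bdry (c : grid_pt -> grid_pt -> bool) :
  (forall a b, c a b = c b a) ->
  (forall a b, c a b -> deep a) ->
  (forall a, deep a -> star_sum c a = false) ->
  exists s, forall a b, deep a -> step a b -> c a b = bdry s a b.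
Proof.
move=> csym cdeep ceven.
have cdeep2 a b : c a b -> deep b by rewrite csym; exact: cdeep.
pose s (q : grid_pt) := \big[addb/false]_(k < q.2.+1) c (q.1, k : nat) (q.1.+1, k : nat).
have ceven' a : star_sum c a = false.
  case: (boolP (deep a)) => [/ceven //|/negP nd].
  by rewrite star_sum4; do 4 (case: (boolP (c a _)) => [/cdeep //|_]).
exists s => a b da ab.
have hor i j : c (i, j.+1) (i.+1, j.+1) = s (i, j.+1) (+) s (i, j).
  by rewrite /s /= big_ord_recr /= addbAC addbb.
have ver i j : c (i.+1, j) (i.+1, j.+1) = s (i.+1, j) (+) s (i, j).
  elim: j => [|j IH].
    rewrite /s !big_ord1.
    have F x y : c (x, 0) y = false by apply/negP => /cdeep; rewrite /deep andbF.
    by rewrite !F.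
  have := ceven' (i.+1, j.+1); rewrite star_sum4 /=.
  rewrite [c _ (i, j.+1)]csym [c _ (i.+1, j)]csym IH !hor.
  by do 4 case: (s _); case: (c _ _).
case: a da ab => [[|[|i]] [|[|j]]] //= _ /stepP /=; rewrite /bdry /flank /=.
case=> -> /=.
- rewrite minnn (_ : minn _ _ = i.+2); last by lia.
  by rewrite (_ : (i.+2 == i.+3) = false) ?hor //; lia.
- rewrite minnn (_ : minn _ _ = i.+1); last by lia.
  by rewrite (_ : (i.+2 == i.+1) = false) 1?csym ?hor //; lia.
- rewrite minnn (_ : minn _ _ = j.+2); last by lia.
  by rewrite eqxx ver.
- rewrite minnn (_ : minn _ _ = j.+1); last by lia.
  by rewrite eqxx csym ver.
Qed.

(** * Lattice paths *)

Fixpoint chain (a : grid_pt) (p : seq grid_pt) (u v : grid_pt) : bool :=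
  if p is b :: p' then
    ((a == u) && (b == v)) (+) ((a == v) && (b == u)) (+) chain b p' u v
  else false.

Lemma chainC a p u v : chain a p u v = chain a p v u.
Proof. by elim: p a => //= b p IH a; rewrite IH; congr addb; rewrite addbC. Qed.

Lemma chain_mem a p u v : chain a p u v -> (u \in a :: p) && (v \in a :: p).
Proof.
elim: p a => //= b p IH a H; have {H} : (a == u) && (b == v) || (a == v) && (b == u) ||
   chain b p u v by move: H; do 2 case: (_ && _) => //=; case: chain.
rewrite !in_cons => /orP[/orP[]/andP[/eqP -> /eqP ->]|]; rewrite ?eqxx ?orbT //.
by move/IH; rewrite !in_cons => /andP[-> ->]; rewrite !orbT.
Qed.

Lemma chain_star a p u : all inner (a :: p) -> path step a p -> inner u ->
  star_sum (chain a p) u = (a == u) (+) (last a p == u).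
Proof.
elim: p a => [|b p IH] a /=; first by rewrite addbb /star_sum big1.
move=> /and3P[ia ib ip] /andP[ab pth] iu.
have := IH b; rewrite /star_sum /= ib ip => /(_ isT pth iu) IHb.
rewrite !big_split /= IHb.
have H x y : step x y -> inner x ->
    \big[addb/false]_(i <- nbrs u) ((x == u) && (y == i)) = (x == u).
  move=> xy ix; case: eqP => [<-|_] /=; last by rewrite big1.
  by rewrite big_addb_eq ?nbrs_uniq // -/(step _ _) xy.
rewrite H // (eq_bigr (fun i => (b == u) && (a == i))); last by move=> i _; rewrite andbC.
rewrite H //; last by rewrite step_sym.
by do 3 case: (_ == u).
Qed.

(** Where the boundary of a set of squares runs along a simple path it can
    neither begin nor end at an inner point of the path, so it follows the whole path. *)
Lemma bdry_path_const s x z q :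
  uniq (x :: z :: q) -> all inner (x :: z :: q) -> path step x (z :: q) ->
  (forall w b, w \in belast z q -> step w b -> ~~ chain x (z :: q) w b ->
     bdry s w b = false) ->
  forall u v, chain x (z :: q) u v -> bdry s u v = bdry s x z.
Proof.
elim: q x z => [|y q IH] x z; rewrite [path _ _ _]/=.
  move=> _ _ _ _ u v /=; rewrite addbF.
  case: (boolP (_ && _)) => [/andP[/eqP -> /eqP ->] //|_ /=] /andP[/eqP -> /eqP ->].
  exact: bdryC.
move=> U I /and3P[xz zy pth] H.
have xq : x \notin [:: z, y & q] by case/andP: U.
have U' : uniq [:: z, y & q] by case/andP: U.
have zq : z \notin y :: q by case/andP: U'.
have I' : all inner [:: z, y & q] by case/andP: I.
have iz : inner z by case/andP: I'.
have ix : inner x by case/andP: I.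
have zyE : bdry s z y = bdry s x z.
  have := star_sum_bdry s iz; rewrite /star_sum.
  rewrite (eq_big_seq (fun b => ((x == b) && bdry s z x) (+) ((y == b) && bdry s z y))).
    rewrite big_split /=.
    have F t : step z t -> \big[addb/false]_(i <- nbrs z) ((t == i) && bdry s z t) = bdry s z t.
      move=> zt; case: bdry; last by rewrite big1 // => i _; rewrite andbF.
      by under eq_bigr do rewrite andbT; rewrite big_addb_eq ?nbrs_uniq.
    rewrite (F _ (step_sym ix xz)) (F _ zy) (bdryC s z x).
    by do 2 case: bdry.
  move=> b zb.
  have xy : (x == y) = false.
    by apply/negbTE; apply: contra xq => /eqP ->; rewrite !inE eqxx orbT.
  case: (x =P b) => [<-|xb].
    by rewrite [y == x]eq_sym xy addbF.
  case: (y =P b) => [<- //|yb] /=.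
  apply: H => //; first by rewrite /= inE eqxx.
  have xz' : (x == z) = false.
    by apply/negbTE; apply: contra xq => /eqP ->; rewrite !inE eqxx.
  rewrite [chain _ _ _ _]/= xz' (negbTE (introN eqP xb)) /= eqxx (negbTE (introN eqP yb)) /=.
  have -> : (y == z) = false.
    by apply/negbTE; apply: contra zq => /eqP ->; rewrite !inE eqxx.
  rewrite andbF /=; apply/negP => /chain_mem /andP[h _]; by rewrite h in zq.
move=> u v; rewrite [chain _ _ _ _]/=.
case: (boolP ((x == u) && (z == v))) => [/andP[/eqP <- /eqP <-] //|_].
case: (boolP ((x == v) && (z == u))) => [/andP[/eqP -> /eqP ->] // _|_]; first exact: bdryC.
rewrite !addFb => huv; rewrite -zyE; apply: IH => //=.
  by rewrite zy.
move=> w b wq wb nc; apply: H => //=; first by rewrite in_cons wq orbT.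
have wq' : w \in y :: q by exact: mem_belast wq.
have -> : (x == w) = false.
  by apply/negbTE; apply: contra xq => /eqP ->; rewrite in_cons wq' orbT.
have zw : (z == w) = false.
  by apply/negbTE; apply: contra zq => /eqP ->.
by rewrite zw !andbF; move: nc => /=; rewrite zw.
Qed.

(** Cutting a walk from [X] to [Y] at its last point in [X] and then at its first
    point in [Y], and removing loops. *)
Lemma simple_link (X Y : pred grid_pt) a p :
  (forall w, X w -> Y w -> False) ->
  path step a p -> X a -> Y (last a p) ->
  exists a' p', [/\ path step a' p', uniq (a' :: p'), X a' /\ Y (last a' p'),
    {subset a' :: p' <= a :: p} &
    forall w, w \in a' :: p' -> (X w -> w = a') /\ (Y w -> w = last a' p')].
Proof.
move=> XY; have [n] := ubnP (size p); elim: n => // n IH in a p *.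
rewrite ltnS => szp pth Xa Yl.
case: (boolP (has X p)) => [/hasP[w wp Xw]|/hasPn nX].
  case/splitPr: wp szp pth Yl => p1 p2.
  rewrite size_cat /= cat_path last_cat /= => sz /and3P[_ _ p2p] Yl.
  have [|a' [p' [h1 h2 h3 h4 h5]]] := IH w p2 _ p2p Xw Yl; first by lia.
  exists a', p'; split=> // u /h4; rewrite !(inE, mem_cat) => /orP[->|->]; by rewrite !orbT.
case: (boolP (has (fun w => Y w && (w != last a p)) p)) => [/hasP[w wp /andP[Yw wl]]|/hasPn nY].
  case/splitPr: wp szp pth Yl wl nX => p1 p2.
  rewrite size_cat /= cat_path last_cat /= => sz /and3P[p1p p1w p2p] Yl wl nX.
  have [|||a' [p' [h1 h2 h3 h4 h5]]] := IH a (rcons p1 w) _ _ Xa; rewrite ?last_rcons //.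
  - by rewrite size_rcons; case: p2 sz wl {p2p Yl nX} => [|w2 p2] /=; rewrite ?eqxx //; lia.
  - by rewrite rcons_path p1p.
  exists a', p'; split=> // u /h4; rewrite !(inE, mem_cat, mem_rcons).
  by case/or3P=> ->; rewrite ?orbT.
case: (shortenP pth) Yl nY => p' pth' up' sub Yl nY.
exists a, p'; split=> //.
  by move=> u; rewrite !in_cons => /orP[->|/sub ->]; rewrite ?orbT.
move=> w; rewrite in_cons => /orP[/eqP ->|wp']; split=> //.
- by move=> Ya; case: (XY a).
- by move/negP: (nX w (sub _ wp')).
by move=> Yw; apply/eqP; move: (nY w (sub _ wp')); rewrite Yw /= negbK.
Qed.

(** * Abstract duals *)

Definition even_edges (T : finType) (C : {set {set T}}) : bool :=
  [forall v, ~~ odd #|[set e in C | v \in e]|].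

Definition dual_bdry (T Phi : finType) (E : {set {set T}}) (l r : {set T} -> Phi)
    (S : {set Phi}) : {set {set T}} :=
  [set e in E | (l e \in S) (+) (r e \in S)].

(** MacLane's form of planarity: an assignment of two faces to every edge for
    which the boundaries of sets of faces are precisely the even edge sets. *)
Definition has_dual (T : finType) (E : {set {set T}}) : Prop :=
  exists (Phi : finType) (l r : {set T} -> Phi),
    (forall phi, even_edges (dual_bdry E l r [set phi])) /\
    (forall C : {set {set T}}, C \subset E -> even_edges C -> exists S, C = dual_bdry E l r S).

(** Every vertex [v] owns a connected set [B v] of lattice points around a centre
    [b v], and every edge [e] a simple lattice path [W e] joining the sets of its
    two ends; outside these boxes the paths are disjoint.  What edges do near a
    common end is hidden inside the box of that end.  A set of squares is called legal when its boundary runs along the paths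
    and inside the boxes only; legal sets are the unions of faces. *)
Section LatticeModel.

Variables (T : finType) (E : {set {set T}}).
Variables (B : T -> seq grid_pt) (b : T -> grid_pt) (W : {set T} -> grid_pt * seq grid_pt).

Let onW e w := w \in (W e).1 :: (W e).2.
Let boxed w := exists v, w \in B v.

Hypothesis B_uniq : forall v, uniq (B v).
Hypothesis B_deep : forall v w, w \in B v -> deep w.
Hypothesis B_connected : forall v w, w \in B v ->
  exists p, [/\ path step (b v) p, last (b v) p = w & {subset b v :: p <= B v}].
Hypothesis B_disjoint : forall v v' w, w \in B v -> w \in B v' -> v = v'.
Hypothesis W_deep : forall e w, e \in E -> onW e w -> deep w.
Hypothesis W_path : forall e, e \in E -> path step (W e).1 (W e).2.
Hypothesis W_uniq : forall e, e \in E -> uniq ((W e).1 :: (W e).2).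
Hypothesis W_ends : forall e, e \in E -> exists x y,
  [/\ x != y, e = [set x; y], (W e).1 \in B x & last (W e).1 (W e).2 \in B y].
Hypothesis W_box : forall e w v, e \in E -> onW e w -> w \in B v ->
  v \in e /\ (w = (W e).1 \/ w = last (W e).1 (W e).2).
Hypothesis W_disjoint : forall e f w, e \in E -> f \in E -> onW e w -> onW f w ->
  ~ boxed w -> e = f.

Let wch e := chain (W e).1 (W e).2.

Let in_box u v := [exists x, (u \in B x) && (v \in B x)].
Let K u v := in_box u v || [exists e in E, wch e u v].

Lemma W_shape e : e \in E -> exists z q, (W e).2 = z :: q.
Proof.
move=> eE; have [x [y [xy _ h1 h2]]] := W_ends eE.
case: (W e).2 h2 => [|z q] /=; last by exists z, q.
by move=> h2; rewrite (B_disjoint h1 h2) eqxx in xy.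
Qed.

(** Segments are compared through their ends: an end outside all boxes lies on a
    single path, and two ends in different boxes name the two ends of the edge. *)
Lemma wch_inj e f u v : e \in E -> f \in E -> ~~ in_box u v ->
  wch e u v -> wch f u v -> e = f.
Proof.
move=> eE fE nuv he hf.
have /andP[ue ve] := chain_mem he; have /andP[uf vf] := chain_mem hf.
have [[x ux]|nu] := pselect (boxed u); last exact: (W_disjoint eE fE ue uf).
have [[y vy]|nv] := pselect (boxed v); last exact: (W_disjoint eE fE ve vf).
have xy : x != y.
  by apply/eqP => E'; move/existsP: nuv; apply; exists x; rewrite ux E' vy.
have F g : g \in E -> onW g u -> onW g v -> g = [set x; y].
  move=> gE ug vg; have [x' [y' [xy' gE' _ _]]] := W_ends gE.
  have [xg _] := W_box gE ug ux; have [yg _] := W_box gE vg vy.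
  apply/eqP; rewrite eq_sym eqEcard cards2 xy gE' cards2 xy' /= andbT.
  by rewrite -gE'; apply/subsetP => t /set2P[] ->.
by rewrite (F e) // (F f).
Qed.

Let first_step e := (head (W e).1 (W e).2).

Lemma first_step_chain e : e \in E ->
  [/\ wch e (W e).1 (first_step e), ~~ in_box (W e).1 (first_step e),
      step (W e).1 (first_step e) & onW e (first_step e)].
Proof.
move=> eE; have [z [q E2]] := W_shape eE.
have := W_uniq eE; have := W_path eE.
have [x [y [xy ee h1 h2]]] := W_ends eE.
have box := W_box eE.
rewrite /first_step /wch /onW in box h1 h2 *; rewrite E2 /= in box h1 h2 *.
move=> /andP[st pq] /andP[nz /andP[zq uq]].
split=> //; last by rewrite !inE eqxx orbT.
  rewrite !eqxx /=; case: eqP => [h|_] /=; first by rewrite h inE eqxx in nz.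
  by apply/negP => /chain_mem /andP[h _]; rewrite h in nz.
apply/existsP => -[t /andP[t1 t2]].
have tx := B_disjoint t1 h1; rewrite {t t1}tx in t2.
have zin : z \in [:: (W e).1, z & q] by rewrite !inE eqxx orbT.
have [_ [h|h]] := box _ _ zin t2; first by rewrite h inE eqxx in nz.
by move: xy; rewrite (B_disjoint t2 (_ : z \in B y)) ?eqxx // h.
Qed.

Let legal s := forall u v, deep u -> step u v -> ~~ K u v -> bdry s u v = false.

Let D (s : grid_pt -> bool) e := bdry s (W e).1 (first_step e).

(** Along a path the only segments that a legal boundary may use are those of the
    path itself, so the boundary contains the path entirely or not at all. *)
Lemma legal_const s e u v : legal s -> e \in E -> wch e u v -> bdry s u v = D s e.
Proof.
move=> ls eE; have [z [q E2]] := W_shape eE.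
have un : uniq ((W e).1 :: z :: q) by rewrite -E2; exact: W_uniq.
have := W_path eE; have box := W_box eE; have dp := W_deep eE.
rewrite /D /first_step /wch /onW in box dp *; rewrite E2 /= in box dp *.
move=> pth uv; apply: (@bdry_path_const _ _ _ q) => //.
  by apply/allP => w /dp /deep_inner.
move=> w t wb wt nc.
have wq : w \in z :: q by exact: mem_belast wb.
have wl : w <> last z q.
  move=> wl; move: un; rewrite cons_uniq => /andP[_].
  by rewrite lastI rcons_uniq -wl wb.
have wx : w <> (W e).1 by move=> wx; move: un; rewrite cons_uniq -wx wq.
have win : w \in (W e).1 :: z :: q by rewrite in_cons wq orbT.
have nbw : ~ boxed w by case=> y wy; have [_ []] := box _ _ win wy.
apply: ls => //; first exact: dp.
apply/norP; split; first by apply/existsP => -[y /andP[wy _]]; apply: nbw; exists y.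
apply/existsP => -[f /andP[fE hf]].
have /andP[wf _] := chain_mem hf.
have eqf : e = f by apply: (W_disjoint eE fE _ wf nbw); rewrite /onW E2.
by move: hf; rewrite -eqf /wch E2 (negbTE nc).
Qed.

(** Summing over a box, the segments inside cancel and only those leaving it
    remain. *)
Let leaving v (c : grid_pt -> grid_pt -> bool) :=
  \big[addb/false]_(a <- B v) \big[addb/false]_(t <- nbrs a | t \notin B v) c a t.

Lemma leavingE v c : (forall x y, c x y = c y x) ->
  leaving v c = \big[addb/false]_(a <- B v) star_sum c a.
Proof.
move=> cs; rewrite /leaving /star_sum.
under [RHS]eq_bigr => a _ do rewrite (bigID (mem (B v))) /=.
rewrite big_split /= [X in _ = addb X _](_ : _ = false) //.
pose F x y := step x y && c x y && (inner x && inner y) && (x \in B v) && (y \in B v).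
transitivity (\big[addb/false]_(x <- B v) \big[addb/false]_(y <- B v) F x y); last first.
  apply: big_addb_symm0 => [x y|x]; rewrite /F; last first.
    by case: (boolP (inner x)) => [/step_irr ->|_]; rewrite ?andbF.
  case: (boolP (inner x)) => ix; case: (boolP (inner y)) => iy; rewrite ?andbF //.
  by rewrite step_symE // cs; case: (x \in B v); case: (y \in B v); rewrite ?andbF ?andbT.
apply: eq_big_seq => x xB; have ix := deep_inner (B_deep xB).
rewrite [RHS](bigID (fun y => step x y && (y \in B v))) /=.
rewrite [X in _ = addb _ X]big1_seq ?addbF; last first.
  by move=> y /andP[h _]; rewrite /F; case: step h => //=; case: (y \in B v); rewrite ?andbF.
rewrite -[RHS]big_filter -big_filter.
rewrite (perm_big [seq i <- B v | step x i && (i \in B v)]).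
  apply: eq_big_seq => y; rewrite mem_filter => /andP[/andP[h1 h2] yB].
  by rewrite /F h1 ix xB yB (deep_inner (B_deep yB)) /= !andbT.
apply: uniq_perm; rewrite ?filter_uniq // ?nbrs_uniq // => y.
by rewrite !mem_filter /step; case: (y \in nbrs x); case: (y \in B v).
Qed.

Lemma leaving_bdry v s : leaving v (bdry s) = false.
Proof.
rewrite leavingE; last by move=> *; exact: bdryC.
by rewrite big1_seq // => a /andP[_ /B_deep /deep_inner ia]; exact: star_sum_bdry.
Qed.

Lemma leaving_wch v e : e \in E -> leaving v (wch e) = (v \in e).
Proof.
move=> eE; rewrite leavingE; last by move=> *; exact: chainC.
have [x [y [xy ee h1 h2]]] := W_ends eE.
rewrite (eq_big_seq (fun a => ((W e).1 == a) (+) (last (W e).1 (W e).2 == a))).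
  rewrite big_split /= !big_addb_eq //.
  have H u w : w \in B u -> (w \in B v) = (v == u).
    by move=> wu; apply/idP/eqP => [wv|-> //]; exact: B_disjoint wv wu.
  rewrite (H _ _ h1) (H _ _ h2) ee !inE.
  by case: eqP => [->|]; rewrite ?(negbTE xy).
move=> a aB; rewrite chain_star ?W_path //; last exact: deep_inner (B_deep aB).
by apply/allP => w ww; apply/deep_inner/(W_deep eE).
Qed.

(** The boundary of a set of squares leaves every box an even number of times, and
    outside the boxes it leaves only along the paths of the edges it contains. *)
Lemma legal_even s : legal s -> even_edges [set e in E | D s e].
Proof.
move=> ls; apply/forallP => v.
have := leaving_bdry v s; rewrite /leaving.
have -> : [set e in [set e in E | D s e] | v \in e] = [set e in E | D s e && (v \in e)].
  by apply/setP => e; rewrite !inE andbA.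
have dE : \big[addb/false]_(a <- B v) \big[addb/false]_(t <- nbrs a | t \notin B v) bdry s a t
   = \big[addb/false]_(a <- B v) \big[addb/false]_(t <- nbrs a | t \notin B v)
      \big[addb/false]_(e in E) (D s e && wch e a t).
  apply: eq_big_seq => a aB; rewrite big_seq_cond [RHS]big_seq_cond.
  apply: eq_bigr => t /andP[at_ ntB].
  have nbx : ~~ in_box a t.
    apply/existsP => -[w /andP[aw tw]]; move/negP: ntB; apply.
    by rewrite (B_disjoint aB aw).
  case: (boolP [exists e in E, wch e a t]) => [/existsP[e /andP[eE he]]|h].
    rewrite (bigD1 e) //= he andbT (legal_const ls eE he) big1 ?addbF //.
    move=> f /andP[fE fe]; apply/negbTE; rewrite negb_and; apply/orP; right.
    by apply: contra fe => hf; rewrite (wch_inj eE fE nbx he hf).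
  rewrite big1 => [|e eE].
    by apply: ls; rewrite ?(B_deep aB) // negb_or nbx.
  by move/existsPn: h => /(_ e); rewrite eE /= => /negbTE ->; rewrite andbF.
rewrite dE -big_addb_odd => H; apply/negbT; rewrite -[RHS]H.
under [RHS]eq_bigr do rewrite exchange_big /=.
rewrite [RHS]exchange_big /=; apply: eq_bigr => e eE.
case: (D s e) => /=; last by rewrite big1 // => a _; rewrite big1.
by rewrite -(leaving_wch v eE).
Qed.

(** Prolonging every path to the centres of its boxes makes all walks of the edges
    at a vertex end in the same lattice point, so that an even set of edges
    becomes an even set of unit segments, to which [even_chain_bdry] applies.
    The prolongations stay inside the boxes and leave legality untouched. *)
Lemma center_walk (e : {set T}) : e \in E -> exists c : grid_pt -> grid_pt -> bool,
  [/\ forall u v, c u v = c v u,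
      forall u v, c u v -> deep u /\ K u v,
      forall u, inner u -> star_sum c u = odd #|[set x in e | b x == u]| &
      forall f, f \in E -> c (W f).1 (first_step f) = (f == e)].
Proof.
move=> eE; have [x [y [xy ee h1 h2]]] := W_ends eE.
have [p1 [p1p l1 s1]] := B_connected h1; have [p2 [p2p l2 s2]] := B_connected h2.
pose c u v := wch e u v (+) (chain (b x) p1 u v (+) chain (b y) p2 u v).
have J z p u v : {subset b z :: p <= B z} -> chain (b z) p u v -> deep u /\ in_box u v.
  move=> sub /chain_mem /andP[/sub uB /sub vB].
  by split; [exact: B_deep uB|apply/existsP; exists z; rewrite uB].
have cK u v : c u v -> deep u /\ K u v.
  rewrite /c; case: (boolP (wch e u v)) => [he _|_].
    have /andP[ue _] := chain_mem he; split; first exact: (W_deep eE ue).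
    by apply/orP; right; apply/existsP; exists e; rewrite eE.
  rewrite addFb; case: (boolP (chain (b x) p1 u v)) => [h|_ /=].
    by have [? h'] := J _ _ _ _ s1 h; rewrite /K h'.
  by move/(J _ _ _ _ s2) => [? h']; rewrite /K h'.
exists c; split=> //.
- by move=> u v; rewrite /c /wch chainC; congr addb; rewrite chainC; congr addb; rewrite chainC.
- move=> u iu; rewrite /star_sum !big_split /= -!/(star_sum _ _).
  have I z p : {subset b z :: p <= B z} -> all inner (b z :: p).
    by move=> sub; apply/allP => w /sub /B_deep /deep_inner.
  rewrite !chain_star ?I ?W_path //; last first.
    by apply/allP => w ww; apply/deep_inner/(W_deep eE).
  rewrite l1 l2 -big_addb_odd ee big_setU1 ?inE //= big_set1.
  by do 4 case: (_ == u).
move=> f fE; have [hf nb stf _] := first_step_chain fE.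
rewrite /c.
have -> : chain (b x) p1 (W f).1 (first_step f) = false.
  by apply/negP => /(J _ _ _ _ s1) [_]; apply/negP.
have -> : chain (b y) p2 (W f).1 (first_step f) = false.
  by apply/negP => /(J _ _ _ _ s2) [_]; apply/negP.
rewrite !addbF; case: (eqVneq f e) => [<-|fe]; first by rewrite hf.
by apply/negP => he; move/eqP: fe; apply; exact: (wch_inj fE eE nb hf he).
Qed.

Lemma even_legal (C : {set {set T}}) : C \subset E -> even_edges C ->
  exists s, legal s /\ forall e, e \in E -> (e \in C) = D s e.
Proof.
move=> /subsetP CE ev.
have /choice[ch chP] : forall e : {set T}, exists c : grid_pt -> grid_pt -> bool, e \in E -> [/\ forall u v, c u v = c v u,
      forall u v, c u v -> deep u /\ K u v,
      forall u, inner u -> star_sum c u = odd #|[set x in e | b x == u]| &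
      forall f, f \in E -> c (W f).1 (first_step f) = (f == e)].
  move=> e; case: (boolP (e \in E)) => [/center_walk [c ?]|_]; first by exists c.
  by exists (fun _ _ => false).
pose c u v := \big[addb/false]_(e in C) ch e u v.
have c1 u v : c u v -> deep u /\ K u v.
  move=> cuv; have : [exists e in C, ch e u v].
    apply: contraT => /existsPn h; move: cuv; rewrite /c big1 // => e eC.
    by have := h e; rewrite eC => /negbTE.
  by move=> /existsP[e /andP[/CE eE]]; have [_ H _ _] := chP e eE; exact: H.
have csym u v : c u v = c v u.
  by apply: eq_bigr => e /CE eE; have [H _ _ _] := chP e eE.
have [||s sP] := even_chain_bdry csym (c := c).
- by move=> u v /c1 [].
- move=> u /deep_inner iu; rewrite /star_sum /c exchange_big /=.
  rewrite (eq_bigr (fun e : {set T} => \big[addb/false]_(x in e) (b x == u))); last first.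
    by move=> e /CE eE; have [_ _ H _] := chP e eE; rewrite -/(star_sum _ _) H // -big_addb_odd.
  rewrite (exchange_big_dep predT) //= big1 // => x _.
  case: (b x == u); last by rewrite big1.
  rewrite (eq_bigl (fun e => e \in [set e in C | x \in e])); last by move=> e; rewrite inE.
  rewrite (big_addb_odd _ xpredT).
  move/forallP: ev => /(_ x); rewrite (_ : [set e in _ | xpredT e] = [set e in C | x \in e]).
    by move/negbTE.
  by apply/setP => e; rewrite !inE andbT.
exists s; split.
  move=> u v du uv nK; rewrite -sP //; apply/negP => /c1 [_ k]; by rewrite k in nK.
move=> e eE; have [_ _ st _] := first_step_chain eE.
rewrite /D -sP //; last by apply: (W_deep eE); rewrite /onW inE eqxx.
rewrite /c (eq_bigr (fun f => e == f)); last first.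
  by move=> f /CE fE; have [_ _ _ H] := chP f fE; exact: H.
case: (boolP (e \in C)) => eC.
  rewrite (bigD1 e) //= eqxx big1 // => f /andP[_ fe]; apply/negbTE.
  by rewrite eq_sym.
rewrite big1 // => f fC; apply/negbTE; by apply: contra eC => /eqP ->.
Qed.

(** Faces are the classes of squares that no legal set of squares separates;
    only the squares next to a path matter, so the class of a square is
    recorded as the set of those of them that it contains. *)
Let sqr (ei : {set T} * bool) : grid_pt :=
  let f := flank (W ei.1).1 (first_step ei.1) in if ei.2 then f.1 else f.2.
Let same q q' := forall s, legal s -> s q = s q'.
Let cls x := [set y | `[< same (sqr x) (sqr y) >]].

Lemma cls_eq x y : same (sqr x) (sqr y) -> cls x = cls y.
Proof.
move=> h; apply/setP => z; rewrite !inE; apply/asboolP/asboolP => h' s ls.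
  by rewrite -h // h'.
by rewrite h // h'.
Qed.

Lemma cls_refl x : x \in cls x.
Proof. by rewrite inE; apply/asboolP. Qed.

(** A class of squares is itself a legal set, because the two squares on either
    side of a segment off the boxes and paths are never separated; hence its
    boundary is even.  Conversely an even edge set bounds a legal set, which is
    a union of classes. *)
Lemma lattice_has_dual : has_dual E.
Proof.
exists {set {set T} * bool}, (fun e => cls (e, true)), (fun e => cls (e, false)); split.
  move=> phi.
  pose s q := `[< exists x, cls x = phi /\ same (sqr x) q >].
  have ls : legal s.
    move=> u v du uv nK.
    have same12 : same (flank u v).1 (flank u v).2.
      by move=> s' ls'; have := ls' u v du uv nK; rewrite /bdry; do 2 case: (s' _).
    rewrite /bdry (_ : s _ = s (flank u v).2) ?addbb //.
    apply/asboolP/asboolP => -[x [xp h]]; exists x; split=> // s' ls'.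
      by rewrite h // same12.
    by rewrite h // same12.
  have sE x : s (sqr x) = (cls x == phi).
    apply/asboolP/eqP => [[y [<- h]]|<-]; last by exists x.
    by apply: cls_eq => s' ls'; rewrite h.
  have := legal_even ls; congr (is_true (even_edges _)).
  apply/setP => e; rewrite !inE; congr andb.
  by rewrite /D /bdry -!sE.
move=> C CE ev; have [s [ls sP]] := even_legal CE ev.
pose S := [set cls x | x in [pred x | s (sqr x)]].
have SE x : (cls x \in S) = s (sqr x).
  apply/imsetP/idP => [[y yin h]|h]; last by exists x.
  have := cls_refl y; rewrite -h inE => /asboolP h'.
  by rewrite h'.
exists S; apply/setP => e; rewrite !inE !SE.
case: (boolP (e \in E)) => [eE|eE] /=; first by rewrite sP.
by apply/negbTE; apply: contra eE; exact: (subsetP CE).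
Qed.

End LatticeModel.

(** * From sampled arcs to lattice paths *)

Definition near_pt (r : nat) (a w : grid_pt) : bool :=
  [&& a.1 <= w.1 + r, w.1 <= a.1 + r, a.2 <= w.2 + r & w.2 <= a.2 + r].

Lemma near_ptC r a w : near_pt r a w = near_pt r w a.
Proof. by rewrite /near_pt; lia. Qed.

Lemma near_pt_trans r s a w u : near_pt r a w -> near_pt s w u -> near_pt (r + s) a u.
Proof. by rewrite /near_pt; lia. Qed.

Definition box (r : nat) (a : grid_pt) : seq grid_pt :=
  [seq (i, j) | i <- iota (a.1 - r) (2 * r).+1, j <- iota (a.2 - r) (2 * r).+1].

Lemma mem_box r a w : r <= a.1 -> r <= a.2 -> (w \in box r a) = near_pt r a w.
Proof.
move=> h1 h2; case: w => i j; rewrite /box.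
apply/allpairsP/idP.
  by case=> -[i' j'] [+ + [-> ->]]; rewrite !mem_iota /near_pt /=; lia.
case/and4P; rewrite -![(i, j).1]/i -![(i, j).2]/j => g1 g2 g3 g4.
have h3 : i \in iota (a.1 - r) (2 * r).+1 by rewrite mem_iota; lia.
have h4 : j \in iota (a.2 - r) (2 * r).+1 by rewrite mem_iota; lia.
by exists (i, j).
Qed.

Lemma box_uniq r a : uniq (box r a).
Proof. by apply: allpairs_uniq; rewrite ?iota_uniq // => -[? ?] [? ?]. Qed.

Lemma box_connected r a w : near_pt r a w ->
  exists p, [/\ path step a p, last a p = w & forall u, u \in a :: p -> near_pt r a u].
Proof.
have [n] := ubnP ((w.1 - a.1) + (a.1 - w.1) + ((w.2 - a.2) + (a.2 - w.2))).
elim: n w => // n IH [i j] /=; case: a IH => a1 a2 /= IH hn ha.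
have H w : near_pt r (a1, a2) w -> step w (i, j) ->
    (w.1 - a1) + (a1 - w.1) + ((w.2 - a2) + (a2 - w.2)) < n ->
    exists p, [/\ path step (a1, a2) p, last (a1, a2) p = (i, j) &
      forall u, u \in (a1, a2) :: p -> near_pt r (a1, a2) u].
  move=> hw st lt; have [p [p1 p2 p3]] := IH w lt hw.
  exists (rcons p (i, j)); rewrite rcons_path last_rcons p1 p2; split=> // u.
  by rewrite -rcons_cons mem_rcons in_cons => /orP[/eqP -> //|]; exact: p3.
rewrite /near_pt /= in ha.
case: (ltngtP i a1) => h1.
- by apply: (H (i.+1, j)); [rewrite /near_pt /=; lia|apply/stepP; constructor 2|rewrite /=; lia].
- apply: (H (i.-1, j)); [rewrite /near_pt /=; lia| |rewrite /=; lia].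
  by apply/stepP; constructor 1; rewrite /= prednK //; lia.
subst i; case: (ltngtP j a2) => h2.
- by apply: (H (a1, j.+1)); [rewrite /near_pt /=; lia|apply/stepP; constructor 4|rewrite /=; lia].
- apply: (H (a1, j.-1)); [rewrite /near_pt /=; lia| |rewrite /=; lia].
  by apply/stepP; constructor 3; rewrite /= prednK //; lia.
by subst j; exists [::]; split=> // u; rewrite inE => /eqP ->; rewrite /near_pt /=; lia.
Qed.

(** Consecutive samples differ by at most one in each coordinate, so a detour
    within distance 1 of the samples links them by unit steps. *)
Lemma sampled_walk (q : nat -> grid_pt) m :
  (forall k, k < m -> near_pt 1 (q k) (q k.+1)) ->
  exists p, [/\ path step (q 0) p, last (q 0) p = q m &
    forall w, w \in q 0 :: p -> exists2 k, k <= m & near_pt 1 (q k) w].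
Proof.
elim: m => [|m IH] H.
  exists [::]; split=> // w; rewrite inE => /eqP ->; exists 0 => //.
  by rewrite /near_pt; lia.
have [|p [p1 p2 p3]] := IH; first by move=> k km; apply: H; exact: ltnW.
have [p' [p1' p2' p3']] := box_connected (H m (ltnSn m)).
exists (p ++ p'); rewrite cat_path last_cat p1 p2 p1' p2'; split=> // w.
rewrite -cat_cons mem_cat => /orP[/p3 [k km hk]|wp'].
  by exists k => //; exact: leqW.
by exists m => //; apply: p3'; rewrite in_cons wp' orbT.
Qed.

(** Boxes of radius [r + 1] around the vertices absorb every meeting of two
    different arcs, because samples that come within distance 2 of each other lie
    within [r] of a vertex, and a lattice path strays from its samples by at most
    1.  Each path is then cut down to a part that touches only the boxes of its
    two ends, and those only with its first and last point. *)
Section Samples.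

Variables (T : finType) (E : {set {set T}}) (b : T -> grid_pt) (r m : nat).
Variable (q : {set T} -> nat -> grid_pt).

Hypothesis b_deep : forall v, (r.+2 < (b v).1) && (r.+2 < (b v).2).
Hypothesis b_apart : forall v v', v != v' -> ~~ near_pt (r.+1 + r.+1) (b v) (b v').
Hypothesis q_deep : forall e k, e \in E -> k <= m -> (2 < (q e k).1) && (2 < (q e k).2).
Hypothesis q_step : forall e k, e \in E -> k < m -> near_pt 1 (q e k) (q e k.+1).
Hypothesis q_ends : forall e, e \in E ->
  exists x y, [/\ x != y, e = [set x; y], q e 0 = b x & q e m = b y].
Hypothesis q_far : forall e k z, e \in E -> k <= m -> z \notin e ->
  ~~ near_pt (r.+1 + 1) (b z) (q e k).
Hypothesis q_apart : forall e f k k', e \in E -> f \in E -> e != f ->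
  k <= m -> k' <= m -> near_pt (1 + 1) (q e k) (q f k') ->
  exists v, near_pt r (b v) (q e k).

Lemma samples_has_dual : has_dual E.
Proof.
pose B v := box r.+1 (b v).
have BE v w : (w \in B v) = near_pt r.+1 (b v) w.
  by apply: mem_box; have := b_deep v; lia.
have Bdisj v v' w : w \in B v -> w \in B v' -> v = v'.
  rewrite !BE near_ptC => h h'; apply/eqP/negPn/negP => /b_apart /negP; apply.
  by rewrite near_ptC in h; rewrite near_ptC in h'; move: h h'; rewrite /near_pt; lia.
have /choice[W WP] : forall e, exists W : grid_pt * seq grid_pt, e \in E ->
    [/\ path step W.1 W.2, uniq (W.1 :: W.2),
      exists x y, [/\ x != y, e = [set x; y], W.1 \in B x & last W.1 W.2 \in B y],
      forall w, w \in W.1 :: W.2 -> exists2 k, k <= m & near_pt 1 (q e k) w &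
      forall w v, v \in e -> w \in W.1 :: W.2 -> w \in B v -> w = W.1 \/ w = last W.1 W.2].
  move=> e; case: (boolP (e \in E)) => [eE|_]; last by exists ((0, 0), [::]).
  have [x [y [xy ee q0 qm]]] := q_ends eE.
  have [p [p1 p2 p3]] := sampled_walk (fun k => @q_step e k eE).
  have [|||a' [p' [h1 h2 [h3 h3'] h4 h5]]] :=
     @simple_link (mem (B x)) (mem (B y)) _ p _ p1.
  - by move=> w /= wx wy; move: xy; rewrite (Bdisj _ _ _ wx wy) eqxx.
  - by rewrite /= BE q0 /near_pt; lia.
  - by rewrite /= p2 BE qm /near_pt; lia.
  exists (a', p'); rewrite /=; split=> //.
  - by exists x, y.
  - by move=> w /h4 /p3.
  move=> w v; rewrite ee => /set2P[] -> wp /=.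
    by have [h _] := h5 w wp => /h; left.
  by have [_ h] := h5 w wp => /h; right.
apply: (@lattice_has_dual _ _ B b W).
- by move=> v; exact: box_uniq.
- move=> v w; rewrite BE /near_pt /deep; have := b_deep v; lia.
- move=> v w; rewrite BE => /box_connected [p [p1 p2 p3]]; exists p; split=> // u /p3.
  by rewrite BE.
- exact: Bdisj.
- move=> e w eE; have [_ _ _ H _] := WP e eE => /H [k km].
  have := q_deep eE km; rewrite /near_pt /deep; lia.
- by move=> e eE; have [] := WP e eE.
- by move=> e eE; have [] := WP e eE.
- by move=> e eE; have [] := WP e eE.
- move=> e w v eE we wv; have [_ _ _ H H'] := WP e eE.
  have ve : v \in e.
    have [k km hk] := H w we.
    apply/negPn/negP => /(q_far eE km) /negP; apply.
    by move: wv hk; rewrite BE /near_pt; lia.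
  by split=> //; exact: H' wv.
move=> e f w eE fE we wf nb; apply/eqP/negPn/negP => ef; apply: nb.
have [_ _ _ H _] := WP e eE; have [k km hk] := H w we.
have [_ _ _ H' _] := WP f fE; have [k' km' hk'] := H' w wf.
have [|v hv] := q_apart eE fE ef km km'.
  by rewrite near_ptC in hk'; exact: near_pt_trans hk hk'.
by exists v; rewrite BE -addn1; exact: near_pt_trans hv hk.
Qed.

End Samples.

(** * Even edge sets, faces and separations *)

Section EdgeSets.
Variable T : finType.
Implicit Types (C D E A : {set {set T}}) (X Y : {set T}).

Definition edges_in X E := forall e, e \in E -> #|e| = 2 /\ e \subset X.

Lemma edge_ends X E e : edges_in X E -> e \in E ->
  exists x y, [/\ x != y, e = [set x; y], x \in X & y \in X].
Proof.
move=> EX eE; have [/eqP/cards2P[x [y [xy ee]]] /subsetP eX] := EX e eE.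
by exists x, y; split=> //; apply: eX; rewrite ee !inE eqxx ?orbT.
Qed.

Definition odd_at C v := \big[addb/false]_(e in C) (v \in e).

Lemma odd_atE C v : odd_at C v = odd #|[set e in C | v \in e]|.
Proof. exact: big_addb_odd. Qed.

Definition sdiff A C := [set e | (e \in A) (+) (e \in C)].

Lemma big_sdiff (P : pred {set T}) A C :
  \big[addb/false]_(e in sdiff A C) P e =
  \big[addb/false]_(e in A) P e (+) \big[addb/false]_(e in C) P e.
Proof.
rewrite [LHS]big_mkcond [X in _ = addb X _]big_mkcond [X in _ = addb _ X]big_mkcond.
rewrite -big_split; apply: eq_bigr => e _ /=.
by rewrite inE; case: (e \in A); case: (e \in C); case: (P e).
Qed.

Lemma odd_at_sdiff A C v : odd_at (sdiff A C) v = odd_at A v (+) odd_at C v.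
Proof. exact: big_sdiff. Qed.

Lemma even_edgesP C : reflect (forall v, odd_at C v = false) (even_edges C).
Proof.
apply: (iffP forallP) => H v; first by rewrite odd_atE; apply/negbTE.
by rewrite -odd_atE H.
Qed.

Lemma odd_at_handshake E X : edges_in X E ->
  \big[addb/false]_(v in X) odd_at E v = false.
Proof.
move=> EX; rewrite exchange_big /= big1 // => e eE.
have [c2 /subsetP eX] := EX e eE.
rewrite big_addb_odd (_ : [set v in X | v \in e] = e) ?c2 //.
by apply/setP => v; rewrite inE andb_idl // => /eX.
Qed.

Lemma odd_at1 (e : {set T}) v : odd_at [set e] v = (v \in e).
Proof. by rewrite /odd_at big_set1. Qed.

(** ** Counting the even edge sets from below *)

Definition even_family E := [set C in powerset E | even_edges C].

(** The sets of edges with a prescribed set of odd vertices, when there are any,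
    are the translates of one of them by the even sets.  The set of odd vertices has
    even size, so at most half of all vertex sets occur. *)
Lemma even_family_lower E X : edges_in X E -> X != set0 ->
  2 ^ (#|E|.+1) <= #|even_family E| * 2 ^ #|X|.
Proof.
move=> EX /set0Pn[x0 x0X].
pose oddset C := [set v in X | odd_at C v].
have sub C : C \in powerset E -> edges_in X C.
  by rewrite inE => /subsetP CE e /CE; exact: EX.
have fiber Y : #|[set C in powerset E | oddset C == Y]| <= #|even_family E|.
  have [->|/set0Pn[C0]] := eqVneq [set C in powerset E | oddset C == Y] set0.
    by rewrite cards0.
  rewrite inE => /andP[C0E /eqP C0Y].
  have inj : injective (sdiff C0).
    move=> A B /setP AB; apply/setP => e; have := AB e; rewrite !inE; exact: addbI.
  rewrite -(card_imset _ inj); apply: subset_leq_card; apply/subsetP => _ /imsetP[C + ->].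
  rewrite !inE => /andP[CE /eqP CY]; apply/andP; split.
    apply/subsetP => e; rewrite inE => h; rewrite inE in C0E.
    by move: h; case: (boolP (e \in C)) => [/(subsetP CE) //|_]; rewrite addbF => /(subsetP C0E).
  apply/even_edgesP => v; rewrite odd_at_sdiff.
  case: (boolP (v \in X)) => vX.
    have := C0Y; rewrite -CY => /setP/(_ v); rewrite !inE vX /= => ->; exact: addbb.
  have out D : D \in powerset E -> odd_at D v = false.
    move=> /sub DX; rewrite /odd_at big1 // => e /DX [_ /subsetP eX].
    by apply/negbTE; apply: contra vX => /eX.
  by rewrite !out // inE.
have im : #|oddset @: powerset E| <= 2 ^ #|X|.-1.
  have inj : {in oddset @: powerset E &, injective (fun Y => Y :\ x0)}.
    have key Y : Y \in oddset @: powerset E ->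
        (x0 \in Y) = \big[addb/false]_(v in X | v != x0) (v \in Y).
      case/imsetP=> C CE ->; have := odd_at_handshake (sub _ CE).
      rewrite (bigD1 x0) //= inE x0X /= => /negbT; rewrite negb_add => /eqP ->.
      by apply: eq_bigr => v /andP[vX _]; rewrite inE vX.
    move=> Y Y' hY hY' /setP YY; apply/setP => v.
    have same w : w != x0 -> (w \in Y) = (w \in Y').
      by move=> wx; have := YY w; rewrite !inE wx.
    have [->|] := eqVneq v x0; last exact: same.
    by rewrite (key _ hY) (key _ hY'); apply: eq_bigr => w /andP[_ /same].
  rewrite -(card_in_imset inj) (cardsD1 x0 X) x0X /= -card_powerset.
  apply: subset_leq_card; apply/subsetP => _ /imsetP[_ /imsetP[C _ ->] ->].
  by rewrite inE setSD //; apply/subsetP => v; rewrite inE => /andP[].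
have -> : 2 ^ #|E|.+1 = 2 * \sum_(Y in oddset @: powerset E) #|[set C in powerset E | oddset C == Y]|.
  rewrite expnS -card_powerset -sum1_card (partition_big oddset (mem (oddset @: powerset E))) /=.
    by congr (_ * _); apply: eq_bigr => Y _; rewrite -sum1dep_card.
  by move=> C CE; exact: imset_f.
have -> : #|X| = #|X|.-1.+1 by rewrite prednK // (cardsD1 x0) x0X.
rewrite expnS mulnCA leq_mul2l /= mulnC.
have h : \sum_(Y in oddset @: powerset E) #|[set C in powerset E | oddset C == Y]|
    <= #|oddset @: powerset E| * #|even_family E|.
  by rewrite -sum_nat_const; apply: leq_sum => Y _; exact: fiber.
by apply: leq_trans h _; rewrite leq_mul2r im orbT.
Qed.

(** ** Faces *)

Section Dual.
Variables (X : {set T}) (E : {set {set T}}) (Phi : finType) (l r : {set T} -> Phi).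
Hypothesis EX : edges_in X E.
Hypothesis dual_span : forall C : {set {set T}}, C \subset E -> even_edges C ->
  exists S, C = dual_bdry E l r S.

Definition face_bdry phi := dual_bdry E l r [set phi].

Lemma in_face_bdry phi e :
  (e \in face_bdry phi) = (e \in E) && ((l e == phi) (+) (r e == phi)).
Proof. by rewrite !inE. Qed.

Definition faces := [set phi | face_bdry phi != set0].

Lemma in_faces phi e : e \in face_bdry phi -> phi \in faces.
Proof. by move=> h; rewrite inE; apply/set0Pn; exists e. Qed.

(** Half of Euler's formula: every even set is a sum of face boundaries, and all of
    these add up to zero, so one of them is redundant.  Comparing with
    [even_family_lower] gives the inequality. *)
Lemma face_count : X != set0 -> faces != set0 -> #|E| + 2 <= #|X| + #|faces|.
Proof.
move=> X0 /set0Pn[f0 f0F].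
have : #|even_family E| <= 2 ^ #|faces|.-1.
  rewrite (cardsD1 f0 faces) f0F /= -card_powerset.
  apply: leq_trans (leq_imset_card (dual_bdry E l r) _).
  apply: subset_leq_card; apply/subsetP => C; rewrite !inE => /andP[CE ev].
  have [S ->] := dual_span CE ev.
  pose S' := if f0 \in S then faces :\: S else faces :&: S.
  have eS : dual_bdry E l r S = dual_bdry E l r S'.
    apply/setP => e; rewrite !inE; case: (boolP (e \in E)) => //= eE.
    have [lr|lr] := eqVneq (l e) (r e); first by rewrite lr !addbb.
    have lF : l e \in faces.
      by apply: (@in_faces _ e); rewrite in_face_bdry eE eqxx eq_sym (negbTE lr).
    have rF : r e \in faces.
      by apply: (@in_faces _ e); rewrite in_face_bdry eE eqxx (negbTE lr).
    rewrite /S'; case: ifP => _; rewrite ?in_setD ?in_setI lF rF //= !andbT.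
    by case: (_ \in S); case: (_ \in S).
  rewrite eS; apply: imset_f; rewrite inE /S'; apply/subsetP => phi.
  case: ifP => f0S; rewrite ?in_setD ?in_setI in_set1 => /andP[h1 h2].
    by rewrite h2 andbT; apply: contraNneq h1 => ->.
  by rewrite h1 andbT; apply: contraTneq h2 => ->; rewrite f0S.
have := even_family_lower EX X0 => low up.
have /(leq_trans low) : #|even_family E| * 2 ^ #|X| <= 2 ^ (#|faces|.-1 + #|X|).
  by rewrite expnD leq_mul2r up orbT.
rewrite leq_exp2l // => h.
have : 0 < #|faces| by apply/card_gt0P; exists f0.
by lia.
Qed.

Lemma face_bdry_parity (U : {set {set T}}) S :
  \big[addb/false]_(e in dual_bdry E l r S) (e \in U) =
  \big[addb/false]_(phi in S) \big[addb/false]_(e in face_bdry phi) (e \in U).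
Proof.
under [RHS]eq_bigr do rewrite big_mkcond.
rewrite exchange_big /= [LHS]big_mkcond; apply: eq_bigr => e _.
under [RHS]eq_bigr do rewrite in_face_bdry.
rewrite inE; case: (e \in E) => /=; last by rewrite big1.
case: (e \in U); last first.
  by rewrite big1 => [|phi _]; case: ifP.
have H f : \big[addb/false]_(i in S) (f == i) = (f \in S).
  rewrite -big_filter big_addb_eq ?mem_filter ?mem_index_enum ?andbT //.
  by rewrite filter_uniq // index_enum_uniq.
rewrite -(H (l e)) -(H (r e)) -big_split /=.
transitivity (\big[addb/false]_(i in S) ((l e == i) (+) (r e == i))); first by case: (\big[_/_]_(_ in _) _).
by apply: eq_bigr => i _; case: (_ (+) _).
Qed.

(** ** Separations *)

(** Connected and without cut vertex, as the absence of a proper splitting with at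
    most one common vertex. *)
Definition inseparable := forall X1 X2 : {set T}, X1 :|: X2 = X -> #|X1 :&: X2| <= 1 ->
  (forall e, e \in E -> (e \subset X1) || (e \subset X2)) -> X1 = X \/ X2 = X.

Lemma walk_edges A x y : connect (fun a b => (a != b) && ([set a; b] \in A)) x y ->
  exists P : {set {set T}}, P \subset A /\ forall v, odd_at P v = (v == x) (+) (v == y).
Proof.
case/connectP=> p; elim: p x => [|z p IH] x /=.
  move=> _ ->; exists set0; rewrite sub0set; split=> // v.
  by rewrite /odd_at big_set0 addbb.
move=> /andP[/andP[xz xzA] pth] ly; have [P [PA Pv]] := IH z pth ly.
exists (sdiff [set [set x; z]] P); split.
  apply/subsetP => e; rewrite inE in_set1; case: eqP => [-> //|_]; exact: (subsetP PA).
move=> v; rewrite odd_at_sdiff odd_at1 Pv !inE.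
case: (eqVneq v x) => [->|_]; rewrite ?(negbTE xz) //=.
by case: (v == z); case: (v == y).
Qed.

(** A walk that avoids [U] and leads from [v] to the other end of an edge of [U]
    would form with that edge an even set meeting [U] once; but even sets are
    sums of face boundaries, and these meet [U] evenly.  So [U] separates the
    far ends of its edges from whatever [v] reaches without [U], and in an
    inseparable graph [v] reaches nothing else. *)
Lemma umbrella_set v (U : {set {set T}}) : inseparable -> v \in X -> U \subset E ->
  (forall e, e \in U -> v \in e) ->
  (forall phi, \big[addb/false]_(e in face_bdry phi) (e \in U) = false) ->
  U != set0 -> forall e, e \in E -> v \in e -> e \in U.
Proof.
move=> insep vX UE Uv Uev U0.
pose rel a b := (a != b) && ([set a; b] \in E :\: U).
pose Y := [set w in X | connect rel v w].
have other e : e \in E -> v \in e -> exists2 w, e = [set v; w] & (v != w) && (w \in X).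
  move=> eE; have [x [y [xy -> xX yX]]] := edge_ends EX eE; rewrite !inE => /orP[] /eqP ->.
    by exists y; rewrite ?xy.
  by exists x; rewrite 1?setUC // eq_sym xy.
have UY w : [set v; w] \in U -> v != w -> w \notin Y.
  move=> eU vw; apply/negP; rewrite inE => /andP[_ /walk_edges [P [PA Pv]]].
  pose C := sdiff [set [set v; w]] P.
  have PE : P \subset E by apply: subset_trans PA (subsetDl _ _).
  have CE : C \subset E.
    apply/subsetP => e; rewrite inE in_set1; case: eqP => [-> _|_]; last exact: (subsetP PE).
    exact: (subsetP UE).
  have Cev : even_edges C.
    apply/even_edgesP => u; rewrite odd_at_sdiff odd_at1 Pv !inE.
    by case: (eqVneq u v) => [->|_]; rewrite ?(negbTE vw) //=; case: (u == w).
  have [S CS] := dual_span CE Cev.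
  have : \big[addb/false]_(e in C) (e \in U) = false.
    by rewrite CS face_bdry_parity big1 // => phi _; exact: Uev.
  rewrite big_sdiff big_set1 eU big1 // => e /(subsetP PA).
  by rewrite inE => /andP[/negbTE].
have YX : Y \subset X by apply/subsetP => w; rewrite inE => /andP[].
have vY : v \in Y by rewrite inE vX connect0.
have [|||E1|E2] := insep Y ((X :\: Y) :|: [set v]).
- apply/setP => w; rewrite !inE; case: (boolP (w \in X)) => wX /=; rewrite ?andbT.
    by case: connect; rewrite ?orbT.
  by apply/negbTE; apply: contra wX => /eqP ->.
- rewrite -(cards1 v); apply: subset_leq_card; apply/subsetP => w.
  by rewrite !inE; case: (connect _ v w) => /=; case: (w \in X); rewrite ?andbF.
- move=> e eE; case: (boolP (e \in U)) => eU.
    have [w ew /andP[vw wX]] := other e eE (Uv e eU).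
    apply/orP; right; rewrite ew subUset !sub1set !inE eqxx orbT /=.
    rewrite ew in eU; have := UY w eU vw; rewrite inE wX /= => ->.
    by rewrite orTb.
  have [a [b [ab ee aX bX]]] := edge_ends EX eE.
  have same : connect rel v a = connect rel v b.
    apply/idP/idP => h; apply: connect_trans h _; apply: connect1; rewrite /rel.
      by rewrite ab -ee inE eU.
    by rewrite eq_sym ab setUC -ee inE eU.
  rewrite ee !subUset !sub1set !inE aX bX same.
  by case: connect.
- case/set0Pn: U0 => e eU.
  have [w ew /andP[vw wX]] := other e (subsetP UE _ eU) (Uv e eU).
  by rewrite ew in eU; have := UY w eU vw; rewrite E1 wX.
move=> e eE ve; apply: contraT => eU; have [w ew /andP[vw wX]] := other e eE ve.
have := wX; rewrite -E2 !inE wX andbT [w == v]eq_sym (negbTE vw) orbF => /negP[].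
by apply: connect1; rewrite /rel vw -ew inE eU.
Qed.

End Dual.

End EdgeSets.

(** ** Short even sets *)

Ltac neq_rewrite := repeat match goal with
  | H : is_true (?x != ?y) |- _ =>
    rewrite ?(negbTE H); rewrite eq_sym in H; rewrite ?(negbTE H); clear H
  end.

Ltac split_uniq H := rewrite /= !inE !negb_or -?andbA in H;
  repeat match type of H with is_true (_ && _) =>
    let h := fresh "n" in case/andP: H => h H end.

Section ShortCycles.
Variable T : finType.
Implicit Types (C D E : {set {set T}}) (X Y : {set T}).

Lemma set2_eq (a b c d : T) :
  ([set a; b] == [set c; d]) = (a == c) && (b == d) || (a == d) && (b == c).
Proof.
apply/eqP/idP => [E|/orP[]/andP[/eqP -> /eqP ->] //]; last exact: setUC.
have ha : a \in [set c; d] by rewrite -E set21.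
have hb : b \in [set c; d] by rewrite -E set22.
have hc : c \in [set a; b] by rewrite E set21.
have hd : d \in [set a; b] by rewrite E set22.
move: ha hb hc hd; rewrite !inE => /orP[] /eqP -> /orP[] /eqP ->; rewrite ?eqxx ?orbT //=.
  by rewrite !orbb => _ /eqP ->; rewrite eqxx.
by rewrite !orbb => /eqP ->; rewrite eqxx.
Qed.

Lemma set2_addb (a b v : T) : a != b -> (v \in [set a; b]) = (v == a) (+) (v == b).
Proof. by rewrite !inE; case: (eqVneq v a) => [->|] //= /negbTE ->. Qed.

Lemma odd_at_seq (s : seq {set T}) v : uniq s ->
  odd_at [set e in s] v = \big[addb/false]_(e <- s) (v \in e).
Proof. by move=> us; rewrite big_uniq //=; apply: eq_bigl => e; rewrite inE. Qed.

Variables (X : {set T}) (C : {set {set T}}).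
Hypothesis CX : edges_in X C.
Hypothesis Cev : even_edges C.

Lemma edge_neq D a b : edges_in X D -> [set a; b] \in D -> a != b.
Proof. by move=> DX /DX []; rewrite cards2; case: (a != b). Qed.

Lemma next_edge D a b : edges_in X D -> even_edges D -> [set a; b] \in D ->
  exists d, [/\ d != a, d != b & [set b; d] \in D].
Proof.
move=> DX /even_edgesP /(_ b) + abD; rewrite /odd_at (bigD1 _ abD) /= set22 => odd1.
have : [exists e in D, (e != [set a; b]) && (b \in e)].
  apply: contraT => /existsPn h; move: odd1; rewrite big1 // => e /andP[/= eD ne].
  by apply/negbTE; have := h e; rewrite (eD : e \in D) ne.
case/existsP=> e /and3P[eD ne be].
have [x [y [xy ee _ _]]] := edge_ends DX eD.
have [d ed] : exists d, e = [set b; d].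
  by move: be; rewrite ee !inE => /orP[] /eqP ->; [exists y|exists x; rewrite setUC].
exists d; rewrite -ed eD; split=> //.
  by apply: contra ne => /eqP dE; rewrite ed dE setUC.
by rewrite eq_sym; apply: (edge_neq DX); rewrite -ed.
Qed.

Lemma even_edges_ge3 D a b : edges_in X D -> even_edges D -> [set a; b] \in D -> 2 < #|D|.
Proof.
move=> DX Dev ab; have nab := edge_neq DX ab.
have [d [da db bd]] := next_edge DX Dev ab.
have [f [fb fd df]] := next_edge DX Dev bd.
have us : uniq [:: [set a; b]; [set b; d]; [set d; f]].
  by rewrite /= !inE !set2_eq; neq_rewrite; rewrite ?andbF ?eqxx.
rewrite -(card_uniqP us : #|_| = 3); apply: subset_leq_card; apply/subsetP => e.
by rewrite !inE => /or3P[] /eqP ->.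
Qed.

(** An even set of at most five edges is a single cycle, because what a cycle
    leaves over would be an even set of at most two edges. *)
Lemma even_subset_full (s : seq {set T}) : #|C| <= 5 -> uniq s -> 2 < size s ->
  {subset s <= C} -> (forall v, \big[addb/false]_(e <- s) (v \in e) = false) ->
  C = [set e in s].
Proof.
move=> C5 us s3 sC sev.
have D0 : sdiff C [set e in s] = C :\: [set e in s].
  apply/setP => e; rewrite !inE; case: (boolP (e \in s)) => [/sC ->//|_]; by rewrite addbF.
apply/eqP; rewrite eqEsubset; apply/andP; split; last first.
  by apply/subsetP => e; rewrite inE => /sC.
rewrite -setD_eq0 -D0; apply/negPn/negP => /set0Pn[e eD].
have DX : edges_in X (sdiff C [set e in s]).
  by rewrite D0 => f; rewrite inE => /andP[_ /CX].
have Dev : even_edges (sdiff C [set e in s]).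
  apply/even_edgesP => v; rewrite odd_at_sdiff odd_at_seq // sev addbF.
  by move/even_edgesP: Cev.
have [a [b [_ ee _ _]]] := edge_ends DX eD; rewrite ee in eD.
have := even_edges_ge3 DX Dev eD; rewrite D0 cardsD.
have -> : C :&: [set e in s] = [set e in s].
  by apply/setIidPr/subsetP => f; rewrite inE => /sC.
have -> : #|[set e in s]| = size s by rewrite cardsE; apply/card_uniqP.
by lia.
Qed.

(** Following edges from [a b] never stops at an even vertex, and five edges force
    the walk to close at [a]: closing earlier would leave [a b] outside a cycle
    that is already everything. *)
Lemma short_cycle a b : #|C| <= 5 -> [set a; b] \in C ->
  [\/ exists d, uniq [:: a; b; d] /\ C = [set e in [:: [set a; b]; [set b; d]; [set d; a]]],
      exists d f, uniq [:: a; b; d; f] /\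
        C = [set e in [:: [set a; b]; [set b; d]; [set d; f]; [set f; a]]] |
      exists d f g, uniq [:: a; b; d; f; g] /\
        C = [set e in [:: [set a; b]; [set b; d]; [set d; f]; [set f; g]; [set g; a]]]].
Proof.
move=> C5 ab; have n01 := edge_neq CX ab.
have nxt := next_edge CX Cev.
have [d [n20 n21 bd]] := nxt _ _ ab.
have [f [n31 n32 df]] := nxt _ _ bd.
have full := even_subset_full C5.
have [fa|n30] := eqVneq f a.
  subst f; constructor 1; exists d; split.
    by rewrite /= !inE; neq_rewrite.
  apply: full => //.
  - by rewrite /= !inE !set2_eq; neq_rewrite; rewrite ?andbF ?eqxx.
  - by move=> e; rewrite !inE => /or3P[] /eqP ->.
  move=> v; rewrite !big_cons big_nil !set2_addb; first (by case: (v == a); case: (v == b); case: (v == d));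
    by [|rewrite eq_sym].
have [g [n42 n43 fg]] := nxt _ _ df.
have [ga|n40] := eqVneq g a.
  subst g; constructor 2; exists d, f; split.
    by rewrite /= !inE; neq_rewrite.
  apply: full => //.
  - by rewrite /= !inE !set2_eq; neq_rewrite; rewrite ?andbF ?eqxx.
  - by move=> e; rewrite !inE => /or4P[] /eqP ->.
  move=> v; rewrite !big_cons big_nil !set2_addb; first (by case: (v == a); case: (v == b); case: (v == d); case: (v == f));
    by [|rewrite eq_sym].
have [gb|n41] := eqVneq g b.
  subst g; exfalso; have F : C = [set e in [:: [set b; d]; [set d; f]; [set f; b]]].
    apply: full => //.
    - by rewrite /= !inE !set2_eq; neq_rewrite; rewrite ?andbF ?eqxx.
    - by move=> e; rewrite !inE => /or3P[] /eqP ->.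
    move=> v; rewrite !big_cons big_nil !set2_addb; first (by case: (v == b); case: (v == d); case: (v == f));
      by [|rewrite eq_sym].
  move: ab; rewrite F !inE !set2_eq; neq_rewrite; by rewrite ?andbF.
have [i [n53 n54 gi]] := nxt _ _ fg.
have [ia|n50] := eqVneq i a.
  subst i; constructor 3; exists d, f, g; split.
    by rewrite /= !inE; neq_rewrite.
  apply: full => //.
  - by rewrite /= !inE !set2_eq; neq_rewrite; rewrite ?andbF ?eqxx.
  - by move=> e; rewrite !inE => /or4P[| | |/orP[]] /eqP ->.
  move=> v; rewrite !big_cons big_nil !set2_addb; first (by case: (v == a); case: (v == b); case: (v == d); case: (v == f); case: (v == g));
    by [|rewrite eq_sym].
exfalso; have [ib|n51] := eqVneq i b.
  subst i; have F : C = [set e in [:: [set b; d]; [set d; f]; [set f; g]; [set g; b]]].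
    apply: full => //.
    - by rewrite /= !inE !set2_eq; neq_rewrite; rewrite ?andbF ?eqxx.
    - by move=> e; rewrite !inE => /or4P[] /eqP ->.
    move=> v; rewrite !big_cons big_nil !set2_addb; first (by case: (v == b); case: (v == d); case: (v == f); case: (v == g));
      by [|rewrite eq_sym].
  move: ab; rewrite F !inE !set2_eq; neq_rewrite; by rewrite ?andbF.
have [id|n52] := eqVneq i d.
  subst i; have F : C = [set e in [:: [set d; f]; [set f; g]; [set g; d]]].
    apply: full => //.
    - by rewrite /= !inE !set2_eq; neq_rewrite; rewrite ?andbF ?eqxx.
    - by move=> e; rewrite !inE => /or3P[] /eqP ->.
    move=> v; rewrite !big_cons big_nil !set2_addb; first (by case: (v == d); case: (v == f); case: (v == g));
      by [|rewrite eq_sym].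
  move: ab; rewrite F !inE !set2_eq; neq_rewrite; by rewrite ?andbF.
have [j [n64 n65 ij]] := nxt _ _ gi.
pose s := [:: [set a; b]; [set b; d]; [set d; f]; [set f; g]; [set g; i]; [set i; j]].
have us : uniq s.
  by rewrite /s /= !inE !set2_eq; neq_rewrite; rewrite ?andbF ?eqxx.
have : #|s| <= #|C|.
  apply: subset_leq_card; apply/subsetP => e.
  by rewrite !inE => /or4P[| | |/or3P[]] /eqP ->.
have -> : #|s| = 6 by exact: (card_uniqP us).
by move=> C6; have := leq_trans C6 C5.
Qed.

End ShortCycles.

(** * Triangular faces and their neighbours *)

Lemma above_2_cases n : 2 < n -> n <> 3 -> [\/ n = 4, n = 5 | 5 < n].
Proof. by move: n => [|[|[|[|[|[|n]]]]]] //= _ _; [constructor 1|constructor 2|constructor 3]. Qed.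

Definition K4_free (T : finType) (E : {set {set T}}) := forall a b c d : T,
  [set a; b] \in E -> [set a; c] \in E -> [set a; d] \in E ->
  [set b; c] \in E -> [set b; d] \in E -> [set c; d] \in E -> False.

Definition theta_free (T : finType) (E : {set {set T}}) := forall a b c d e f : T,
  uniq [:: a; b; c; d; e; f] ->
  [set a; b] \in E -> [set b; c] \in E -> [set c; d] \in E -> [set d; e] \in E ->
  [set e; f] \in E -> [set f; a] \in E -> [set a; c] \in E -> False.

Section Discharge.
Variables (T : finType) (X : {set T}) (E : {set {set T}}).
Variables (Phi : finType) (l r : {set T} -> Phi).
Hypothesis EX : edges_in X E.
Hypothesis dual_even : forall phi, even_edges (dual_bdry E l r [set phi]).
Hypothesis dual_span : forall C : {set {set T}}, C \subset E -> even_edges C ->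
  exists S, C = dual_bdry E l r S.
Hypothesis insep : inseparable X E.
Hypothesis X6 : 5 < #|X|.
Hypothesis mindeg : forall v, v \in X -> 2 < #|[set e in E | v \in e]|.
Hypothesis noK4 : K4_free E.
Hypothesis noTheta : theta_free E.

Let adj x y := [set x; y] \in E.
Let fb := face_bdry E l r.
Let sd f x y := [set x; y] \in fb f.
Let len f := #|fb f|.

Let adjC x y : adj x y = adj y x. Proof. by rewrite /adj setUC. Qed.
Let sdC f x y : sd f x y = sd f y x. Proof. by rewrite /sd setUC. Qed.

Let fb_sub f : fb f \subset E.
Proof. by apply/subsetP => e; rewrite in_face_bdry => /andP[]. Qed.

Let sd_adj f x y : sd f x y -> adj x y. Proof. exact: (subsetP (fb_sub f)). Qed.

Let adj_neq x y : adj x y -> x != y. Proof. exact: edge_neq EX. Qed.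

Let adj_in x y : adj x y -> (x \in X) && (y \in X).
Proof. by move=> /EX [_ /subsetP h]; rewrite !h ?set21 ?set22. Qed.

Let fbX f : edges_in X (fb f). Proof. by move=> e /(subsetP (fb_sub f)); exact: EX. Qed.

Ltac adjt := match goal with |- is_true (adj ?x ?y) => first [ assumption
  | rewrite adjC; assumption
  | match goal with
    | H : is_true (sd _ x y) |- _ => exact (sd_adj H)
    | H : is_true (sd _ y x) |- _ => rewrite adjC; exact (sd_adj H)
    end ] end.

Ltac neqt := match goal with |- is_true (?x != ?y) => first [ assumption
  | rewrite eq_sym; assumption | apply: adj_neq; adjt ] end.

Ltac uniqt := rewrite /= ?inE ?negb_or -?andbA; repeat (apply/andP; split); try neqt; try done.

Lemma K4_false a b c d : adj a b -> adj a c -> adj a d -> adj b c -> adj b d -> adj c d -> False.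
Proof. exact: noK4. Qed.

Lemma theta_false a b c d e x : uniq [:: a; b; c; d; e; x] ->
  adj a b -> adj b c -> adj c d -> adj d e -> adj e a -> adj x a -> adj x b -> False.
Proof.
move=> U ab bc cd de ea xa xb.
have noTh : uniq [:: a; x; b; c; d; e] -> adj a x -> adj x b -> adj b c -> adj c d ->
  adj d e -> adj e a -> adj a b -> False by exact: noTheta.
apply: noTh; try adjt.
by split_uniq U; uniqt.
Qed.

Lemma sides f g x y : sd f x y -> sd g x y -> f != g ->
  forall h, sd h x y = (f == h) (+) (g == h).
Proof.
rewrite /sd !in_face_bdry => /andP[e1 H1] /andP[_ H2] fg h; rewrite in_face_bdry e1 /=.
move: H1 H2; case: (eqVneq (l [set x; y]) f) => [lf|lf]; case: (eqVneq (l [set x; y]) g) => [lg|lg] /=.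
- by move: fg; rewrite -lf lg eqxx.
- by rewrite lf => _ /eqP ->.
- by rewrite lg => /eqP -> _; rewrite addbC.
- by move=> /eqP E1 /eqP E2; move: fg; rewrite -E1 -E2 eqxx.
Qed.

Lemma third_side f g h x y : sd f x y -> sd g x y -> f != g -> sd h x y -> h = f \/ h = g.
Proof.
move=> h1 h2 fg; rewrite (sides h1 h2 fg) => H.
by case: (eqVneq f h) H => [->|_] /=; [left|move/eqP; right].
Qed.

Lemma len_neq f g : len f <> len g -> f != g.
Proof. by move=> h; apply/eqP => E'; apply: h; rewrite E'. Qed.

(** ** Closed umbrellas *)

(** [umbrella_set] in terms of neighbours: when every face uses an even number of
    the edges from [v] to [s], these are all edges at [v]. *)
Lemma umbrella v (s : seq T) : uniq s -> s != [::] -> (forall w, w \in s -> adj v w) ->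
  (forall f, \big[addb/false]_(w <- s) sd f v w = false) ->
  forall w, adj v w -> w \in s.
Proof.
move=> us s0 sadj sev w vw.
have vX : v \in X by case/andP: (adj_in vw).
have inj : injective (fun w => [set v; w]).
  move=> x y /eqP; rewrite set2_eq eqxx /= => /orP[/eqP //|/andP[/eqP <- /eqP <-] //].
pose U := [set e in [seq [set v; u] | u <- s]].
suff : [set v; w] \in U by rewrite inE => /mapP[u us' /inj ->].
apply: (@umbrella_set _ X E Phi l r EX dual_span v U insep vX).
- by apply/subsetP => e; rewrite inE => /mapP[u us' ->]; exact: sadj.
- by move=> e; rewrite inE => /mapP[u _ ->]; exact: set21.
- move=> f; rewrite -[RHS](sev f) big_mkcond /=.
  transitivity (\big[addb/false]_(e in U) (e \in fb f)).
    rewrite [RHS]big_mkcond; apply: eq_bigr => e _ /=.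
    by rewrite /fb; case: (e \in U); case: (e \in face_bdry E l r f).
  have -> : \big[addb/false]_(e in U) (e \in fb f) =
      \big[addb/false]_(e <- [seq [set v; u] | u <- s]) (e \in fb f).
    by rewrite big_uniq ?map_inj_uniq //; apply: eq_bigl => e; rewrite inE.
  by rewrite big_map.
- by case: s s0 @U {us sev sadj} => // u s _ U; apply/set0Pn; exists [set v; u]; rewrite !inE eqxx.
- exact: vw.
- exact: set21.
Qed.

(** Two faces that share two edges at a vertex close up around it, which leaves the
    vertex with degree 2. *)
Lemma deg2_false f g v a b : sd f v a -> sd g v a -> sd f v b -> sd g v b ->
  f != g -> a != b -> False.
Proof.
move=> fa ga fb' gb fg ab.
have U : uniq [:: a; b] by uniqt.
have vX : v \in X by case/andP: (adj_in (sd_adj fa)).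
have : #|[set e in E | v \in e]| <= size [:: [set v; a]; [set v; b]].
  apply: leq_trans (card_size _); apply: subset_leq_card; apply/subsetP => e.
  rewrite inE => /andP[eE ve].
  have [w ew] : exists w, e = [set v; w].
    have [x [y [_ ee _ _]]] := edge_ends EX eE.
    by move: ve; rewrite ee !inE => /orP[] /eqP ->; [exists y|exists x; rewrite setUC].
  have : w \in [:: a; b].
    apply: (@umbrella v [:: a; b]) => //; last by rewrite /adj -ew.
      by move=> u; rewrite !inE => /orP[] /eqP ->; adjt.
    by move=> h; rewrite !big_cons big_nil (sides fa ga fg) (sides fb' gb fg) addbF addbb.
  by rewrite ew !inE => /orP[] /eqP ->; rewrite eqxx ?orbT.
by rewrite leqNgt mindeg.
Qed.

Lemma umbrella3 v a b c f1 f2 f3 : uniq [:: a; b; c] ->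
  f1 != f2 -> f2 != f3 -> f1 != f3 ->
  sd f1 v a -> sd f2 v a -> sd f2 v b -> sd f3 v b -> sd f3 v c -> sd f1 v c ->
  forall w, adj v w -> w \in [:: a; b; c].
Proof.
move=> U n12 n23 n13 a1 a2 b2 b3 c3 c1; apply: umbrella => //.
  by move=> u; rewrite !inE => /or3P[] /eqP ->; adjt.
move=> h; rewrite !big_cons big_nil (sides a1 a2 n12) (sides b2 b3 n23) (sides c1 c3 n13).
by case: (f1 == h); case: (f2 == h); case: (f3 == h).
Qed.

Lemma umbrella4 v a b c d f1 f2 f3 f4 : uniq [:: a; b; c; d] ->
  f1 != f2 -> f2 != f3 -> f3 != f4 -> f4 != f1 ->
  sd f1 v a -> sd f2 v a -> sd f2 v b -> sd f3 v b -> sd f3 v c -> sd f4 v c ->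
  sd f4 v d -> sd f1 v d ->
  forall w, adj v w -> w \in [:: a; b; c; d].
Proof.
move=> U n12 n23 n34 n41 a1 a2 b2 b3 c3 c4 d4 d1; apply: umbrella => //.
  by move=> u; rewrite !inE => /or4P[] /eqP ->; adjt.
move=> h; rewrite !big_cons big_nil (sides a1 a2 n12) (sides b2 b3 n23) (sides c3 c4 n34) (sides d4 d1 n41).
by case: (f1 == h); case: (f2 == h); case: (f3 == h); case: (f4 == h).
Qed.

(** ** Short faces *)

Definition tri f a b c := [&& len f == 3, sd f a b, sd f b c & sd f c a].

Lemma triP f a b c : tri f a b c -> [/\ len f = 3, sd f a b, sd f b c & sd f c a].
Proof. by case/and4P=> /eqP. Qed.

Lemma tri_rot f a b c : tri f a b c -> tri f b c a.
Proof. by case/and4P=> h1 h2 h3 h4; rewrite /tri h1 h3 h4 h2. Qed.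

Lemma tri_flip f a b c : tri f a b c -> tri f b a c.
Proof. by case/and4P=> h1 h2 h3 h4; rewrite /tri h1 (sdC f b a) (sdC f a c) (sdC f c b) h2 h3 h4. Qed.

Lemma face3 f a b : len f = 3 -> sd f a b -> exists c, tri f a b c.
Proof.
move=> h3 ab; have h5 : len f <= 5 by rewrite h3.
have h3' : #|fb f| = 3 := h3.
have [] := short_cycle (@fbX f) (dual_even f) h5 ab.
- case=> c [U Fe]; exists c; rewrite /tri h3 eqxx /sd Fe !inE !eqxx ?orbT //.
- case=> c [d [U Fe]]; exfalso; move: h3'; rewrite Fe cardsE.
  split_uniq U; rewrite (card_uniqP _) //=.
  by rewrite !inE !set2_eq; neq_rewrite; rewrite ?andbF ?eqxx.
case=> c [d [g [U Fe]]]; exfalso; move: h3'; rewrite Fe cardsE.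
split_uniq U; rewrite (card_uniqP _) //=.
by rewrite !inE !set2_eq; neq_rewrite; rewrite ?andbF ?eqxx.
Qed.

Definition quad f a b c d :=
  [&& len f == 4, uniq [:: a; b; c; d], sd f a b, sd f b c, sd f c d & sd f d a].

Lemma quadP f a b c d : quad f a b c d ->
  [/\ a != c, b != d, sd f a b, sd f b c & sd f c d /\ sd f d a].
Proof. by case/and5P=> _ U h1 h2 /andP[h3 h4]; split_uniq U. Qed.

Lemma face4 f a b : len f = 4 -> sd f a b -> exists c d, quad f a b c d.
Proof.
move=> h4 ab; have h5 : len f <= 5 by rewrite h4.
have h4' : #|fb f| = 4 := h4.
have [] := short_cycle (@fbX f) (dual_even f) h5 ab.
- case=> c [U Fe]; exfalso; move: h4'; rewrite Fe cardsE.
  split_uniq U; rewrite (card_uniqP _) //=.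
  by rewrite !inE !set2_eq; neq_rewrite; rewrite ?andbF ?eqxx.
- by case=> c [d [U Fe]]; exists c, d; rewrite /quad h4 eqxx U /sd Fe !inE !eqxx ?orbT.
case=> c [d [g [U Fe]]]; exfalso; move: h4'; rewrite Fe cardsE.
split_uniq U; rewrite (card_uniqP _) //=.
by rewrite !inE !set2_eq; neq_rewrite; rewrite ?andbF ?eqxx.
Qed.

Lemma face5 f a b : len f = 5 -> sd f a b -> exists c d g,
  [/\ uniq [:: a; b; c; d; g], sd f b c, sd f c d, sd f d g & sd f g a].
Proof.
move=> h5' ab; have h5 : len f <= 5 by rewrite h5'.
have h6 : #|fb f| = 5 := h5'.
have [] := short_cycle (@fbX f) (dual_even f) h5 ab.
- case=> c [U Fe]; exfalso; move: h6; rewrite Fe cardsE.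
  split_uniq U; rewrite (card_uniqP _) //=.
  by rewrite !inE !set2_eq; neq_rewrite; rewrite ?andbF ?eqxx.
- case=> c [d [U Fe]]; exfalso; move: h6; rewrite Fe cardsE.
  split_uniq U; rewrite (card_uniqP _) //=.
  by rewrite !inE !set2_eq; neq_rewrite; rewrite ?andbF ?eqxx.
by case=> c [d [g [U Fe]]]; exists c, d, g; rewrite U /sd Fe !inE !eqxx ?orbT.
Qed.

Lemma len_ge3 f a b : sd f a b -> 2 < len f.
Proof. move=> h; exact: (even_edges_ge3 (@fbX f) (dual_even f) h). Qed.

Lemma face_seq f (s : seq {set T}) : uniq s -> len f = size s ->
  {subset s <= fb f} -> fb f = [set e in s].
Proof.
move=> us sz sub; apply/esym/eqP; rewrite eqEcard; apply/andP; split.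
  by apply/subsetP => e; rewrite inE => /sub.
have -> : #|[set e in s]| = size s by rewrite cardsE; apply/card_uniqP.
by rewrite -sz.
Qed.

Lemma tri_seq f a b c : tri f a b c ->
  uniq [:: [set a; b]; [set b; c]; [set c; a]] /\
  fb f = [set e in [:: [set a; b]; [set b; c]; [set c; a]]].
Proof.
case/triP=> l3 ab bc ca.
have U : uniq [:: [set a; b]; [set b; c]; [set c; a]].
  have n1 : a != b by neqt.
  have n2 : b != c by neqt.
  have n3 : c != a by neqt.
  by rewrite /= !inE !set2_eq; neq_rewrite; rewrite ?andbF ?eqxx.
split=> //; apply: face_seq => //.
by move=> e; rewrite !in_cons in_nil orbF => /or3P[] /eqP ->.
Qed.

Lemma tri_full f a b c x y : tri f a b c -> sd f x y ->
  [|| ([set x; y] == [set a; b]), ([set x; y] == [set b; c]) | ([set x; y] == [set c; a])].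
Proof. by case/tri_seq=> _ fE; rewrite /sd fE !inE. Qed.

Lemma tri_third f a b c d : tri f a b c -> sd f a d -> d = b \/ d = c.
Proof.
move=> h /(tri_full h); have [_ ab bc ca] := triP h.
have n1 : a != b by neqt.
have n2 : b != c by neqt.
have n3 : c != a by neqt.
rewrite !set2_eq eqxx; neq_rewrite.
by rewrite /= ?orbF => /orP[] /eqP; [left|right].
Qed.

(** ** Local configurations *)

Lemma two_tri f g h x y : sd f x y -> sd g x y -> f != g -> len f = 3 -> len g = 3 ->
  len h <> 3 -> sd h x y -> False.
Proof. by move=> h1 h2 fg l1 l2 l3 /(third_side h1 h2 fg) [] E'; apply: l3; rewrite E'. Qed.

Lemma tri_apex_neq f g a b c d : tri f a b c -> tri g a b d -> f != g -> c != d.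
Proof.
move=> /triP[_ f1 f2 f3] /triP[_ g1 g2 g3] fg; apply/eqP => cd; subst d.
apply: (@deg2_false f g a b c) => //; rewrite ?(sdC _ a c) //; neqt.
Qed.

Lemma tri_apex_nadj f g a b c d : tri f a b c -> tri g a b d -> ~ adj c d.
Proof.
move=> /triP[_ f1 f2 f3] /triP[_ g1 g2 g3] cd.
by apply: (@K4_false a b c d); adjt.
Qed.

(** A triangle with a triangle on each of its sides is a hexagon with a short
    chord. *)
Lemma three_neighbours_false t t1 t2 t3 a b c x y z : tri t a b c ->
  tri t1 a b x -> tri t2 b c y -> tri t3 c a z -> t1 != t -> t2 != t -> t3 != t -> False.
Proof.
move=> T0 T1 T2 T3 n1 n2 n3.
have cx : c != x by rewrite eq_sym; exact: tri_apex_neq T1 T0 n1.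
have ay : a != y by rewrite eq_sym; exact: tri_apex_neq T2 (tri_rot T0) n2.
have bz : b != z by rewrite eq_sym; exact: tri_apex_neq T3 (tri_rot (tri_rot T0)) n3.
have [_ ab bc ca] := triP T0.
have [_ _ bx xa] := triP T1; have [_ _ cy yb] := triP T2; have [_ _ az zc] := triP T3.
have xy : x != y.
  apply/eqP => xy; subst y; exact: (@tri_apex_nadj _ _ _ _ _ _ T0 T1 (sd_adj cy)).
have yz : y != z.
  apply/eqP => yz; subst z; apply: (@tri_apex_nadj _ _ _ _ _ _ (tri_rot T0) T2 (sd_adj az)).
have zx : z != x.
  apply/eqP => zx; subst z; apply: (@tri_apex_nadj _ _ _ _ _ _ T0 T1); adjt.
by apply: (@theta_false a b y c z x); try adjt; uniqt.
Qed.

(** A quadrilateral on a side of a lone pair of triangles that avoided the other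
    apex [x] would complete a pentagon next to a triangle.  So it passes through
    [x], and a triangle on one of its two further sides would do the same with
    the pentagon around the pair. *)
Lemma pair_quad t t' u v w x Q : tri t u v w -> tri t' u v x -> t != t' ->
  sd Q u w -> len Q = 4 ->
  (forall f, len f = 3 -> sd f v w -> f = t) ->
  (forall f, len f = 3 -> sd f x v -> f = t') ->
  exists p, quad Q u w p x /\ 
    forall f, len f = 3 -> ~~ sd f w p /\ ~~ sd f p x.
Proof.
move=> B B' tt' Quw Q4 only_t only_t'.
have wx : w != x := tri_apex_neq B B' tt'.
have nwx : ~ adj w x := tri_apex_nadj B B'.
have [l3 uv vw wu] := triP B; have [l3' _ vx xu] := triP B'.
have tQ : t != Q by apply: len_neq; rewrite l3 Q4.
have t'Q : t' != Q by apply: len_neq; rewrite l3' Q4.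
have Q3 : len Q <> 3 by rewrite Q4.
have [p [q qd]] := face4 Q4 Quw; have [up wq _ wp [pq qu]] := quadP qd.
have vp : v != p.
  apply/eqP => vp; subst p.
  apply: (@deg2_false t Q w u v) => //; rewrite 1?sdC // sdC //.
have vq : v != q.
  apply/eqP => vq; subst q; apply: (@two_tri t t' Q u v) => //; first by case/triP: B'.
  by rewrite sdC.
have xp : x != p by apply/eqP => xp; subst p; apply: nwx; adjt.
have xq : x = q.
  apply/eqP; apply: contraT => xq; exfalso.
  by apply: (@theta_false u v w p q x); try adjt; uniqt.
subst q; exists p; split=> // f f3.
have npu : ~ adj p u.
  move=> pu; have : p \in [:: w; x; v].
    apply: (@umbrella3 u w x v t Q t') => //; rewrite 1?eq_sym //; try (by rewrite sdC); try adjt.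
      by uniqt.
    by case/triP: B'.
  by rewrite !inE; apply/negP; uniqt.
split; apply/negP => fs.
- have [y fy] := face3 f3 fs; have [_ _ py yw] := triP fy.
  have yx : y != x by apply/eqP => yx; subst y; apply: nwx; adjt.
  have yu : y != u by apply/eqP => yu; subst y; apply: npu; adjt.
  have yv : y != v.
    apply/eqP => yv; subst y; have ft := only_t f f3 yw; subst f.
    have [h|h] := tri_third (tri_rot (tri_rot B)) fs; first by rewrite h eqxx in up.
    by rewrite h eqxx in vp.
  by apply: (@theta_false w p x u v y); try adjt; uniqt.
have [y fy] := face3 f3 fs; have [_ _ xy yp] := triP fy.
have yw : y != w by apply/eqP => yw; subst y; apply: nwx; adjt.
have yu : y != u by apply/eqP => yu; subst y; apply: npu; adjt.
have yv : y != v.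
  apply/eqP => yv; subst y; have ft := only_t' f f3 xy; subst f.
  rewrite sdC in fs; have [h|h] := tri_third (tri_rot (tri_rot B')) fs.
    by rewrite h eqxx in up.
  by rewrite h eqxx in vp.
by apply: (@theta_false p x u v w y); try adjt; uniqt.
Qed.

(** A fan of three triangles around [h], seen from its end triangle [t1], whose two
    free sides are the spoke [h a] and the rim edge [a b]. *)
Section FanEnd.
Variables (t1 t2 t3 : Phi) (h a b c d : T).
Hypotheses (T1 : tri t1 h a b) (T2 : tri t2 h b c) (T3 : tri t3 h c d).
Hypotheses (n12 : t1 != t2) (n23 : t2 != t3).
Hypothesis only_ha : forall f, len f = 3 -> sd f h a -> f = t1.

Let L1 : len t1 = 3. Proof. by case/triP: T1. Qed.
Let L2 : len t2 = 3. Proof. by case/triP: T2. Qed.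
Let L3 : len t3 = 3. Proof. by case/triP: T3. Qed.
Let ha : sd t1 h a. Proof. by case/triP: T1. Qed.
Let ab : sd t1 a b. Proof. by case/triP: T1. Qed.
Let bh : sd t1 b h. Proof. by case/triP: T1. Qed.
Let hb : sd t2 h b. Proof. by case/triP: T2. Qed.
Let bc : sd t2 b c. Proof. by case/triP: T2. Qed.
Let ch : sd t2 c h. Proof. by case/triP: T2. Qed.
Let hc : sd t3 h c. Proof. by case/triP: T3. Qed.
Let cd : sd t3 c d. Proof. by case/triP: T3. Qed.
Let dh : sd t3 d h. Proof. by case/triP: T3. Qed.

Let ac : a != c.
Proof. exact: (tri_apex_neq (tri_flip (tri_rot (tri_rot T1))) T2 n12). Qed.
Let nac : ~ adj a c.
Proof. exact: (tri_apex_nadj (tri_flip (tri_rot (tri_rot T1))) T2). Qed.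
Let bd : b != d.
Proof. exact: (tri_apex_neq (tri_flip (tri_rot (tri_rot T2))) T3 n23). Qed.
Let nbd : ~ adj b d.
Proof. exact: (tri_apex_nadj (tri_flip (tri_rot (tri_rot T2))) T3). Qed.
Let ad : a != d.
Proof.
apply/eqP => E'; subst d.
have E3 : t3 = t1 by apply: only_ha => //; rewrite sdC.
have t1hc : sd t1 h c by rewrite -E3.
have [E4|E4] := tri_third T1 t1hc; first by move: ac; rewrite E4 eqxx.
have : adj b c by adjt.
by rewrite E4 => /adj_neq; rewrite eqxx.
Qed.

(** A quadrilateral on the spoke [h a] would form with [t1] a pentagon next to
    [t2]. *)
Lemma fan_end_outer S : sd S h a -> len S <> 3 -> len S <> 4.
Proof.
move=> Sha S3 S4; have [r0 [s qd]] := face4 S4 Sha.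
have [hr as_ _ ar [rs sh]] := quadP qd.
have t1S : t1 != S by apply: len_neq; rewrite L1 S4.
have br : b != r0.
  by apply/eqP => E'; subst r0; apply: (@deg2_false t1 S a h b) => //; rewrite 1?sdC //; neqt.
have bs : b != s.
  by apply/eqP => E'; subst s; apply: (@two_tri t1 t2 S b h) => //; rewrite sdC.
have cr : c != r0 by apply/eqP => E'; subst r0; apply: nac; adjt.
have cs : c != s.
  by apply/eqP => E'; subst s; apply: (@two_tri t2 t3 S c h) => //; rewrite sdC.
by apply: (@theta_false h b a r0 s c); try adjt; uniqt.
Qed.

(** A pentagon [h a r s u] on the spoke gives the forbidden graph with [t1], unless
    [s = b]; in that case [h c b r a] is a pentagon next to [t3].  The edge [a b]
    does not follow [h a] on it, since its two faces are [t1] and the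
    quadrilateral. *)
Lemma fan_end_both Q S : sd Q a b -> len Q = 4 -> sd S h a -> len S <> 3 -> 5 < len S.
Proof.
move=> Qab Q4 Sha S3.
have S4 := fan_end_outer Sha S3; have Sge := len_ge3 Sha.
have t1Q : t1 != Q by apply: len_neq; rewrite L1 Q4.
have [//|S5|//] := above_2_cases Sge S3; exfalso.
have [r0 [s [u [U ar rs su uh]]]] := face5 S5 Sha; split_uniq U.
have br : b != r0.
  apply/eqP => E'; subst r0; have [E2|E2] := third_side ab Qab t1Q ar.
    by apply: S3; rewrite E2.
  by apply: S4; rewrite E2.
have bu : b != u.
  by apply/eqP => E'; subst u; apply: (@two_tri t1 t2 S b h) => //; rewrite sdC.
have [E'|bs] := eqVneq b s; last first.
  by apply: (@theta_false h a r0 s u b); try adjt; uniqt.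
subst s.
have cr : c != r0 by apply/eqP => E'; subst r0; apply: nac; adjt.
have dr : d != r0 by apply/eqP => E'; subst r0; apply: nbd; adjt.
by apply: (@theta_false h c b r0 a d); try adjt; uniqt.
Qed.

End FanEnd.

(** Otherwise the pentagon [h b c d e] and the triangle [h a b] share an edge. *)
Lemma fan4_closes t1 t2 t3 t4 h a b c d e : tri t1 h a b -> tri t2 h b c ->
  tri t3 h c d -> tri t4 h d e -> t1 != t2 -> t2 != t3 -> t3 != t4 -> e = a.
Proof.
move=> T1 T2 T3 T4 n12 n23 n34.
have T2' := tri_flip (tri_rot (tri_rot T2)); have T3' := tri_flip (tri_rot (tri_rot T3)).
have T1' := tri_flip (tri_rot (tri_rot T1)).
have ac : a != c := tri_apex_neq T1' T2 n12.
have bd : b != d := tri_apex_neq T2' T3 n23.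
have ce : c != e := tri_apex_neq T3' T4 n34.
have nac : ~ adj a c := tri_apex_nadj T1' T2.
have nbd : ~ adj b d := tri_apex_nadj T2' T3.
have [_ ha ab bh] := triP T1; have [_ hb bc ch] := triP T2.
have [_ hc cd dh] := triP T3; have [_ hd de eh] := triP T4.
have ad : a != d by apply/eqP => E'; subst d; apply: nac; adjt.
have be : b != e by apply/eqP => E'; subst e; apply: nbd; adjt.
apply/eqP; apply: contraT => ea; exfalso.
by apply: (@theta_false h b c d e a); try adjt; uniqt.
Qed.

(** The other shape of four triangles in a row, a fan of three continued across its
    last rim edge, contains the pentagon [b h d e c] next to the triangle
    [a b h]. *)
Lemma strip4_false t1 t2 t3 t4 h a b c d e : tri t1 h a b -> tri t2 h b c ->
  tri t3 h c d -> tri t4 c d e -> t1 != t2 -> t2 != t3 -> t3 != t4 -> False.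
Proof.
move=> T1 T2 T3 T4 n12 n23 n34.
have T2' := tri_flip (tri_rot (tri_rot T2)); have T3' := tri_rot T3.
have T1' := tri_flip (tri_rot (tri_rot T1)).
have ac : a != c := tri_apex_neq T1' T2 n12.
have bd : b != d := tri_apex_neq T2' T3 n23.
have he : h != e := tri_apex_neq T3' T4 n34.
have nac : ~ adj a c := tri_apex_nadj T1' T2.
have nbd : ~ adj b d := tri_apex_nadj T2' T3.
have [_ ha ab bh] := triP T1; have [_ hb bc ch] := triP T2.
have [_ hc cd dh] := triP T3; have [_ _ de ec] := triP T4.
have ad : a != d by apply/eqP => E'; subst d; apply: nbd; adjt.
have be : b != e by apply/eqP => E'; subst e; apply: nbd; adjt.
have ae : a != e by apply/eqP => E'; subst e; apply: nac; adjt.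
by apply: (@theta_false b h d e c a); try adjt; uniqt.
Qed.

(** A pentagon outside the wheel is a pentagon next to a triangle of the wheel.  A
    quadrilateral outside has to run through the whole rim; then the wheel is
    closed off all around, and there is no room for a sixth vertex. *)
Lemma wheel_outer t1 t2 t3 t4 h a b c d P : tri t1 h a b -> tri t2 h b c ->
  tri t3 h c d -> tri t4 h d a -> t1 != t2 -> t2 != t3 -> t3 != t4 -> t4 != t1 ->
  sd P b c -> len P <> 3 -> 5 < len P.
Proof.
move=> T1 T2 T3 T4 n12 n23 n34 n41 Pbc P3.
have T2' := tri_flip (tri_rot (tri_rot T2)); have T3' := tri_flip (tri_rot (tri_rot T3)).
have T1' := tri_flip (tri_rot (tri_rot T1)).
have ac : a != c := tri_apex_neq T1' T2 n12.
have bd : b != d := tri_apex_neq T2' T3 n23.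
have nac : ~ adj a c := tri_apex_nadj T1' T2.
have nbd : ~ adj b d := tri_apex_nadj T2' T3.
have [L1 ha ab bh] := triP T1; have [L2 hb bc ch] := triP T2.
have [L3 hc cd dh] := triP T3; have [L4 hd da ah] := triP T4.
have inn x : x \in [:: a; b; c; d] -> sd P h x -> False.
  rewrite !inE => /or4P[] /eqP -> Ph.
  - by apply: (@two_tri t4 t1 P h a) => //; rewrite sdC.
  - by apply: (@two_tri t1 t2 P h b) => //; rewrite sdC.
  - by apply: (@two_tri t2 t3 P h c) => //; rewrite sdC.
  - by apply: (@two_tri t3 t4 P h d) => //; rewrite sdC.
have hub x : adj h x -> x \in [:: a; b; c; d].
  apply: (@umbrella4 h a b c d t4 t1 t2 t3) => //; rewrite 1?sdC //.
  by uniqt.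
have Pge := len_ge3 Pbc.
have hr_ r0 : sd P c r0 -> h != r0.
  move=> cr; apply/eqP => E'; subst r0; apply: (inn c); rewrite ?inE ?eqxx ?orbT //.
  by rewrite sdC.
have hs_ s : sd P s b -> h != s.
  by move=> sb; apply/eqP => E'; subst s; apply: (inn b); rewrite ?inE ?eqxx ?orbT.
have [P4|P5|//] := above_2_cases Pge P3.
  exfalso; have [r0 [s qd]] := face4 P4 Pbc; have [br cs _ cr [rs sb]] := quadP qd.
  have hr := hr_ _ cr; have hs := hs_ _ sb.
  have ds : d != s by apply/eqP => E'; subst s; apply: nbd; adjt.
  have ar : a != r0 by apply/eqP => E'; subst r0; apply: nac; adjt.
  have dr : d = r0.
    apply/eqP; apply: contraT => dr; exfalso.
    by apply: (@theta_false h c r0 s b d); try adjt; uniqt.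
  subst r0.
  have as_ : a = s.
    apply/eqP; apply: contraT => as_; exfalso.
    by apply: (@theta_false h b s d c a); try adjt; uniqt.
  subst s.
  have P1 : t1 != P by apply: len_neq; rewrite L1 P4.
  have P2 : t2 != P by apply: len_neq; rewrite L2 P4.
  have P3' : t3 != P by apply: len_neq; rewrite L3 P4.
  have P4' : t4 != P by apply: len_neq; rewrite L4 P4.
  have Ua : forall x, adj a x -> x \in [:: h; b; d].
    apply: (@umbrella3 a h b d t4 t1 P) => //; try (by rewrite sdC); try by [].
    by uniqt.
  have Ub : forall x, adj b x -> x \in [:: h; c; a].
    apply: (@umbrella3 b h c a t1 t2 P) => //; try (by rewrite sdC); try by [].
    by uniqt.
  have Uc : forall x, adj c x -> x \in [:: h; d; b].
    apply: (@umbrella3 c h d b t2 t3 P) => //; try (by rewrite sdC); try by [].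
    by uniqt.
  have Ud : forall x, adj d x -> x \in [:: h; a; c].
    apply: (@umbrella3 d h a c t3 t4 P) => //; try (by rewrite sdC); try by [].
    by uniqt.
  pose Y := [set x in [:: h; a; b; c; d]].
  have YX : Y \subset X.
    apply/subsetP => x; rewrite inE !in_cons in_nil orbF.
    have hX : h \in X by case/andP: (adj_in (sd_adj ha)).
    have aX : a \in X by case/andP: (adj_in (sd_adj ab)).
    have bX : b \in X by case/andP: (adj_in (sd_adj bc)).
    have cX : c \in X by case/andP: (adj_in (sd_adj cd)).
    have dX : d \in X by case/andP: (adj_in (sd_adj da)).
    by case/or4P=> [| | |/orP[]] /eqP ->.
  have cY : #|Y| <= 5 by rewrite cardsE; exact: card_size.
  have closedY x y : adj x y -> x \in Y -> y \in Y.
    move=> xy; rewrite inE !in_cons in_nil orbF => xY.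
    have : y \in [:: h; a; b; c; d].
      have into (s : seq T) : all (mem [:: h; a; b; c; d]) s -> y \in s -> y \in [:: h; a; b; c; d].
        by move=> /allP; apply.
      case/or4P: xY => [/eqP E'|/eqP E'|/eqP E'|/orP[] /eqP E']; subst x.
      - by apply: into (hub _ xy); rewrite /= !inE !eqxx ?orbT.
      - by apply: into (Ua _ xy); rewrite /= !inE !eqxx ?orbT.
      - by apply: into (Ub _ xy); rewrite /= !inE !eqxx ?orbT.
      - by apply: into (Uc _ xy); rewrite /= !inE !eqxx ?orbT.
      - by apply: into (Ud _ xy); rewrite /= !inE !eqxx ?orbT.
    by move=> yY; rewrite inE.
  have [|||E1|E2] := insep (X1 := Y) (X2 := X :\: Y).
  - by apply/setP => x; rewrite in_setU in_setD; case: (boolP (x \in Y)) => [/(subsetP YX) ->|].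
  - by rewrite (_ : Y :&: _ = set0) ?cards0 //; apply/setP => x; rewrite !in_setI in_setD in_set0; case: (x \in Y).
  - move=> e eE; have [x [y [_ ee xX yX]]] := edge_ends EX eE; rewrite ee !subUset !sub1set.
    have xy : adj x y by rewrite /adj -ee.
    rewrite !in_setD xX yX !andbT.
    case: (boolP (x \in Y)) => xY /=; first by rewrite (closedY x y xy xY).
    by apply: contra xY => yY; apply: (closedY y x) => //; rewrite adjC.
  - by move: X6; rewrite -E1 ltnNge cY.
  have : h \in X by case/andP: (adj_in (sd_adj ha)).
  by rewrite -E2 in_setD inE in_cons eqxx.
exfalso; have [r0 [s [u [U cr rs su ub]]]] := face5 P5 Pbc; split_uniq U.
have hr := hr_ _ cr; have hu := hs_ _ ub.
have [E'|hs] := eqVneq h s.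
  subst s; apply: (inn r0); last by rewrite sdC.
  by apply: hub; adjt.
by apply: (@theta_false b c r0 s u h); try adjt; uniqt.
Qed.

(** ** Discharging *)

Let other f e := if l e == f then r e else l e.

Lemma other_face e f : e \in fb f ->
  [/\ e \in fb (other f e), other f e != f & other (other f e) e = f].
Proof.
rewrite /fb !in_face_bdry /other => /andP[-> /=].
case: (eqVneq (l e) f) => [<-|lf] /=.
  by move=> rf; rewrite eqxx [l e == r e]eq_sym (negbTE rf).
move=> /eqP rf; rewrite eqxx rf; split=> //.
by rewrite [f == _]eq_sym (negbTE lf).
Qed.

Lemma other_eq e f g : e \in fb f -> e \in fb g -> g != f -> other f e = g.
Proof.
rewrite /fb !in_face_bdry /other => /andP[_ H1] /andP[_ H2] gf; move: H1 H2.
case: (eqVneq (l e) f) => [->|lf] /=; case: (eqVneq _ g) => [fg|fg] //=.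
- by move: gf; rewrite fg eqxx.
- by move=> _ /eqP.
by move=> /eqP -> /eqP fg'; move: gf; rewrite fg' eqxx.
Qed.

Let is_tri f := len f == 3.
Let tri_sides f := #|[set e in fb f | is_tri (other f e)]|.

(** The most that a face of length [L], with charge [7 L - 24], can give to every
    adjacent triangle.  A quadrilateral has charge 4, hence the case
    distinction. *)
Let share f := if 5 < len f then 3 else if len f == 5 then 2
  else if tri_sides f <= 2 then 2 else 1.

(** Besides, an end triangle of a fan of three passes one unit to the middle one,
    which has only one side left to receive from. *)
Let nbr t e := is_tri (other t e).
Let tri_nbrs t := \sum_(e in fb t) nbr t e.
Let received t := \sum_(e in fb t) if nbr t e then 0 else share (other t e).
Let given t := \sum_(e in fb t) [&& nbr t e, tri_nbrs t == 1 & tri_nbrs (other t e) == 2].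
Let taken t := \sum_(e in fb t) [&& nbr t e, tri_nbrs t == 2 & tri_nbrs (other t e) == 1].

Lemma sum_tri (F : {set T} -> nat) t a b c : tri t a b c ->
  \sum_(e in fb t) F e = F [set a; b] + (F [set b; c] + F [set c; a]).
Proof.
case/tri_seq=> us fE; rewrite (eq_bigl (fun e => e \in [:: [set a; b]; [set b; c]; [set c; a]])).
  by rewrite -big_uniq //= !big_cons big_nil /= addn0.
by move=> e; rewrite fE inE.
Qed.

Lemma only_tri t x y : sd t x y -> ~~ nbr t [set x; y] ->
  forall f, len f = 3 -> sd f x y -> f = t.
Proof.
move=> txy n f f3 fxy; apply/eqP; apply: contraNT n => ft.
by rewrite /nbr (other_eq txy fxy ft) /is_tri f3.
Qed.

Lemma nbr_tri t x y : sd t x y -> nbr t [set x; y] ->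
  exists o z, [/\ other t [set x; y] = o, o != t & tri o x y z].
Proof.
move=> txy /eqP n; have [h1 h2 _] := other_face txy.
have [z hz] := face3 n h1; by exists (other t [set x; y]), z.
Qed.

Lemma non_nbr t x y : sd t x y -> ~~ nbr t [set x; y] ->
  sd (other t [set x; y]) x y /\ len (other t [set x; y]) <> 3.
Proof. by move=> txy n; have [h1 _ _] := other_face txy; split=> //; apply/eqP. Qed.

Lemma share_ge1 f : 0 < share f.
Proof. by rewrite /share; case: ifP => // _; case: ifP => // _; case: ifP. Qed.

Lemma share_ge2 f a b : sd f a b -> len f <> 3 -> (len f = 4 -> tri_sides f <= 2) -> 1 < share f.
Proof.
move=> fab f3 f4; rewrite /share.
have [l4|->|->//] := above_2_cases (len_ge3 fab) f3; last by [].
by rewrite l4 f4.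
Qed.

Lemma share_big f : 5 < len f -> share f = 3.
Proof. by rewrite /share => ->. Qed.

(** By [pair_quad] a quadrilateral next to a lone pair touches no further triangle,
    so it has 2 to give to both. *)
Lemma pair_share t t' u v w x Q : tri t u v w -> tri t' u v x -> t != t' ->
  sd Q u w -> len Q <> 3 ->
  (forall f, len f = 3 -> sd f v w -> f = t) ->
  (forall f, len f = 3 -> sd f x v -> f = t') -> 1 < share Q.
Proof.
move=> T1 T2 tt' Quw Q3 o1 o2; apply: (share_ge2 Quw Q3) => Q4.
have [p [qd np]] := pair_quad T1 T2 tt' Quw Q4 o1 o2.
have [up wx _ wp [px xu]] := quadP qd.
have fE : fb Q = [set e in [:: [set u; w]; [set w; p]; [set p; x]; [set x; u]]].
  have uw : u != w by neqt.
  have nwp : w != p by neqt.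
  have npx : p != x by neqt.
  have nxu : x != u by neqt.
  apply: face_seq; rewrite ?Q4 //.
    by rewrite /= !inE !set2_eq; neq_rewrite; rewrite ?andbF ?eqxx.
  by move=> e; rewrite !in_cons in_nil orbF => /or4P[] /eqP ->.
apply: leq_trans (card_size [:: [set u; w]; [set x; u]]).
apply: subset_leq_card; apply/subsetP => e; rewrite inE => /andP[eQ /eqP o3].
have [eo _ _] := other_face eQ; have [n1 n2] := np _ o3.
move: eQ; rewrite fE inE !in_cons in_nil !orbF => /or4P[] /eqP ee.
- by rewrite ee eqxx.
- by rewrite ee in eo n1; rewrite /sd eo in n1.
- by rewrite ee in eo n2; rewrite /sd eo in n2.
by rewrite ee eqxx orbT.
Qed.

(** The end of a fan needs 4, being asked for one unit by the middle.  Only a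
    quadrilateral gives 1, and then the face on the spoke gives 3. *)
Lemma fan_share t1 t2 t3 h a b c d Q S : tri t1 h a b -> tri t2 h b c -> tri t3 h c d ->
  t1 != t2 -> t2 != t3 -> (forall f, len f = 3 -> sd f h a -> f = t1) ->
  sd Q a b -> len Q <> 3 -> sd S h a -> len S <> 3 -> 3 < share Q + share S.
Proof.
move=> T1 T2 T3 n12 n23 only Qab Q3 Sha S3.
have S4 := fan_end_outer T1 T2 T3 n12 n23 Sha S3.
have [Q4|Q4] := eqVneq (len Q) 4.
  have S6 := fan_end_both T1 T2 T3 n12 n23 only Qab Q4 Sha S3.
  by rewrite (share_big S6) addn3; have := share_ge1 Q; case: (share Q).
have sQ : 1 < share Q by apply: (share_ge2 Qab Q3) => Q4'; rewrite Q4' in Q4.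
have sS : 1 < share S by apply: (share_ge2 Sha S3) => S4'; case: (S4 S4').
exact: (leq_add sQ sS).
Qed.

(** A fourth triangle in a row makes the wheel by [fan4_closes], since the other
    shape is excluded. *)
Lemma wheel_share t o1 o2 a b c x y Q : tri t a b c -> tri o1 a b x -> tri o2 b c y ->
  o1 != t -> o2 != t -> nbr o1 [set b; x] || nbr o1 [set x; a] ->
  sd Q c a -> len Q <> 3 -> 5 < len Q.
Proof.
move=> T0 T1 T2 n1 n2 nb Qca Q3.
have [_ _ bx xa] := triP T1; have [_ _ _ yb] := triP T2.
case/orP: nb => nb.
  have [t0 [z [_ n0 T3]]] := nbr_tri bx nb.
  have T3' : tri t0 b z x := tri_flip (tri_rot (tri_rot T3)).
  have T1' : tri o1 b x a := tri_rot T1.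
  have T0' : tri t b a c := tri_flip T0.
  have nto2 : t != o2 by rewrite eq_sym.
  have yz : y = z := fan4_closes T3' T1' T0' T2 n0 n1 nto2.
  subst z.
  have T3'' : tri t0 b y x := T3'.
  have n3 : o2 != t0.
    apply/eqP => E'; subst t0.
    have bx' : sd o2 b x by case/triP: T3.
    have [_ _ xy _] := triP T3.
    have [E2|E2] := tri_third T2 bx'.
      have to1 : t != o1 by rewrite eq_sym.
      by have := tri_apex_neq T0 T1 to1; rewrite E2 eqxx.
    by have := adj_neq (sd_adj xy); rewrite E2 eqxx.
  apply: (wheel_outer T1' T0' T2 T3'' n1 nto2 n3 n0) => //.
  by rewrite sdC.
have [t0 [z [_ n0 T3]]] := nbr_tri xa nb.
exfalso; apply: (@strip4_false o2 t o1 t0 b y c a x z) => //.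
- exact: tri_flip (tri_rot (tri_rot T2)).
- exact: tri_rot T0.
- exact: tri_flip T1.
- exact: tri_flip T3.
- by rewrite eq_sym.
- by rewrite eq_sym.
Qed.

Lemma setC2 (x y : T) : [set x; y] = [set y; x]. Proof. exact: setUC. Qed.

(** A triangle with one triangular neighbour [o] belongs to a pair or is the end of
    a fan of three, depending on whether [o] has a further one. *)
Lemma local_charge1 t a b c : tri t a b c -> nbr t [set a; b] ->
  ~~ nbr t [set b; c] -> ~~ nbr t [set c; a] -> 3 + given t <= received t + taken t.
Proof.
move=> T0 n1 n2 n3; have [_ ab bc ca] := triP T0.
have [o [x [oE ot To]]] := nbr_tri ab n1.
have to : t != o by rewrite eq_sym.
have [_ oab obx oxa] := triP To.
have kt : tri_nbrs t = 1.
  by rewrite /tri_nbrs (sum_tri _ T0) n1 (negbTE n2) (negbTE n3).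
have gt : given t = (tri_nbrs o == 2).
  by rewrite /given (sum_tri _ T0) n1 (negbTE n2) (negbTE n3) kt oE /= !addn0.
have rt : received t = share (other t [set b; c]) + share (other t [set c; a]).
  by rewrite /received (sum_tri _ T0) n1 (negbTE n2) (negbTE n3).
have [q1 q1'] := non_nbr bc n2; have [q2 q2'] := non_nbr ca n3.
have o1 := only_tri bc n2; have o2 := only_tri ca n3.
have nt : nbr o [set a; b].
  by rewrite /nbr (other_eq oab ab to) /is_tri; case/and4P: T0.
have ko : tri_nbrs o = 1 + (nbr o [set b; x] + nbr o [set x; a]).
  by rewrite /tri_nbrs (sum_tri _ To) nt.
suff : 3 + (tri_nbrs o == 2) <= received t by rewrite gt => /leq_trans; apply; exact: leq_addr.
rewrite rt; case: (boolP (nbr o [set b; x])) => nbx; case: (boolP (nbr o [set x; a])) => nxa.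
- have [t2 [y [_ n2' T2]]] := nbr_tri obx nbx; have [t3 [z [_ n3' T3]]] := nbr_tri oxa nxa.
  by case: (three_neighbours_false To T0 T2 T3).
- rewrite ko nbx (negbTE nxa) /= [share _ + _]addnC.
  have [t3 [z [_ n3' T3]]] := nbr_tri obx nbx.
  apply: (@fan_share t o t3 b c a x z) => //.
  + exact: tri_rot T0.
  + exact: tri_flip To.
  + by rewrite eq_sym.
- rewrite ko (negbTE nbx) nxa /=.
  have [t3 [z [_ n3' T3]]] := nbr_tri oxa nxa.
  apply: (@fan_share t o t3 a c b x z) => //.
  + exact: tri_flip (tri_rot (tri_rot T0)).
  + exact: tri_flip T3.
  + by rewrite eq_sym.
  + by move=> f f3; rewrite sdC; exact: o2.
  + by rewrite sdC.
  + by rewrite sdC.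
rewrite ko (negbTE nbx) (negbTE nxa) /= addn0.
have o3 := only_tri obx nbx; have o4 := only_tri oxa nxa.
have s1 : 1 < share (other t [set b; c]).
  apply: (@pair_share t o b a c x) => //; try exact: tri_flip.
  by move=> f f3; rewrite sdC; exact: o2.
have s2 : 1 < share (other t [set c; a]).
  apply: (@pair_share t o a b c x) => //; first by rewrite sdC.
  by move=> f f3; rewrite sdC; exact: o3.
exact: ltnW (leq_add s1 s2).
Qed.

(** A triangle with two triangular neighbours is the middle of a fan, where both
    neighbours pass it one unit, or part of a wheel. *)
Lemma local_charge2 t a b c : tri t a b c -> nbr t [set a; b] ->
  nbr t [set b; c] -> ~~ nbr t [set c; a] -> 3 + given t <= received t + taken t.
Proof.
move=> T0 n1 n2 n3; have [_ ab bc ca] := triP T0.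
have [o1 [x [o1E n1' T1]]] := nbr_tri ab n1; have [o2 [y [o2E n2' T2]]] := nbr_tri bc n2.
have [_ o1ab o1bx o1xa] := triP T1; have [_ o2bc o2cy o2yb] := triP T2.
have kt : tri_nbrs t = 2 by rewrite /tri_nbrs (sum_tri _ T0) n1 n2 (negbTE n3).
have -> : given t = 0 by rewrite /given (sum_tri _ T0) kt /= !andbF.
have -> : received t = share (other t [set c; a]).
  by rewrite /received (sum_tri _ T0) n1 n2 (negbTE n3).
have -> : taken t = (tri_nbrs o1 == 1) + (tri_nbrs o2 == 1).
  by rewrite /taken (sum_tri _ T0) n1 n2 (negbTE n3) kt /= addn0 o1E o2E.
have [q q'] := non_nbr ca n3.
have to1 : t != o1 by rewrite eq_sym.
have to2 : t != o2 by rewrite eq_sym.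
have nt1 : nbr o1 [set a; b].
  by rewrite /nbr (other_eq o1ab ab to1) /is_tri; case/and4P: T0.
have nt2 : nbr o2 [set b; c].
  by rewrite /nbr (other_eq o2bc bc to2) /is_tri; case/and4P: T0.
have big1 : tri_nbrs o1 != 1 -> share (other t [set c; a]) = 3.
  rewrite /tri_nbrs (sum_tri _ T1) nt1 => h; apply: share_big.
  apply: (wheel_share T0 T1 T2) => //; by move: h; do 2 case: (nbr o1 _).
have big2 : tri_nbrs o2 != 1 -> share (other t [set c; a]) = 3.
  rewrite /tri_nbrs (sum_tri _ T2) nt2 => h; apply: share_big.
  apply: (@wheel_share t o2 o1 c b a y x) => //.
  - exact: tri_flip (tri_rot T0).
  - exact: tri_flip T2.
  - exact: tri_flip T1.
  - by rewrite setC2 (setC2 y c); move: h; do 2 case: (nbr o2 _).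
  - by rewrite sdC.
have := share_ge1 (other t [set c; a]).
case: (eqVneq (tri_nbrs o1) 1) big1 => [_ _|_ ->] //.
case: (eqVneq (tri_nbrs o2) 1) big2 => [_ _|_ ->] //.
by rewrite addn2; case: (share _).
Qed.

Lemma local_charge t : is_tri t -> 3 + given t <= received t + taken t.
Proof.
move=> /eqP l3.
have [e et] : exists e, e \in fb t by apply/card_gt0P; rewrite -/(len t) l3.
have [x [y [_ ee _ _]]] := edge_ends (@fbX t) et.
rewrite ee in et; have [z T0] := face3 l3 et.
move: x y z T0 {e ee et} => a b c T0; have [_ ab bc ca] := triP T0.
have T1 := tri_rot T0; have T2 := tri_rot T1.
case: (boolP (nbr t [set a; b])) => n1; case: (boolP (nbr t [set b; c])) => n2;
  case: (boolP (nbr t [set c; a])) => n3.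
- have [t1 [x [_ h1 H1]]] := nbr_tri ab n1; have [t2 [y [_ h2 H2]]] := nbr_tri bc n2.
  have [t3 [z [_ h3 H3]]] := nbr_tri ca n3.
  by case: (three_neighbours_false T0 H1 H2 H3).
- exact: local_charge2 T0 n1 n2 n3.
- exact: local_charge2 T2 n3 n1 n2.
- exact: local_charge1 T0 n1 n2 n3.
- exact: local_charge2 T1 n2 n3 n1.
- exact: local_charge1 T1 n2 n3 n1.
- exact: local_charge1 T2 n3 n1 n2.
have -> : given t = 0.
  by rewrite /given (sum_tri _ T0) (negbTE n1) (negbTE n2) (negbTE n3).
rewrite addn0 /received (sum_tri _ T0) (negbTE n1) (negbTE n2) (negbTE n3).
apply: leq_trans (leq_addr _ _).
by have := leq_add (share_ge1 (other t [set a; b])) (leq_add (share_ge1 (other t [set b; c]))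
  (share_ge1 (other t [set c; a]))).
Qed.

Lemma share_budget f : fb f != set0 -> ~~ is_tri f -> share f * tri_sides f + 24 <= 7 * len f.
Proof.
case/set0Pn=> e ef /eqP f3; have [x [y [_ ee _ _]]] := edge_ends (@fbX f) ef.
rewrite ee in ef; have ms : tri_sides f <= len f.
  by apply: subset_leq_card; apply/subsetP => g; rewrite inE => /andP[].
rewrite /share; have [l4|l5|l6] := above_2_cases (len_ge3 ef) f3.
- rewrite l4 /=; rewrite l4 in ms; by move: ms; case: (tri_sides f) => [|[|[|[|[|]]]]].
- by rewrite l5 /=; rewrite l5 in ms; move: ms; case: (tri_sides f) => [|[|[|[|[|[|]]]]]].
rewrite l6; clear -ms l6; lia.
Qed.

(** Both sides of an edge see it: a sum over faces and their edges may be read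
    from the other side. *)
Lemma swap_sides (F : Phi -> {set T} -> nat) :
  \sum_f \sum_(e in fb f) F f e = \sum_f \sum_(e in fb f) F (other f e) e.
Proof.
rewrite !pair_big_dep /=.
rewrite (reindex_onto (fun fe : Phi * {set T} => (other fe.1 fe.2, fe.2))
                      (fun fe => (other fe.1 fe.2, fe.2))) /=.
  apply: eq_big => [[f e]|] //=.
  apply/andP/idP => [[h /eqP[E']]|h].
    by have [+ _ _] := other_face h; rewrite E'.
  by have [h1 _ ->] := other_face h.
by case=> f e /= h; have [_ _ ->] := other_face h.
Qed.

Lemma sum_len : \sum_f len f <= 2 * #|E|.
Proof.
have -> : \sum_f len f = \sum_(e in E) \sum_f ((l e == f) (+) (r e == f)).
  rewrite exchange_big /=; apply: eq_bigr => f _.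
  rewrite /len -sum1_card big_mkcond [RHS]big_mkcond; apply: eq_bigr => e _ /=.
  by rewrite /fb in_face_bdry; case: (e \in E); case: (_ (+) _).
rewrite mulnC -sum_nat_const; apply: leq_sum => e _.
have one g : \sum_f (g == f :> Phi) = 1.
  by rewrite (bigD1 g) //= eqxx big1 // => f /negbTE; rewrite eq_sym => ->.
rewrite -[2]/(1 + 1) -{1}(one (l e)) -(one (r e)) -big_split /=.
by apply: leq_sum => f _; case: (l e == f); case: (r e == f).
Qed.

(** What the triangles pass among themselves cancels, and what they receive from
    longer faces is what these give.  With three collected by each triangle and no
    longer face overdrawn, the charges [7 L - 24] have a nonnegative sum. *)
Lemma discharging : 12 * #|faces E l r| <= 7 * #|E|.
Proof.
pose pos f := fb f != set0.
have tri_pos f : is_tri f -> pos f by move=> /eqP h; rewrite /pos -card_gt0 -/(len f) h.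
have swap0 (P : Phi -> {set T} -> nat) : (forall f e, e \in fb f -> ~~ is_tri f -> P f e = 0) ->
    \sum_(t | is_tri t) \sum_(e in fb t) P t e = \sum_f \sum_(e in fb f) P f e.
  move=> P0; rewrite [RHS](bigID is_tri) /= [X in _ = _ + X]big1 ?addn0 // => f nf.
  by rewrite big1 // => e ef; exact: P0.
have gt : \sum_(t | is_tri t) given t = \sum_(t | is_tri t) taken t.
  pose G t e : nat := [&& is_tri t, nbr t e, tri_nbrs t == 1 & tri_nbrs (other t e) == 2].
  pose H t e : nat := [&& is_tri t, nbr t e, tri_nbrs t == 2 & tri_nbrs (other t e) == 1].
  transitivity (\sum_(t | is_tri t) \sum_(e in fb t) G t e).
    by apply: eq_bigr => t h; apply: eq_bigr => e _; rewrite /G h.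
  transitivity (\sum_(t | is_tri t) \sum_(e in fb t) H t e); last first.
    by apply: eq_bigr => t h; apply: eq_bigr => e _; rewrite /H h.
  rewrite !swap0; try by move=> f e _ /negbTE; rewrite /G /H => ->.
  rewrite swap_sides; apply: eq_bigr => f _; apply: eq_bigr => e ef.
  have [_ _ oo] := other_face ef; rewrite /G /H /nbr oo.
  case: (is_tri f); case: (is_tri (other f e)) => //=; by rewrite andbC.
have rec : \sum_(t | is_tri t) received t = \sum_(f | ~~ is_tri f) share f * tri_sides f.
  pose G t e := if is_tri t && ~~ nbr t e then share (other t e) else 0.
  transitivity (\sum_(t | is_tri t) \sum_(e in fb t) G t e).
    by apply: eq_bigr => t h; apply: eq_bigr => e _; rewrite /G h; case: (nbr t e).
  rewrite swap0; last by move=> f e _ /negbTE; rewrite /G => ->.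
  rewrite swap_sides [LHS](bigID (fun f => ~~ is_tri f)) /= addnC big1 ?add0n.
    apply: eq_bigr => f nf; rewrite mulnC /tri_sides -sum_nat_const.
    rewrite (eq_bigl (fun e => (e \in fb f) && is_tri (other f e))); last by move=> e; rewrite inE.
    rewrite big_mkcondr /=; apply: eq_bigr => e ef.
    by have [_ _ oo] := other_face ef; rewrite /G /nbr oo nf andbT.
  move=> f; rewrite negbK => nf; rewrite big1 // => e ef.
  by have [_ _ oo] := other_face ef; rewrite /G /nbr oo nf andbF.
have low : \sum_(t | is_tri t) 3 <= \sum_(f | ~~ is_tri f) share f * tri_sides f.
  rewrite -rec -(leq_add2r (\sum_(t | is_tri t) given t)) {2}gt -!big_split /=.
  by apply: leq_sum => t; exact: local_charge.
have high : \sum_(f | ~~ is_tri f && pos f) (share f * tri_sides f + 24) <=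
    \sum_(f | ~~ is_tri f && pos f) 7 * len f.
  by apply: leq_sum => f /andP[nf pf]; exact: share_budget.
have share0 : \sum_(f | ~~ is_tri f) share f * tri_sides f =
    \sum_(f | ~~ is_tri f && pos f) share f * tri_sides f.
  rewrite [RHS]big_mkcondr; apply: eq_bigr => f _; case: ifP => // /negbFE /eqP f0.
  rewrite /tri_sides (_ : [set e in fb f | _] = set0) ?cards0 ?muln0 //.
  by apply/setP => e; rewrite inE f0 !inE.
have facesE : #|faces E l r| = #|[pred f | is_tri f]| + #|[pred f | ~~ is_tri f && pos f]|.
  rewrite -(cardID is_tri (mem (faces E l r))) /=; congr (_ + _); apply: eq_card => f.
    by rewrite !inE andbC; apply: andb_idr => /tri_pos.
  by rewrite !inE.
have lenE : \sum_f len f = \sum_(f | is_tri f) 3 + \sum_(f | ~~ is_tri f && pos f) len f.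
  rewrite (bigID is_tri) /=; congr (_ + _); first by apply: eq_bigr => f /eqP.
  rewrite [RHS]big_mkcondr; apply: eq_bigr => f _; case: ifP => // /negbFE /eqP f0.
  by rewrite /len f0 cards0.
set A := #|[pred f | is_tri f]| in facesE; set N := #|[pred f | ~~ is_tri f && pos f]| in facesE.
have c1 : \sum_(f | is_tri f) 3 = A * 3.
  by rewrite /A -sum_nat_const; apply: eq_bigl => f; rewrite inE.
have c2 : \sum_(f | ~~ is_tri f && pos f) 24 = N * 24.
  by rewrite /N -sum_nat_const; apply: eq_bigl => f; rewrite inE.
have := sum_len; rewrite lenE c1; move: low high.
rewrite share0 c1 big_split /= c2 -big_distrr /= facesE.
set S1 := \sum_(f | _) _; set S2 := \sum_(f | _) _.
by clear facesE c1 c2; move: A N S1 S2 #|E|; clear; lia.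
Qed.

(** Without faces there is no even set but the empty one, so the graph is a forest
    and has far fewer edges. *)
Theorem discharged_bound : 5 * #|E| + 24 <= 12 * #|X|.
Proof.
have X0 : X != set0 by rewrite -card_gt0; exact: leq_trans X6.
have [F0|F0] := eqVneq (faces E l r) set0; last first.
  have := face_count EX dual_span X0 F0; have := discharging.
  by move: #|faces E l r| #|E| #|X|; clear; lia.
have sub : even_family E \subset [set set0].
  apply/subsetP => C; rewrite !inE => /andP[CE ev]; have [S ->] := dual_span CE ev.
  apply/eqP/setP => e; rewrite !inE; apply/negbTE/negP => /andP[eE lr].
  have : l e \in faces E l r.
    apply: (@in_faces _ _ _ _ _ _ e); rewrite in_face_bdry eE eqxx /=.
    by apply: contraL lr => /eqP ->; rewrite addbb.
  by rewrite F0 inE.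
have := even_family_lower EX X0; have := subset_leq_card sub; rewrite cards1 => c1 c2.
have : 2 ^ #|E|.+1 <= 2 ^ #|X|.
  by apply: leq_trans c2 _; rewrite -{2}[2 ^ _]mul1n leq_mul2r c1 orbT.
rewrite leq_exp2l // => c3.
by move: c3 X6; move: #|E| #|X|; clear; lia.
Qed.

End Discharge.

(** * The upper bound by induction *)

Section Induction.
Variable T : finType.
Implicit Types (X Y : {set T}) (E : {set {set T}}).

Definition pairs_in X := [set e : {set T} | (e \subset X) & (#|e| == 2)].

Lemma edges_sub_pairs X E : edges_in X E -> E \subset pairs_in X.
Proof. by move=> EX; apply/subsetP => e /EX [c2 eX]; rewrite inE eX c2. Qed.

Lemma card_pairs X : #|pairs_in X| = 'C(#|X|, 2).
Proof. exact: cards_draws. Qed.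

Lemma pair_in X x y : x \in X -> y \in X -> x != y -> [set x; y] \in pairs_in X.
Proof. by move=> xX yX xy; rewrite inE subUset !sub1set xX yX cards2 xy. Qed.

Lemma card4P Y : #|Y| = 4 -> exists a b c d, uniq [:: a; b; c; d] /\ {subset [:: a; b; c; d] <= Y}.
Proof.
move=> Y4; have := enum_uniq (mem Y); have := cardE (mem Y); have := mem_enum (mem Y).
rewrite Y4; case: (enum _) => [|a [|b [|c [|d [|]]]]] //= mE _ U.
by exists a, b, c, d; split=> // x; rewrite mE.
Qed.

Lemma K4_free_sub E E' : E' \subset E -> K4_free E -> K4_free E'.
Proof. by move=> /subsetP s K a b c d h1 h2 h3 h4 h5 h6; apply: (K a b c d); exact: s. Qed.

Lemma theta_free_sub E E' : E' \subset E -> theta_free E -> theta_free E'.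
Proof. by move=> /subsetP s K a b c d e f U *; apply: (K a b c d e f) => //; exact: s. Qed.

Lemma no_complete4 Y E : K4_free E -> #|Y| = 4 -> ~~ (pairs_in Y \subset E).
Proof.
move=> K Y4; apply/negP => /subsetP s; have [a [b [c [d [U sub]]]]] := card4P Y4.
split_uniq U.
have h x y : x \in [:: a; b; c; d] -> y \in [:: a; b; c; d] -> x != y -> [set x; y] \in E.
  by move=> /sub xY /sub yY xy; apply: s; exact: pair_in.
by apply: (K a b c d); apply: h => //; rewrite !inE eqxx ?orbT.
Qed.

Section Small.
Variables (X : {set T}) (E : {set {set T}}).
Hypotheses (EX : edges_in X E) (noK4 : K4_free E).

Lemma edges_le_bin : #|E| <= 'C(#|X|, 2).
Proof. by rewrite -card_pairs; exact: subset_leq_card (edges_sub_pairs EX). Qed.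

Lemma missing_card : #|pairs_in X :\: E| + #|E| = 'C(#|X|, 2).
Proof.
rewrite -card_pairs -(cardsID E (pairs_in X)) addnC; congr (_ + _).
by rewrite (setIidPr (edges_sub_pairs EX)).
Qed.

Lemma edges_le5 : #|X| = 4 -> #|E| <= 5.
Proof.
move=> X4; rewrite leqNgt; apply/negP => E6.
have := no_complete4 noK4 X4; rewrite -setD_eq0 -cards_eq0.
by have := missing_card; rewrite X4 (_ : 'C(4, 2) = 6) //; lia.
Qed.

(** If [v] lies on all missing pairs, the other four vertices are complete. *)
Lemma star_missing v : #|X| = 5 -> v \in X ->
  (forall e, e \in pairs_in X :\: E -> v \in e) -> False.
Proof.
move=> X5 vX miss; have Y4 : #|X :\ v| = 4 by have := cardsD1 v X; rewrite X5 vX; lia.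
have := no_complete4 noK4 Y4 => /negP; apply; apply/subsetP => e eP.
apply: contraT => eE; have : v \in e.
  apply: miss; rewrite inE eE /=; move: eP; rewrite !inE => /andP[+ ->]; rewrite andbT.
  by move/subset_trans; apply; exact: subsetDl.
move: eP; rewrite inE => /andP[/subsetP s _] /s.
by rewrite !inE eqxx.
Qed.

Lemma edges_le8 : #|X| = 5 -> #|E| <= 8.
Proof.
move=> X5; rewrite leqNgt; apply/negP => E9.
have := missing_card; rewrite X5 (_ : 'C(5, 2) = 10) // => mc.
have m1 : #|pairs_in X :\: E| <= 1 by lia.
have [m0|] := eqVneq (pairs_in X :\: E) set0.
  have /card_gt0P[v vX] : 0 < #|X| by rewrite X5.
  by apply: (star_missing X5 vX) => e; rewrite m0 inE.
case/set0Pn=> e0 em; have : e0 \in pairs_in X by move: em; rewrite inE => /andP[].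
rewrite inE => /andP[/subsetP eX /cards2P[x [y [_ ee]]]].
have xX : x \in X by apply: eX; rewrite ee set21.
apply: (star_missing X5 xX) => e em'.
have : pairs_in X :\: E = [set e0].
  by apply/eqP; rewrite eq_sym eqEcard sub1set em cards1.
by move/setP/(_ e); rewrite em' inE => /esym/eqP ->; rewrite ee set21.
Qed.

(** The two missing pairs are disjoint by [star_missing]; the vertex on neither is
    the hub, and the other four form the rim. *)
Lemma wheel_of_5 : #|X| = 5 -> #|E| = 8 -> exists h a b c d,
  [/\ X = [set x in [:: h; a; b; c; d]], uniq [:: h; a; b; c; d],
      [/\ [set h; a] \in E, [set h; b] \in E, [set h; c] \in E & [set h; d] \in E] &
      [/\ [set a; b] \in E, [set b; c] \in E, [set c; d] \in E & [set d; a] \in E]].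
Proof.
move=> X5 E8; have := missing_card; rewrite X5 (_ : 'C(5, 2) = 10) // E8 => mc.
have /eqP/cards2P[e1 [e2 [e12 me]]] : #|pairs_in X :\: E| = 2 by lia.
have inP e : e \in pairs_in X :\: E -> exists x y, [/\ x != y, e = [set x; y], x \in X & y \in X].
  rewrite !inE => /andP[_ /andP[/subsetP eX /cards2P[x [y [xy ee]]]]].
  by exists x, y; split=> //; apply: eX; rewrite ee ?set21 ?set22.
have i1 : e1 \in pairs_in X :\: E by rewrite me set21.
have i2 : e2 \in pairs_in X :\: E by rewrite me set22.
have [a [c [ac e1E aX cX]]] := inP e1 i1; have [b [d [bd e2E bX dX]]] := inP e2 i2.
have dis v : v \in X -> v \in e1 -> v \notin e2.
  move=> vX v1; apply/negP => v2; apply: (star_missing X5 vX) => e.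
  by rewrite me => /set2P[] ->.
have ain : a \in e1 by rewrite e1E set21.
have cin : c \in e1 by rewrite e1E set22.
have := dis a aX ain; have := dis c cX cin; rewrite e2E !inE !negb_or.
move=> /andP[cb cd] /andP[ab ad].
have U4 : uniq [:: a; b; c; d] by rewrite /= !inE; neq_rewrite.
have sub4 : {subset [:: a; b; c; d] <= X}.
  by move=> x; rewrite !in_cons in_nil orbF => /or4P[] /eqP ->.
have [h hX h4] : exists2 h, h \in X & h \notin [:: a; b; c; d].
  apply/exists_inP; apply: contraT => /exists_inPn H.
  have : #|X| <= size [:: a; b; c; d].
    apply: leq_trans (card_size _); apply: subset_leq_card; apply/subsetP => x xX.
    by have := H x xX; rewrite negbK.
  by rewrite X5.
have U : uniq [:: h; a; b; c; d] by rewrite cons_uniq h4.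
have sub5 : {subset [:: h; a; b; c; d] <= X}.
  by move=> x; rewrite in_cons => /orP[/eqP -> //|]; exact: sub4.
have XE : X = [set x in [:: h; a; b; c; d]].
  apply/esym/eqP; rewrite eqEcard X5 cardsE (card_uniqP U) andbT.
  by apply/subsetP => x; rewrite inE; exact: sub5.
have inE' x y : x \in X -> y \in X -> x != y -> [set x; y] != e1 -> [set x; y] != e2 -> [set x; y] \in E.
  move=> xX yX xy n1 n2; apply: contraT => nE.
  have : [set x; y] \in pairs_in X :\: E by rewrite inE nE pair_in.
  by rewrite me !inE (negbTE n1) (negbTE n2).
exists h, a, b, c, d; split=> //; split_uniq U.
  by split; apply: inE'; rewrite ?e1E ?e2E ?set2_eq //; neq_rewrite; rewrite ?andbF.
by split; apply: inE'; rewrite ?e1E ?e2E ?set2_eq //; neq_rewrite; rewrite ?andbF ?eqxx.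
Qed.

End Small.

(** A sixth vertex tied twice to the wheel is inserted into its rim or spokes to
    give the forbidden graph; up to rotation, the ties are to a rim vertex [a] and
    to the hub, the next rim vertex or the opposite one. *)
Lemma wheel_theta E h a b c d v : theta_free E -> uniq [:: h; a; b; c; d; v] ->
  [set h; a] \in E -> [set h; b] \in E -> [set h; c] \in E -> [set h; d] \in E ->
  [set a; b] \in E -> [set b; c] \in E -> [set c; d] \in E -> [set d; a] \in E ->
  [set v; a] \in E -> [\/ [set v; h] \in E, [set v; b] \in E | [set v; c] \in E] -> False.
Proof.
move=> th U ha hb hc hd ab bc cd da va; split_uniq U.
have S x y : [set x; y] \in E -> [set y; x] \in E by rewrite setUC.
case=> [vh|vb|vc].
- by apply: (th h v a b c d) => //; try exact: S; rewrite /= !inE; neq_rewrite.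
- by apply: (th a v b c h d) => //; try exact: S; rewrite /= !inE; neq_rewrite.
- by apply: (th c b h d a v) => //; try exact: S; rewrite /= !inE; neq_rewrite.
Qed.

Lemma delete_vertex X E v : edges_in X E -> v \in X ->
  let E' := E :\: [set e in E | v \in e] in
  [/\ edges_in (X :\ v) E', E' \subset E & #|E| = #|[set e in E | v \in e]| + #|E'|].
Proof.
move=> EX vX E'; split; last 1 first.
- rewrite -(cardsID [set e in E | v \in e] E); congr (_ + _); apply: eq_card => e.
  by rewrite !inE; case: (e \in E).
- move=> e; rewrite !inE => /andP[nv eE]; rewrite eE /= in nv.
  have [c2 eX] := EX e eE; split=> //; apply/subsetP => x xe; rewrite !inE (subsetP eX) // andbT.
  by apply: contra nv => /eqP <-.
exact: subsetDl.
Qed.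

(** Deleting a vertex of degree at most 2 leads below the range of the induction
    when there are six vertices.  Ten edges would leave a wheel with eight, and
    the deleted vertex tied twice to it. *)
Lemma edges_le9 X E : edges_in X E -> K4_free E -> theta_free E -> #|X| = 6 ->
  (exists2 v, v \in X & #|[set e in E | v \in e]| <= 2) -> #|E| <= 9.
Proof.
move=> EX K th X6 [v vX dv]; have [E'X E'E cE] := delete_vertex EX vX.
set E' := E :\: _ in E'X E'E cE.
have X5 : #|X :\ v| = 5 by have := cardsD1 v X; rewrite X6 vX; lia.
have K' := K4_free_sub E'E K; have e8 := edges_le8 E'X K' X5.
rewrite leqNgt; apply/negP => E10.
have dv2 : #|[set e in E | v \in e]| = 2 by move: E10 cE dv e8; clear; lia.
have E8 : #|E'| = 8 by move: E10 cE dv e8; clear; lia.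
have [h [a [b [c [d [XE U [ha hb hc hd] [ab bc cd da]]]]]]] := wheel_of_5 E'X K' X5 E8.
move/eqP/cards2P: dv2 => [e1 [e2 [e12 de]]].
have nbr e : e \in [set e in E | v \in e] -> exists2 y, e = [set v; y] & y \in [:: h; a; b; c; d].
  rewrite inE => /andP[eE ve]; have [x [y [xy ee xX yX]]] := edge_ends EX eE.
  have H z : z \in X -> z != v -> z \in [:: h; a; b; c; d].
    by move=> zX zv; have : z \in X :\ v by [rewrite !inE zv]; rewrite XE inE.
  move: ve; rewrite ee !inE => /orP[] /eqP E1.
    by exists y; [rewrite E1|apply: H => //; rewrite E1 eq_sym].
  by exists x; [rewrite E1 setUC|apply: H => //; rewrite E1].
have i1 : e1 \in [set e in E | v \in e] by rewrite de set21.
have i2 : e2 \in [set e in E | v \in e] by rewrite de set22.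
have [y1 e1E y1in] := nbr _ i1; have [y2 e2E y2in] := nbr _ i2.
have v1 : [set v; y1] \in E by move: i1; rewrite inE e1E => /andP[].
have v2 : [set v; y2] \in E by move: i2; rewrite inE e2E => /andP[].
have y12 : y1 != y2 by apply: contra e12 => /eqP h12; rewrite e1E e2E h12.
have S x y : [set x; y] \in E -> [set y; x] \in E by rewrite setUC.
have vn : v \notin [:: h; a; b; c; d].
  by apply/negP => vin; have : v \in X :\ v by [rewrite XE inE]; rewrite !inE eqxx.
have sE := subsetP E'E.
have [ha' hb' hc' hd'] : [/\ [set h; a] \in E, [set h; b] \in E, [set h; c] \in E & [set h; d] \in E].
  by split; exact: sE.
have [ab' bc' cd' da'] : [/\ [set a; b] \in E, [set b; c] \in E, [set c; d] \in E & [set d; a] \in E].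
  by split; exact: sE.
have W a' b' c' d' : uniq [:: h; a'; b'; c'; d'; v] ->
  [set h; a'] \in E -> [set h; b'] \in E -> [set h; c'] \in E -> [set h; d'] \in E ->
  [set a'; b'] \in E -> [set b'; c'] \in E -> [set c'; d'] \in E -> [set d'; a'] \in E ->
  [set v; a'] \in E -> [\/ [set v; h] \in E, [set v; b'] \in E | [set v; c'] \in E] -> False.
  exact: wheel_theta.
split_uniq U; split_uniq vn.
have Ua : uniq [:: h; a; b; c; d; v] by rewrite /= !inE; neq_rewrite.
have Ub : uniq [:: h; b; c; d; a; v] by rewrite /= !inE; neq_rewrite.
have Uc : uniq [:: h; c; d; a; b; v] by rewrite /= !inE; neq_rewrite.
have Ud : uniq [:: h; d; a; b; c; v] by rewrite /= !inE; neq_rewrite.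
have Wa := W _ _ _ _ Ua ha' hb' hc' hd' ab' bc' cd' da'.
have Wb := W _ _ _ _ Ub hb' hc' hd' ha' bc' cd' da' ab'.
have Wc := W _ _ _ _ Uc hc' hd' ha' hb' cd' da' ab' bc'.
have Wd := W _ _ _ _ Ud hd' ha' hb' hc' da' ab' bc' cd'.
move: y1in y2in y12 v1 v2; rewrite !inE => /or4P[| | |/orP[]] /eqP -> /or4P[| | |/orP[]] /eqP ->;
  rewrite ?eqxx // => _ v1 v2;
  first [ by apply: Wa => //; first [by constructor 1|by constructor 2|by constructor 3]
        | by apply: Wb => //; first [by constructor 1|by constructor 2|by constructor 3]
        | by apply: Wc => //; first [by constructor 1|by constructor 2|by constructor 3]
        | by apply: Wd => //; first [by constructor 1|by constructor 2|by constructor 3] ].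
Qed.

Lemma inseparableP X E : inseparable X E \/ exists X1 X2, [/\ X1 :|: X2 = X, #|X1 :&: X2| <= 1,
    forall e, e \in E -> (e \subset X1) || (e \subset X2), X1 != X & X2 != X].
Proof.
case: (boolP [exists X1 : {set T}, exists X2 : {set T},
   [&& X1 :|: X2 == X, #|X1 :&: X2| <= 1, [forall e in E, (e \subset X1) || (e \subset X2)],
       X1 != X & X2 != X]]).
  case/existsP=> X1 /existsP[X2 /and5P[/eqP h1 h2 /forall_inP h3 h4 h5]].
  by right; exists X1, X2.
move=> /existsPn H; left => X1 X2 h1 h2 h3; have /existsPn/(_ X2) := H X1.
rewrite h1 eqxx h2 /=; have -> /= : [forall e in E, (e \subset X1) || (e \subset X2)].
  by apply/forall_inP.
by rewrite negb_and !negbK => /orP[] /eqP; [left|right].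
Qed.

(** Gluing two parts at a common vertex leaves 12 to spare in the bound, and putting
    them side by side 24.  Parts with at most five vertices, which may exceed the
    bound, do so by at most 5, or by 12 for a single vertex. *)
Lemma excess X E : edges_in X E -> K4_free E -> 0 < #|X| ->
  (5 < #|X| -> 5 * #|E| + 24 <= 12 * #|X|) ->
  5 * #|E| + 24 <= 12 * #|X| + (if #|X| == 1 then 12 else 5).
Proof.
move=> EX K X0 H; have [/H|X5] := ltnP 5 #|X|.
  by move/leq_trans; apply; exact: leq_addr.
have b := edges_le_bin EX; have b4 := edges_le5 EX K; have b5 := edges_le8 EX K.
move: X0 X5 b b4 b5; move: #|X| #|E| => [|[|[|[|[|[|n]]]]]] // m _ _.
- by rewrite (_ : 'C(1, 2) = 0) //= => b _ _; lia.
- by rewrite (_ : 'C(2, 2) = 1) //= => b _ _; lia.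
- by rewrite (_ : 'C(3, 2) = 3) //= => b _ _; lia.
- by move=> _ /(_ erefl) h _; move: h => /=; lia.
by move=> _ _ /(_ erefl) /=; lia.
Qed.

Variable E0 : {set {set T}}.
Hypothesis dual0 : forall E, E \subset E0 -> has_dual E.
Hypothesis noK4 : K4_free E0.
Hypothesis noTheta : theta_free E0.

(** Deleting a vertex of degree at most 2 costs at most 10 against 12, and a
    splitting is covered by [excess].  What neither reduces is inseparable with
    minimum degree 3, where discharging applies. *)
Theorem dual_edge_bound X E : E \subset E0 -> edges_in X E -> 5 < #|X| ->
  5 * #|E| + 24 <= 12 * #|X|.
Proof.
have [n] := ubnP #|X|; elim: n X E => // n IH X E; rewrite ltnS => Xn EE0 EX X5.
have K := K4_free_sub EE0 noK4; have th := theta_free_sub EE0 noTheta.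
case: (boolP [exists v in X, #|[set e in E | v \in e]| <= 2]) => [/exists_inP[v vX dv]|/exists_inPn deg].
  have [X6|X6] := eqVneq #|X| 6.
    have := edges_le9 EX K th X6 (ex_intro2 _ _ v vX dv).
    by rewrite X6; move: #|E|; clear; lia.
  have [E'X E'E cE] := delete_vertex EX vX.
  have cX := cardsD1 v X; rewrite vX in cX.
  have := IH _ _ _ (subset_trans E'E EE0) E'X; rewrite cE.
  move: cX Xn X5 X6 dv; move: #|X :\ v| #|[set e in E | v \in e]| #|_ :\: _| #|X|; clear => x d e y.
  by move=> -> *; lia.
have mindeg v : v \in X -> 2 < #|[set e in E | v \in e]|.
  by move=> /deg; rewrite -ltnNge.
case: (@inseparableP X E) => [insep|[X1 [X2 [XU XI Esub n1 n2]]]].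
  have [Phi [l [r [ev sp]]]] := dual0 EE0.
  exact: (discharged_bound EX ev sp insep X5 mindeg K th).
pose E1 := [set e in E | e \subset X1]; pose E2 := [set e in E | ~~ (e \subset X1)].
have E1X : edges_in X1 E1 by move=> e; rewrite inE => /andP[/EX [c2 _] h].
have E2X : edges_in X2 E2.
  move=> e; rewrite inE => /andP[eE h]; have [c2 _] := EX e eE; split=> //.
  by have := Esub e eE; rewrite (negbTE h).
have E1E : E1 \subset E by apply/subsetP => e; rewrite inE => /andP[].
have E2E : E2 \subset E by apply/subsetP => e; rewrite inE => /andP[].
have cE : #|E| = #|E1| + #|E2|.
  rewrite -(cardsID E1 E); congr (_ + _); apply: eq_card => e; rewrite !inE; first by case: (e \in E).
  by case: (e \in E) => //=; rewrite andbT.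
have X1X : X1 \proper X by rewrite properEneq n1 -XU subsetUl.
have X2X : X2 \proper X by rewrite properEneq n2 -XU subsetUr.
have c1 := proper_card X1X; have c2 := proper_card X2X.
have cU := cardsUI X1 X2; rewrite XU in cU.
have pos1 : 0 < #|X1|.
  by rewrite card_gt0; apply: contra n2 => /eqP h; rewrite -XU h set0U.
have pos2 : 0 < #|X2|.
  by rewrite card_gt0; apply: contra n1 => /eqP h; rewrite -XU h setU0.
have one1 : #|X1| = 1 -> #|X1 :&: X2| = 0.
  move=> h; apply/eqP; rewrite cards_eq0; apply: contraNT n2 => /set0Pn[x xi].
  have X1x : X1 = [set x].
    by apply/esym/eqP; rewrite eqEcard cards1 h sub1set; move: xi; rewrite inE => /andP[->].
  rewrite -XU X1x; apply/eqP/esym/setUidPr; rewrite sub1set.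
  by move: xi; rewrite inE => /andP[].
have one2 : #|X2| = 1 -> #|X1 :&: X2| = 0.
  move=> h; apply/eqP; rewrite cards_eq0; apply: contraNT n1 => /set0Pn[x xi].
  have X2x : X2 = [set x].
    by apply/esym/eqP; rewrite eqEcard cards1 h sub1set; move: xi; rewrite inE => /andP[_ ->].
  rewrite -XU X2x; apply/eqP/esym/setUidPl; rewrite sub1set.
  by move: xi; rewrite inE => /andP[].
have x1 := excess E1X (K4_free_sub E1E K) pos1
  (IH X1 E1 (leq_trans c1 Xn) (subset_trans E1E EE0) E1X).
have x2 := excess E2X (K4_free_sub E2E K) pos2
  (IH X2 E2 (leq_trans c2 Xn) (subset_trans E2E EE0) E2X).
move: cE cU XI pos1 pos2 one1 one2 x1 x2.
move: #|E| #|E1| #|E2| #|X| #|X1| #|X2| #|X1 :&: X2|; clear => e e1 e2 x y1 y2 i -> cU i1 p1 p2.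
by case: (eqVneq y1 1) => h1; case: (eqVneq y2 1) => h2 o1 o2 h3 h4;
  rewrite ?(o1 h1) ?(o2 h2) in cU; lia.
Qed.

End Induction.

(** * Rings of three wheels *)

(** Spots of a ring: 0 and 10 are its two ends, 11 is the apex common to all
    rings; the wheels are 0, 1, 10, 2 with hub 3, then 11, 4, 1, 5 with hub 6,
    and 11, 7, 2, 8 with hub 9. Each edge comes with the number of its wheel. *)
Definition ring_edges : seq (nat * nat * nat) :=
  [:: (0, 1, 0); (1, 10, 0); (2, 10, 0); (0, 2, 0); (0, 3, 0); (1, 3, 0); (2, 3, 0); (3, 10, 0);
      (4, 11, 1); (5, 11, 1); (6, 11, 1); (1, 4, 1); (1, 5, 1); (1, 6, 1); (4, 6, 1); (5, 6, 1);
      (7, 11, 2); (8, 11, 2); (9, 11, 2); (2, 7, 2); (2, 8, 2); (2, 9, 2); (7, 9, 2); (8, 9, 2)].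

(** Consecutive rings share an end, as spot 10 of one is spot 0 of the next. *)
Definition spot (j s : nat) : nat := if s == 11 then 0 else (10 * j + s).+1.

Definition wheel_spots (w : nat) : seq nat :=
  nth [::] [:: [:: 0; 1; 2; 3; 10]; [:: 1; 4; 5; 6; 11]; [:: 2; 7; 8; 9; 11]] w.

Lemma ring_edges_wheel s : s \in ring_edges ->
  (s.1.1 \in wheel_spots s.2) && (s.1.2 \in wheel_spots s.2).
Proof. by apply/allP: s. Qed.

Lemma ring_edges_bounds s : s \in ring_edges -> (s.1.1 < s.1.2) && (s.1.2 <= 11) && (s.1.1 < 10).
Proof. by apply/allP: s. Qed.

Section Fold.

(** Reading the ring numbers modulo 3 gives a finite quotient that is injective
    around every vertex but the apex. *)
Definition fold (u : nat) : nat := if u is u'.+1 then (u' %% 30).+1 else 0.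

Definition folded_edges : seq (nat * nat * (nat * nat)) :=
  [seq (fold (spot j s.1.1), fold (spot j s.1.2), (j, s.2)) | j <- iota 0 3, s <- ring_edges].

Definition folded_nbrs (a : nat) : seq (nat * (nat * nat)) :=
  [seq (x.1.2, x.2) | x <- folded_edges & x.1.1 == a] ++
  [seq (x.1.1, x.2) | x <- folded_edges & x.1.2 == a].

Definition folded_table : seq (seq (nat * (nat * nat))) := map folded_nbrs (iota 0 31).

(** Since folding is injective around all vertices but the apex 0, a path without
    repetitions turns back at most there. *)
Definition turn (a b c : nat) : bool := (b == 0) || (a != c).

(** Closed walks of the quotient are searched exhaustively from the table of
    neighbours, in which every entry carries the ring modulo 3 and the wheel of
    its edge. *)
Definition no_folded_K4 : bool :=
  let nb := nth [::] folded_table in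
  let adj a b := b \in [seq x.1 | x <- nb a] in
  all (fun a => all (fun b => all (fun c => if adj a c.1 then
    all (fun d => ~~ (adj a d.1 && adj b.1 d.1)) (nb c.1) else true) (nb b.1)) (nb a)) (iota 0 31).

Definition folded_triangles_local : bool :=
  let nb := nth [::] folded_table in
  all (fun a => all (fun b => all (fun c => all (fun d =>
    (d.1 == a) ==> ((b.2 == c.2) && (c.2 == d.2))) (nb c.1)) (nb b.1)) (nb a)) (iota 0 31).

Definition folded_pentagons_local : bool :=
  let nb := nth [::] folded_table in
  all (fun a => all (fun b => all (fun c => if turn a b.1 c.1 then
    all (fun d => if turn b.1 c.1 d.1 then all (fun e => if turn c.1 d.1 e.1 then
      all (fun f => [&& f.1 == a, turn d.1 e.1 a, turn e.1 a b.1 &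
             count (pred1 0) [:: a; b.1; c.1; d.1; e.1] <= 1] ==>
          [&& b.2 == c.2, c.2 == d.2, d.2 == e.2 & e.2 == f.2]) (nb e.1)
      else true) (nb d.1) else true) (nb c.1) else true) (nb b.1)) (nb a)) (iota 0 31).

Lemma no_folded_K4T : no_folded_K4. Proof. by vm_compute. Qed.
Lemma folded_triangles_localT : folded_triangles_local. Proof. by vm_compute. Qed.
Lemma folded_pentagons_localT : folded_pentagons_local. Proof. by vm_compute. Qed.

End Fold.

Definition linked (u v j w : nat) : Prop := exists2 s, s \in ring_edges &
  s.2 = w /\ ((u = spot j s.1.1 /\ v = spot j s.1.2) \/ (v = spot j s.1.1 /\ u = spot j s.1.2)).

Lemma linkedC u v j w : linked u v j w -> linked v u j w.
Proof. by case=> s sE [sw h]; exists s => //; split=> //; case: h; [right|left]. Qed.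

Lemma fold_lt u : fold u < 31.
Proof. by case: u => //= u; rewrite ltnS ltn_mod. Qed.

Lemma fold_spot j s : fold (spot j s) = fold (spot (j %% 3) s).
Proof. by rewrite /spot; case: eqP => //= _; congr _.+1; lia. Qed.

Lemma all_iota_fold (p : pred nat) u : all p (iota 0 31) -> p (fold u).
Proof. by move/allP; apply; rewrite mem_iota fold_lt. Qed.

Lemma nth_map_iota (A : Type) (x : A) (f : nat -> A) n a : a < n -> nth x (map f (iota 0 n)) a = f a.
Proof. by move=> h; rewrite (nth_map 0) ?size_iota // nth_iota. Qed.

Lemma folded_tableE a : a < 31 -> nth [::] folded_table a = folded_nbrs a.
Proof. exact: nth_map_iota. Qed.
Local Opaque folded_table.

Lemma linked_folded u v j w : linked u v j w ->
  (fold v, (j %% 3, w)) \in nth [::] folded_table (fold u).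
Proof.
case=> s sE [<- h]; rewrite folded_tableE ?fold_lt // mem_cat.
have mem : (fold (spot j s.1.1), fold (spot j s.1.2), (j %% 3, s.2)) \in folded_edges.
  rewrite (fold_spot j s.1.1) (fold_spot j s.1.2); apply: allpairs_f => //.
  by rewrite mem_iota ltn_mod.
case: h => -[-> ->]; apply/orP; [left|right]; apply/mapP;
  exists (fold (spot j s.1.1), fold (spot j s.1.2), (j %% 3, s.2)) => //;
  by rewrite mem_filter eqxx.
Qed.

Lemma linked_near u v j w : linked u v j w -> v != 0 ->
  (u = 0 \/ (u <= v + 10 /\ v <= u + 10)) /\ 10 * j < v <= 10 * j + 11.
Proof.
case=> s sE [_ h]; have := ring_edges_bounds sE => /andP[/andP[b1 b2] b3] v0.
move: h v0; rewrite /spot; case: (eqVneq s.1.1 11) => e1; case: (eqVneq s.1.2 11) => e2;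
  move=> [[-> ->]|[-> ->]] v0; lia.
Qed.

Lemma linked_turn u v x j j' w w' : linked u v j w -> linked v x j' w' -> u != x ->
  turn (fold u) (fold v) (fold x).
Proof.
move=> h1 h2 ux; rewrite /turn; have [->//|v0] := eqVneq v 0.
have [h3 _] := linked_near h1 v0; have [h4 _] := linked_near (linkedC h2) v0.
apply/orP; right; apply: contra ux; move: h3 h4 v0.
case: u {h1} => [|u]; case: x {h2} => [|x] //=.
rewrite eqSS => h3 h4 v0 /eqP h5; rewrite eqSS; lia.
Qed.

(** Two edges at a vertex other than the apex belong to the same or to consecutive
    rings, so their ring numbers may be compared modulo 3. *)
Lemma linked_same u v x j j' w w' : linked u v j w -> linked v x j' w' -> v != 0 ->
  j %% 3 = j' %% 3 -> j = j'.
Proof.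
move=> h1 h2 v0; have [_ h3] := linked_near h1 v0; have [_ h4] := linked_near (linkedC h2) v0.
lia.
Qed.

Lemma fold0 u : (fold u == 0) = (u == 0). Proof. by case: u. Qed.

(** At most one vertex is the apex, and at each of the others [linked_same] lifts
    the agreement found in the quotient. *)
Lemma linked_triangle a b c j1 j2 j3 w1 w2 w3 : uniq [:: a; b; c] ->
  linked a b j1 w1 -> linked b c j2 w2 -> linked c a j3 w3 ->
  [/\ j1 = j2, j2 = j3, w1 = w2 & w2 = w3].
Proof.
move=> U h1 h2 h3.
have := folded_triangles_localT; rewrite /folded_triangles_local => /(all_iota_fold a) /allP/(_ _ (linked_folded h1)) /allP/(_ _ (linked_folded h2)).
move=> /allP/(_ _ (linked_folded h3)); rewrite /= eqxx !xpair_eqE /=.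
move=> /andP[/andP[/eqP j12 /eqP ->] /andP[/eqP j23 /eqP ->]].
have e2 : b != 0 -> j1 = j2 by move=> b0; exact: linked_same h1 h2 b0 j12.
have e3 : c != 0 -> j2 = j3 by move=> c0; exact: linked_same h2 h3 c0 j23.
have e1 : a != 0 -> j3 = j1.
  by move=> a0; apply: (linked_same h3 h1 a0); rewrite -j23 -j12.
move: U; rewrite /= !inE => U; clear h1 h2 h3.
by split=> //; lia.
Qed.

Lemma linked_pentagon a b c d e j1 j2 j3 j4 j5 w1 w2 w3 w4 w5 : uniq [:: a; b; c; d; e] ->
  linked a b j1 w1 -> linked b c j2 w2 -> linked c d j3 w3 -> linked d e j4 w4 ->
  linked e a j5 w5 ->
  [/\ j1 = j2, j2 = j3, j3 = j4 & j4 = j5] /\ [/\ w1 = w2, w2 = w3, w3 = w4 & w4 = w5].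
Proof.
move=> U h1 h2 h3 h4 h5.
have [n1 [n2 [n3 [n4 n5]]]] : a != c /\ b != d /\ c != e /\ d != a /\ e != b.
  by move: U; rewrite /= !inE; do ![split]; lia.
have := folded_pentagons_localT; rewrite /folded_pentagons_local => /(all_iota_fold a) /allP/(_ _ (linked_folded h1)) /allP/(_ _ (linked_folded h2)).
rewrite (linked_turn h1 h2 n1) => /allP/(_ _ (linked_folded h3)).
rewrite (linked_turn h2 h3 n2) => /allP/(_ _ (linked_folded h4)).
rewrite (linked_turn h3 h4 n3) => /allP/(_ _ (linked_folded h5)).
rewrite (linked_turn h4 h5 n4) (linked_turn h5 h1 n5) [_ == fold a]eqxx.
have -> : count (pred1 0) [:: fold a; fold b; fold c; fold d; fold e] <= 1.
  have -> : count (pred1 0) [:: fold a; fold b; fold c; fold d; fold e] =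
      count_mem 0 [:: a; b; c; d; e] by rewrite /= !fold0.
  by rewrite count_uniq_mem // leq_b1.
rewrite /= !xpair_eqE /= => /and4P[/andP[/eqP j12 /eqP ->] /andP[/eqP j23 /eqP ->]
  /andP[/eqP j34 /eqP ->] /andP[/eqP j45 /eqP ->]].
have e2 : b != 0 -> j1 = j2 by move=> b0; exact: linked_same h1 h2 b0 j12.
have e3 : c != 0 -> j2 = j3 by move=> c0; exact: linked_same h2 h3 c0 j23.
have e4 : d != 0 -> j3 = j4 by move=> d0; exact: linked_same h3 h4 d0 j34.
have e5 : e != 0 -> j4 = j5 by move=> e0; exact: linked_same h4 h5 e0 j45.
have e1 : a != 0 -> j5 = j1.
  by move=> a0; apply: (linked_same h5 h1 a0); rewrite -j45 -j34 -j23 -j12.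
have : count_mem 0 [:: a; b; c; d; e] <= 1 by rewrite count_uniq_mem // leq_b1.
move=> /= one; clear -one e1 e2 e3 e4 e5.
have [E1|b0] := eqVneq b 0; last have {}e2 := e2 b0.
  subst b; split=> //; split; lia.
have [E2|c0] := eqVneq c 0; last have {}e3 := e3 c0.
  subst c; split=> //; split; lia.
have [E3|d0] := eqVneq d 0; last have {}e4 := e4 d0.
  subst d; split=> //; split; lia.
have [E4|e0] := eqVneq e 0; last have {}e5 := e5 e0.
  subst e; split=> //; split; lia.
by split.
Qed.

Definition joined u v := exists j w, linked u v j w.

Lemma joined_K4_free a b c d : joined a b -> joined a c -> joined a d -> joined b c ->
  joined b d -> joined c d -> False.
Proof.
move=> [j1 [w1 h1]] [j2 [w2 h2]] [j3 [w3 h3]] [j4 [w4 h4]] [j5 [w5 h5]] [j6 [w6 h6]].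
have := no_folded_K4T; rewrite /no_folded_K4 => /(all_iota_fold a) /allP/(_ _ (linked_folded h1)) /allP/(_ _ (linked_folded h4)).
have adj u v j w : linked u v j w -> fold v \in [seq x.1 | x <- nth [::] folded_table (fold u)].
  by move=> /linked_folded h; apply/mapP; exists (fold v, (j %% 3, w)).
rewrite /= (adj _ _ _ _ h2) => /allP/(_ _ (linked_folded h6)).
by rewrite /= (adj _ _ _ _ h3) (adj _ _ _ _ h5).
Qed.

Lemma linked_wheel u v j w : linked u v j w ->
  (u \in map (spot j) (wheel_spots w)) && (v \in map (spot j) (wheel_spots w)).
Proof.
case=> s /ring_edges_wheel /andP[s1 s2] [<- h].
by case: h => -[-> ->]; rewrite !map_f.
Qed.

(** A triangle and a pentagon lie in one wheel each, and when they share an edge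
    in the same one, which has only five vertices. *)
Lemma joined_theta_free a b c d e f : uniq [:: a; b; c; d; e; f] ->
  joined a b -> joined b c -> joined c d -> joined d e -> joined e f -> joined f a ->
  joined a c -> False.
Proof.
move=> U [j1 [w1 h1]] [j2 [w2 h2]] [j3 [w3 h3]] [j4 [w4 h4]] [j5 [w5 h5]] [j6 [w6 h6]] [j7 [w7 h7]].
have U3 : uniq [:: a; b; c] := mask_uniq U [:: true; true; true].
have U5 : uniq [:: a; c; d; e; f] := mask_uniq U [:: true; false; true; true; true; true].
have [E1 E2 F1 F2] := linked_triangle U3 h1 h2 (linkedC h7).
have [[E3 E4 E5 E6] [F3 F4 F5 F6]] := linked_pentagon U5 h7 h3 h4 h5 h6.
subst; have /andP[ia ib] := linked_wheel h1; have /andP[_ ic] := linked_wheel h2.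
have /andP[_ id] := linked_wheel h3; have /andP[_ ie] := linked_wheel h4.
have /andP[_ i_f] := linked_wheel h5.
have := uniq_leq_size U (s2 := map (spot j6) (wheel_spots w6)).
rewrite size_map; have -> : (size [:: a; b; c; d; e; f] <= size (wheel_spots w6)) = false.
  by move: w6 {h1 h2 h3 h4 h5 h6 h7 ia ib ic id ie i_f} => [|[|[|[|w]]]].
move=> H; suff: false by []; apply: H => x; rewrite !in_cons in_nil orbF.
by case/or4P=> [| | |/or3P[]] /eqP ->.
Qed.

Lemma ring_edges_fst : {in ring_edges &, forall s s', s.1 = s'.1 -> s = s'}.
Proof.
move=> s s' sE sE' h.
have /allP H : all (fun s => all (fun s' => (s.1 == s'.1) ==> (s == s')) ring_edges) ring_edges.
  by vm_compute.
have /allP H' := H _ sE; have /= := H' _ sE'.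
by rewrite h eqxx => /eqP.
Qed.

Lemma spot_edge_inj j j' s s' : s \in ring_edges -> s' \in ring_edges ->
  (spot j s.1.1 = spot j' s'.1.1 /\ spot j s.1.2 = spot j' s'.1.2) \/
  (spot j s.1.1 = spot j' s'.1.2 /\ spot j s.1.2 = spot j' s'.1.1) -> j = j' /\ s = s'.
Proof.
move=> sE sE' H; have /andP[/andP[b1 b2] b3] := ring_edges_bounds sE.
have /andP[/andP[b1' b2'] b3'] := ring_edges_bounds sE'.
have [jj [e1 e2]] : j = j' /\ s.1.1 = s'.1.1 /\ s.1.2 = s'.1.2.
  move: H; rewrite /spot; have -> : (s.1.1 == 11) = false by lia.
  have -> : (s'.1.1 == 11) = false by lia.
  by case: (eqVneq s.1.2 11) => ?; case: (eqVneq s'.1.2 11) => ? [] []; lia.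
split=> //; apply: ring_edges_fst => //.
by rewrite [LHS]surjective_pairing [RHS]surjective_pairing e1 e2.
Qed.

(** * Drawing the rings *)

(** Ring [j] is drawn with straight segments in the strip [0 <= x <= 6],
    [4 j <= y <= 4 j + 4], except that edges to the apex run horizontally to
    the border of the strip. *)
Definition spot_pos (s : nat) : nat * nat :=
  nth (0, 0) [:: (3, 0); (4, 2); (2, 2); (3, 2); (5, 1); (5, 3); (5, 2);
                 (1, 1); (1, 3); (1, 2); (3, 4)] s.

Definition far_end (s : nat * nat * nat) : nat * nat :=
  if s.1.2 == 11 then (if s.2 == 1 then 6 else 0, (spot_pos s.1.1).2) else spot_pos s.1.2.

(** The points compared are interior to their segments, hence one strict inequality
    among the four is enough to keep the projections apart. *)
Definition apart1 (a b c d : nat) : bool :=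
  [&& a <= c, a <= d, b <= c, b <= d & [|| a < c, a < d, b < c | b < d]].

Definition apart (A B C D : nat * nat) : bool :=
  [|| apart1 A.1 B.1 C.1 D.1, apart1 C.1 D.1 A.1 B.1,
      apart1 A.2 B.2 C.2 D.2 | apart1 C.2 D.2 A.2 B.2].

Lemma ring_edges_apart : {in ring_edges &, forall s s', s != s' ->
  apart (spot_pos s.1.1) (far_end s) (spot_pos s'.1.1) (far_end s')}.
Proof.
move=> s s' sE sE' ss.
have /allP H : all (fun s => all (fun s' => (s != s') ==>
  apart (spot_pos s.1.1) (far_end s) (spot_pos s'.1.1) (far_end s')) ring_edges) ring_edges.
  by vm_compute.
have /allP H' := H _ sE; have /= := H' _ sE'.
by rewrite ss.
Qed.

Lemma ring_edges_spot_apart s q : s \in ring_edges -> q < 10 ->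
  apart (spot_pos s.1.1) (far_end s) (spot_pos q) (spot_pos q).
Proof.
move=> sE q10.
have /allP H : all (fun s => all (fun q => 
  apart (spot_pos s.1.1) (far_end s) (spot_pos q) (spot_pos q)) (iota 0 10)) ring_edges.
  by vm_compute.
by have /allP H' := H _ sE; apply: H'; rewrite mem_iota.
Qed.

Lemma ring_edges_strip s : s \in ring_edges ->
  [&& 0 < (spot_pos s.1.1).1, (spot_pos s.1.1).1 < 6, (far_end s).1 <= 6,
      (spot_pos s.1.1).2 <= 4, (far_end s).2 <= 4,
      0 < (spot_pos s.1.1).2 + (far_end s).2,
      (spot_pos s.1.1).2 + (far_end s).2 < 8 & spot_pos s.1.1 != far_end s].
Proof. by apply/allP: s. Qed.

Lemma spot_pos_inj q q' : q < 10 -> q' < 10 -> spot_pos q = spot_pos q' -> q = q'.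
Proof.
move=> h h' e; have /allP H : all (fun q => all (fun q' =>
  (spot_pos q == spot_pos q') ==> (q == q')) (iota 0 10)) (iota 0 10) by vm_compute.
have /allP H' := H q (eq_trans (mem_iota 0 10 q) h).
have /= := H' q' (eq_trans (mem_iota 0 10 q') h').
by rewrite e eqxx => /eqP.
Qed.

Lemma spot_pos_strip q : q < 10 -> [&& 0 < (spot_pos q).1, (spot_pos q).1 < 6 & (spot_pos q).2 <= 3].
Proof.
move=> h; have /allP H : all (fun q => [&& 0 < (spot_pos q).1, (spot_pos q).1 < 6 & (spot_pos q).2 <= 3]) (iota 0 10) by vm_compute.
by apply: H; rewrite mem_iota.
Qed.

From mathcomp Require Import all_order all_algebra.
From mathcomp Require Import all_classical all_reals all_analysis.
From mathcomp Require Import ring lra.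
Import Order.TTheory GRing.Theory Num.Theory numFieldNormedType.Exports.

Local Open Scope classical_set_scope.
Local Open Scope ring_scope.

(** * Continuous arcs and grid cells *)

Section Analysis.
Variable R : realType.
Implicit Types (z w : R * R) (d : R).

Lemma norm_pair_lt z d : (`|z| < d) = (`|z.1| < d) && (`|z.2| < d).
Proof. by rewrite {1}/Num.norm /= gt_max. Qed.

Lemma norm_pair_le z d : (`|z| <= d) = (`|z.1| <= d) && (`|z.2| <= d).
Proof. by rewrite {1}/Num.norm /= ge_max. Qed.

Definition clamp (t : R) : R := Num.max 0 (Num.min t 1).

Lemma clamp_itv t : clamp t \in `[0, 1].
Proof. by rewrite in_itv /= /clamp le_max lexx /= ge_max ge_min ler01 lexx orbT. Qed.

Lemma clamp_id t : t \in `[0, 1] -> clamp t = t.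
Proof. by rewrite in_itv /= => /andP[t0 t1]; rewrite /clamp min_l // max_r. Qed.

Lemma clamp_continuous : continuous clamp.
Proof.
move=> t; rewrite /clamp.
apply: (@continuous_max _ R (fun=> 0) (fun t => Num.min t 1)); first exact: cst_continuous.
by apply: (@continuous_min _ R (fun t => t) (fun=> 1)) => //; exact: cst_continuous.
Qed.

Lemma continuous_clamp (f : R -> R * R) :
  {within `[0, 1], continuous f} -> continuous (f \o clamp).
Proof.
move=> /subspace_continuousP cf t.
have := cf (clamp t) (clamp_itv t); apply: cvg_comp.
move=> P Pw.
have : nbhs t (clamp @^-1` [set x | `[0, 1]%classic x -> P x]).
  exact: (@clamp_continuous t _ Pw).
by apply: filterS => u; apply; exact: clamp_itv.
Qed.

(** Compactness enters in two ways: through the minimum of a positive continuous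
    function here, and through uniform continuity in [uniform_steps]. *)
Lemma positive_lower_bound (T : topologicalType) (A : set T) (g : T -> R) :
  compact A -> continuous g -> (forall t, A t -> 0 < g t) ->
  exists2 d, 0 < d & forall t, A t -> d <= g t.
Proof.
move=> cA cg g0; have [[a Aa]|A0] := pselect (A !=set0); last first.
  by exists 1 => // t At; case: A0; exists t.
have [|c cin H] := compact_EVT_min (ex_intro _ a Aa) cA (f := g).
  exact: continuous_subspaceT.
exists (g c) => [|t At]; first by apply: g0; rewrite inE in cin.
by apply: H; rewrite inE.
Qed.

(** A bound for each edge, or for each pair of edges, is made uniform by taking the
    least of them. *)
Lemma finite_positive_bound (I : finType) (P : I -> R -> Prop) :
  (forall i d d', 0 < d' -> d' <= d -> P i d -> P i d') ->
  (forall i, exists2 d, 0 < d & P i d) -> exists2 d, 0 < d & forall i, P i d.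
Proof.
move=> mono ex.
suff [d d0 dP] : exists2 d, 0 < d & forall i, i \in enum I -> P i d.
  by exists d => // i; apply: dP; rewrite mem_enum.
elim: (enum I) => [|i s [d d0 dP]]; first by exists 1.
have [e e0 eP] := ex i.
have m0 : 0 < Num.min d e by rewrite lt_min d0.
exists (Num.min d e) => // j; rewrite in_cons => /orP[/eqP ->|/dP].
  by apply: mono eP => //; rewrite ge_min lexx orbT.
by apply: mono => //; rewrite ge_min lexx.
Qed.

Lemma uniform_steps (f : R -> R * R) d : continuous f -> 0 < d ->
  exists2 h, 0 < h & forall t u, 0 <= t <= 1 -> `|t - u| < h -> `|f t - f u| < d.
Proof.
move=> cf d0.
have N : \forall h \near (0 : R)^'+, `[0, 1] `<=`
    (fun t => forall u, `|t - u| < h -> `|f t - f u| < d).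
  apply: ((compact_near_coveringP _).1 (@segment_compact R 0 1)) => t _.
  have /cvgrPdist_lt /(_ (d / 2)) := cf t; rewrite divr_gt0 // => /(_ isT) /=.
  rewrite near_simpl => /nbhs_ballP[e /= e0 He].
  exists (ball t (e / 2), [set h | h < e / 2]) => /=.
    split; first by apply: nbhsx_ballx; rewrite divr_gt0.
    by apply: nbhs_right_lt; rewrite divr_gt0.
  case=> t' h [/= tt' he] u hu.
  have h1 : `|f t - f t'| < d / 2.
    apply: He; apply: lt_trans tt' _; lra.
  have h2 : `|f t - f u| < d / 2.
    apply: He; rewrite /ball /= in tt' *.
    rewrite (_ : t - u = (t - t') + (t' - u)); last by ring.
    by apply: le_lt_trans (ler_normD _ _) _; lra.
  rewrite (_ : f t' - f u = - (f t - f t') + (f t - f u)); last first.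
    by rewrite opprB addrA subrK.
  apply: le_lt_trans (ler_normD _ _) _; rewrite normrN; lra.
have [h [Hh h0]] := filter_ex (filterI N (nbhs_right_gt (0 : R))).
by exists h => // t u t01; apply: Hh; rewrite /= in_itv.
Qed.

(** Truncation turns points of the plane into lattice points. *)
Definition cell (K M : R) (z : R * R) : grid_pt :=
  (Num.truncn (K * (z.1 + M)), Num.truncn (K * (z.2 + M))).

Lemma truncn_close n (a b : R) : 0 <= a -> 0 <= b ->
  (Num.truncn a <= Num.truncn b + n)%N -> a < b + n.+1%:R.
Proof.
move=> a0 b0; have /andP[_ a1] := truncn_itv a0; have /andP[b1 _] := truncn_itv b0.
rewrite -(ler_nat R) natrD => h; apply: lt_le_trans a1 _.
rewrite -[X in X%:R <= _]addn1 -[n.+1]addn1 !natrD addrA; lra.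
Qed.

Lemma close_truncn n (a b : R) : 0 <= a -> 0 <= b ->
  a <= b + n%:R -> (Num.truncn a <= Num.truncn b + n)%N.
Proof.
move=> a0 b0; have /andP[a1 _] := truncn_itv a0; have /andP[_ b1] := truncn_itv b0.
move=> h; rewrite -ltnS -(ltr_nat R) -addSn natrD; lra.
Qed.

Section Cell.
Variables (K M : R).
Hypothesis K0 : 0 < K.
Let above z := 0 <= z.1 + M /\ 0 <= z.2 + M.

Let absK x : `|x| * K = `|x * K|.
Proof. by rewrite normrM (gtr0_norm K0). Qed.

Lemma near_cell n z w : above z -> above w ->
  near_pt n (cell K M z) (cell K M w) -> K * `|z - w| < n.+1%:R.
Proof.
move=> [z1 z2] [w1 w2] /and4P[/= h1 h2 h3 h4].
have pos x : 0 <= x -> 0 <= K * x by move=> x0; rewrite mulr_ge0 // ltW.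
have := truncn_close (pos _ z1) (pos _ w1) h1.
have := truncn_close (pos _ w1) (pos _ z1) h2.
have := truncn_close (pos _ z2) (pos _ w2) h3.
have := truncn_close (pos _ w2) (pos _ z2) h4.
move=> g4 g3 g2 g1; rewrite mulrC -ltr_pdivlMr // norm_pair_lt /=.
by rewrite !ltr_pdivlMr // !absK !ltr_norml; lra.
Qed.

Lemma cell_near n z w : above z -> above w ->
  K * `|z - w| <= n%:R -> near_pt n (cell K M z) (cell K M w).
Proof.
move=> [z1 z2] [w1 w2].
have pos x : 0 <= x -> 0 <= K * x by move=> x0; rewrite mulr_ge0 // ltW.
rewrite mulrC -ler_pdivlMr // norm_pair_le /= !ler_pdivlMr //.
rewrite !absK !ler_norml => /andP[h1 h2].
by apply/and4P; split; apply: close_truncn; rewrite ?pos //; lra.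
Qed.

End Cell.

End Analysis.

(** * A plane drawing has a dual *)

Section Drawing.
Variables (R : realType) (T : finType) (G : graph T).
Variables (p : T -> R * R) (c : {set T} -> R -> R * R).
Hypothesis draw : plane_drawing G p c.

Let ce e := c e \o @clamp R.
Let unit_itv (t : R) := 0 <= t <= 1.

Lemma arc_continuous e : e \in edges G -> continuous (ce e).
Proof. by case: draw => _ H _ _ /H [cf _ _]; exact: continuous_clamp. Qed.

Let ceE e t : unit_itv t -> ce e t = c e t.
Proof. by move=> t01; rewrite /ce /= clamp_id // in_itv. Qed.

Lemma arc_ends e : e \in edges G ->
  exists x y, [/\ x != y, e = [set x; y]%SET, ce e 0 = p x & ce e 1 = p y].
Proof.
move=> eG; case: draw => _ H _ _; have [_ _ [x [y [ee h0 h1]]]] := H e eG.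
exists x, y; rewrite !ceE /unit_itv ?lexx ?ler01 //; split=> //.
have /forall_inP/(_ e eG) : simple_edges (edges G) := valP G.
by rewrite ee cards2; case: (x != y).
Qed.

Lemma arc_vertex e t v : e \in edges G -> unit_itv t -> ce e t = p v ->
  v \in e /\ (t = 0 \/ t = 1).
Proof.
move=> eG t01 tv; have [x [y [xy ee c0 c1]]] := arc_ends eG.
have [pinj _ H _] := draw.
have [t0|t0] := eqVneq t 0.
  split; last (by left); move: tv; rewrite t0 c0 => /pinj <-; by rewrite ee !inE eqxx.
have [t1|t1] := eqVneq t 1.
  split; last (by right); move: tv; rewrite t1 c1 => /pinj <-; by rewrite ee !inE eqxx orbT.
case: (H e v eG t); last by rewrite -ceE.
by move: t01; rewrite /unit_itv in_itv /= => /andP[a b]; rewrite !lt_neqAle eq_sym t0 a t1 b.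
Qed.

Lemma arc_meet e f s t : e \in edges G -> f \in edges G -> e <> f ->
  unit_itv s -> unit_itv t -> ce e s = ce f t -> exists2 v, v \in e & ce e s = p v.
Proof.
move=> eG fG ef s01 t01 st; have [_ _ _ H] := draw.
have end_pt g u : g \in edges G -> u = 0 \/ u = 1 -> exists v, ce g u = p v.
  by move=> /arc_ends [x [y [_ _ c0 c1]]] [->|->]; [exists x|exists y].
have fin v : ce e s = p v -> exists2 v, v \in e & ce e s = p v.
  by move=> sv; exists v => //; have [] := arc_vertex eG s01 sv.
have inside u : unit_itv u -> ~ (u = 0 \/ u = 1) -> u \in `]0, 1[.
  rewrite /unit_itv in_itv /= => /andP[a b] nu; rewrite !lt_neqAle a b !andbT eq_sym.
  by apply/andP; split; apply/eqP => h; apply: nu; [left|right].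
have [|ns] := pselect (s = 0 \/ s = 1).
  by move=> /(end_pt e s eG) [v /fin].
have [|nt] := pselect (t = 0 \/ t = 1).
  by move=> /(end_pt f t fG) [v]; rewrite -st => /fin.
case: (H e f eG fG ef s t (inside _ s01 ns) (inside _ t01 nt)).
by rewrite -!ceE.
Qed.

Let dist_continuous e z : e \in edges G -> continuous (fun t => `|ce e t - z|).
Proof.
move=> eG t; apply: cvg_norm; apply: cvgB; last exact: cvg_cst.
exact: arc_continuous.
Qed.

(** The factor 8 leaves room for disjoint boxes around the vertices on every grid
    with at least one cell per length [d]. *)
Lemma vertex_gap : exists2 d : R, 0 < d &
  (forall v v', v != v' -> 8 * d <= `|p v - p v'|) /\
  (forall e v t, e \in edges G -> v \notin e -> unit_itv t -> 8 * d <= `|ce e t - p v|).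
Proof.
have [||d1 d10 H1] := @finite_positive_bound R _
  (fun (vv : T * T) d => vv.1 != vv.2 -> 8 * d <= `|p vv.1 - p vv.2|).
- by move=> vv d d' _ dd H /H; apply: le_trans; rewrite ler_pM2l.
- case=> v v' /=; have [->|vv] := eqVneq v v'; first by exists 1.
  have pos : 0 < `|p v - p v'|.
    by rewrite normr_gt0 subr_eq0; apply: contra vv => /eqP; case: draw => pinj _ _ _ /pinj ->.
  by exists (`|p v - p v'| / 8) => [|_]; lra.
have [||d2 d20 H2] := @finite_positive_bound R _
  (fun (ev : {set T} * T) d => ev.1 \in edges G -> ev.2 \notin ev.1 ->
     forall t, unit_itv t -> 8 * d <= `|ce ev.1 t - p ev.2|).
- by move=> vv d d' _ dd H eG ve t t01; apply: le_trans (H eG ve t t01); rewrite ler_pM2l.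
- case=> e v /=; case: (boolP (e \in edges G)) => eG; last by exists 1.
  case: (boolP (v \in e)) => [|ve]; first by exists 1.
  have [||d d0 H] := positive_lower_bound (@segment_compact R 0 1) (g := fun t => `|ce e t - p v|).
  + exact: dist_continuous.
  + move=> t; rewrite /= in_itv /= => t01; rewrite normr_gt0 subr_eq0.
    by apply/eqP => /(arc_vertex eG t01) [h _]; rewrite h in ve.
  exists (d / 8) => [|_ _ t t01]; first lra.
  have := H t; rewrite /= in_itv /= => /(_ t01); lra.
exists (Num.min d1 d2); first by rewrite lt_min d10.
split=> [v v' vv|e v t eG ve t01].
  by apply: le_trans (H1 (v, v') vv); rewrite ler_pM2l // ge_min lexx.
by apply: le_trans (H2 (e, v) eG ve t t01); rewrite ler_pM2l // ge_min lexx orbT.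
Qed.

(** Two arcs may meet at a common end.  Adding to their distance a bump of height
    [rho] around each end of the first arc makes it positive everywhere, hence
    bounded below; where the bumps vanish, the bound is one for the distance. *)
Lemma arc_gap rho : 0 < rho -> exists2 d : R, 0 < d &
  forall e f s t, e \in edges G -> f \in edges G -> e != f -> unit_itv s -> unit_itv t ->
    `|ce e s - ce f t| < d -> exists v, `|ce e s - p v| < rho.
Proof.
move=> rho0.
have [||d d0 H] := @finite_positive_bound R _
  (fun (ef : {set T} * {set T}) d => ef.1 \in edges G -> ef.2 \in edges G -> ef.1 != ef.2 ->
   forall s t, unit_itv s -> unit_itv t ->
    `|ce ef.1 s - ce ef.2 t| < d -> exists v, `|ce ef.1 s - p v| < rho).
- by move=> ef d d' _ dd H h1 h2 h3 s t hs ht h; apply: (H h1 h2 h3 s t) => //; exact: lt_le_trans h dd.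
- case=> e f /=; case: (boolP (e \in edges G)) => eG; last by exists 1.
  case: (boolP (f \in edges G)) => fG; last by exists 1.
  have [|ef] := eqVneq e f; first by exists 1.
  have [x [y [_ ee _ _]]] := arc_ends eG.
  pose bump z s := Num.max 0 (rho - `|ce e s - p z|).
  have bump0 z s : 0 <= bump z s by rewrite /bump le_max lexx.
  have bump_cont z : continuous (bump z).
    move=> s; apply: (@continuous_max _ R (fun=> 0) (fun s => rho - `|ce e s - p z|)).
      exact: cst_continuous.
    by apply: cvgB; [exact: cvg_cst|exact: dist_continuous].
  pose g (st : R * R) := `|ce e st.1 - ce f st.2| + (bump x st.1 + bump y st.1).
  have cA : compact ((`[0, 1] : set R) `*` (`[0, 1] : set R)).
    by apply: compact_setX; exact: segment_compact.
  have [||d d0 H] := positive_lower_bound cA (g := g).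
  + move=> st; apply: cvgD.
      apply: cvg_norm; apply: cvgB.
        by apply: (cvg_comp fst (ce e)); [exact: cvg_fst|exact: arc_continuous].
      by apply: (cvg_comp snd (ce f)); [exact: cvg_snd|exact: arc_continuous].
    apply: cvgD.
      by apply: (cvg_comp fst (bump x)); [exact: cvg_fst|exact: bump_cont].
    by apply: (cvg_comp fst (bump y)); [exact: cvg_fst|exact: bump_cont].
  + case=> s t; rewrite /= !in_itv /= => -[s01 t01]; rewrite /g /=.
    have [st|st] := eqVneq (ce e s) (ce f t); last first.
      by rewrite ltr_wpDr // ?addr_ge0 // normr_gt0 subr_eq0.
    have [v ve sv] := arc_meet eG fG (elimN eqP ef) s01 t01 st.
    rewrite st subrr normr0 add0r.
    have bv : bump v s = rho by rewrite /bump sv subrr normr0 subr0 max_r // ltW.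
    move: ve; rewrite ee => /set2P[] vE; rewrite -vE bv.
      by rewrite ltr_wpDr.
    by rewrite ltr_wpDl.
  exists d => // _ _ _ s t s01 t01 st.
  have := H (s, t); rewrite /= !in_itv /= => /(_ (conj s01 t01)); rewrite /g /= => gd.
  have : (0 < bump x s) || (0 < bump y s).
    apply: contraT; rewrite negb_or -!leNgt => /andP[bx byy]; lra.
  by rewrite !lt_max ltxx /= !subr_gt0 => /orP[] h; [exists x|exists y].
by exists d => // e f s t eG fG ef; exact: (H (e, f)).
Qed.

Lemma drawing_bounded : exists M : R,
  (forall v, `|p v| <= M) /\ (forall e t, e \in edges G -> unit_itv t -> `|ce e t| <= M).
Proof.
have [||d1 d10 H1] := @finite_positive_bound R _ (fun v d => d * `|p v| <= 1).
- by move=> v d d' d'0 dd; apply: le_trans; rewrite ler_wpM2r.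
- move=> v; exists (`|p v| + 1)^-1; first by rewrite invr_gt0 ltr_wpDl.
  by rewrite mulrC ler_pdivrMr ?mul1r ?lerDl // ltr_wpDl.
have [||d2 d20 H2] := @finite_positive_bound R _
  (fun e d => e \in edges G -> forall t, unit_itv t -> d * `|ce e t| <= 1).
- by move=> e d d' d'0 dd H eG t t01; apply: le_trans (H eG t t01); rewrite ler_wpM2r.
- move=> e; case: (boolP (e \in edges G)) => eG; last by exists 1.
  have [|u _ H] := @EVT_max R (fun t => `|ce e t|) 0 1 ler01.
    apply: continuous_subspaceT => t; apply: cvg_norm; exact: arc_continuous.
  exists (`|ce e u| + 1)^-1; first by rewrite invr_gt0 ltr_wpDl.
  move=> _ t t01; rewrite mulrC ler_pdivrMr ?mul1r; last by rewrite ltr_wpDl.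
  have := H t; rewrite in_itv /= => /(_ t01); lra.
exists (d1^-1 + d2^-1); split=> [v|e t eG t01].
  have := H1 v; rewrite -ler_pdivlMl // mulr1 => /le_trans; apply.
  by rewrite lerDl invr_ge0 ltW.
have := H2 e eG t t01; rewrite -ler_pdivlMl // mulr1 => /le_trans; apply.
by rewrite lerDr invr_ge0 ltW.
Qed.

Lemma arc_samples d : 0 < d -> exists m, (0 < m)%N /\
  forall e k, e \in edges G -> (k < m)%N ->
    `|ce e (k%:R / m%:R) - ce e (k.+1%:R / m%:R)| < d.
Proof.
move=> d0.
have [||h h0 H] := @finite_positive_bound R _ (fun e h => e \in edges G ->
  forall t u, unit_itv t -> `|t - u| < h -> `|ce e t - ce e u| < d).
- by move=> e h h' _ hh H eG t u t01 tu; apply: H => //; exact: lt_le_trans tu hh.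
- move=> e; case: (boolP (e \in edges G)) => eG; last by exists 1.
  have [h h0 H] := uniform_steps (arc_continuous eG) d0; exists h => // _ t u; exact: H.
exists (Num.truncn h^-1).+1; split=> // e k eG km; apply: H => //.
  rewrite /unit_itv divr_ge0 //= ler_pdivrMr ?ltr0n // mul1r ler_nat; exact: ltnW.
rewrite -mulrBl -natr1 opprD addrA subrr add0r mulN1r normrN ger0_norm ?invr_ge0 //.
by rewrite invf_plt ?posrE ?ltr0n // truncnS_gt.
Qed.

(** The scale [K] of the grid is chosen so that the discs of radius [rho] have at
    least one cell ([Krho]), and arcs closer than three cells are within [eta] of
    each other ([Keta]); the arcs are then sampled finely enough to move by at
    most one cell at a time. *)
Theorem drawing_has_dual (E : {set {set T}}) : E \subset edges G -> has_dual E.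
Proof.
move=> /fintype.subsetP EG.
have [rho rho0 [gap1 gap2]] := vertex_gap.
have [eta eta0 gap3] := arc_gap rho0.
have [M0 [bd1 bd2]] := drawing_bounded.
pose K := rho^-1 + 3 / eta; pose M := M0 + 8 * rho.
have K0 : 0 < K by rewrite /K addr_gt0 ?divr_gt0 ?invr_gt0.
have Krho : 1 <= K * rho.
  by rewrite /K mulrDl mulVf ?gt_eqF // lerDl mulr_ge0 ?divr_ge0 ?ltW.
have Keta : 3 <= K * eta.
  rewrite /K mulrDl divfK ?gt_eqF // lerDr mulr_ge0 ?invr_ge0 ?ltW //.
have [m [m0 samp]] := arc_samples (divr_gt0 ltr01 K0).
pose kappa := K * rho; pose r := (Num.truncn kappa).+1.
have r1 : kappa <= r%:R by apply: ltW; exact: truncnS_gt.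
have r2 : r%:R <= kappa + 1.
  rewrite /r -natr1 lerD2r truncn_le; exact: le_trans ler01 Krho.
pose q e k := cell K M (ce e (k%:R / m%:R)); pose b v := cell K M (p v).
have kitv k : (k <= m)%N -> unit_itv (k%:R / m%:R).
  by move=> km; rewrite /unit_itv divr_ge0 //= ler_pdivrMr ?ltr0n // mul1r ler_nat.
have above z : `|z| <= M0 -> 8 * rho <= z.1 + M /\ 8 * rho <= z.2 + M.
  by rewrite norm_pair_le !ler_norml /M => /andP[/andP[h1 _] /andP[h2 _]]; split; lra.
have above0 z : `|z| <= M0 -> 0 <= z.1 + M /\ 0 <= z.2 + M.
  by move=> /above [h1 h2]; split; lra.
have deepc z n : `|z| <= M0 -> n.+1%:R <= 8 * kappa ->
    ((n < (cell K M z).1) && (n < (cell K M z).2))%N.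
  move=> /above [h1 h2] hn; rewrite /cell /= !truncn_gt_nat.
  have L x : 8 * rho <= x -> n.+1%:R <= K * x.
    move=> hx; apply: le_trans hn _; rewrite /kappa mulrCA ler_pM2l //.
  by rewrite !L.
have bdq e k : e \in E -> (k <= m)%N -> `|ce e (k%:R / m%:R)| <= M0.
  by move=> /EG eG km; exact: bd2 eG (kitv k km).
have far z w n : `|z| <= M0 -> `|w| <= M0 -> n.+1%:R <= 8 * kappa -> 8 * rho <= `|z - w| ->
    ~~ near_pt n (cell K M z) (cell K M w).
  move=> hz hw hn zw; apply/negP => /(near_cell K0 (above0 _ hz) (above0 _ hw)).
  apply/negP; rewrite -leNgt; apply: le_trans hn _.
  by rewrite /kappa mulrCA ler_pM2l.
have kap : 1 <= kappa := Krho.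
apply: (@samples_has_dual _ _ b r m q).
- move=> v; apply: deepc => //; rewrite -addn3 natrD; lra.
- move=> v v' vv; apply: far => //; last exact: gap1.
  by rewrite (_ : (r.+1 + r.+1).+1 = (r + r + 3)%N) ?natrD; [lra|lia].
- move=> e k eE km; apply: deepc; first exact: bdq.
  by rewrite (_ : 2.+1%:R = 3 :> R) //; lra.
- move=> e k eE km; apply: cell_near => //; [exact/above0/bdq/ltnW|exact/above0/bdq|].
  have := samp e k (EG _ eE) km; rewrite div1r => /ltW.
  by rewrite -[X in _ <= X]mulr1 ler_pdivlMl.
- move=> e eE; have [x [y [xy ee c0 c1]]] := arc_ends (EG _ eE).
  exists x, y; split=> //; rewrite /q /b ?mul0r ?c0 // divff ?c1 //.
  by rewrite pnatr_eq0 -lt0n.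
- move=> e k z eE km ze; rewrite near_ptC; apply: far => //; first exact: bdq.
    by rewrite (_ : (r.+1 + 1).+1 = (r + 3)%N) ?natrD; [lra|lia].
  exact: gap2 (EG _ eE) ze (kitv _ km).
move=> e f k k' eE fE ef km km' nr.
have nr' := near_cell K0 (above0 _ (bdq e k eE km)) (above0 _ (bdq f k' fE km')) nr.
have [|v hv] := gap3 e f _ _ (EG _ eE) (EG _ fE) ef (kitv _ km) (kitv _ km').
  rewrite -(ltr_pM2l K0); apply: lt_le_trans nr' _; exact: Keta.
exists v; rewrite near_ptC; apply: cell_near => //; first exact/above0/bdq.
  exact/above0/bd1.
apply: le_trans r1; rewrite /kappa ler_pM2l //; exact: ltW.
Qed.

End Drawing.

(** * The rings are planar *)

Section Plane.
Variable R : realType.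
Implicit Types (z : R * R) (t : R).

(** This map is injective inside the strip and takes both its borders to the
    origin, where the apex is. Horizontal segments across the strip become
    nested loops. *)
Definition loop_map z : R * R :=
  let u := z.1 * (6 - z.1) * (z.2 + 1) in (u, u * z.1).

Lemma loop_map_gt0 z : 0 < z.1 < 6 -> 0 <= z.2 -> 0 < (loop_map z).1.
Proof.
by move=> /andP[h1 h2] h3; rewrite /loop_map /= !mulr_gt0 ?subr_gt0 // ltr_wpDl.
Qed.

Lemma loop_map_inj z z' : 0 < z.1 < 6 -> 0 <= z.2 -> 0 < z'.1 < 6 -> 0 <= z'.2 ->
  loop_map z = loop_map z' -> z = z'.
Proof.
move=> hx hy hx' hy' E'.
have := loop_map_gt0 hx hy; have := loop_map_gt0 hx' hy'.
case: E'; rewrite /loop_map /=.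
set u := _ * (z.2 + 1); set u' := _ * (z'.2 + 1) => uu' ux u'0 u0.
have xx : z.1 = z'.1.
  by apply: (mulfI (lt0r_neq0 u0)); rewrite ux -uu'.
move: uu'; rewrite /u /u' xx => /mulfI yy.
have /addIr yE : z.2 + 1 = z'.2 + 1.
  apply: yy; move/andP: hx' => [h1 h2]; rewrite mulf_neq0 ?gt_eqF ?subr_gt0 //.
by rewrite [z]surjective_pairing [z']surjective_pairing xx yE.
Qed.

Lemma loop_map_border z : z.1 = 0 \/ z.1 = 6 -> loop_map z = (0, 0).
Proof. by rewrite /loop_map; case=> ->; rewrite ?subrr ?mul0r ?mulr0 ?mul0r. Qed.

Definition grid_point (j : nat) (q : nat * nat) : R * R := (q.1%:R, q.2%:R + (4 * j)%:R).

Definition along (a b : R * R) t : R * R := (a.1 + t * (b.1 - a.1), a.2 + t * (b.2 - a.2)).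

(** The difference is a combination of the four differences of ends with positive
    coefficients. *)
Lemma apart1_lines (a b c d : nat) (t s : R) : apart1 a b c d -> 0 < t < 1 -> 0 < s < 1 ->
  a%:R + t * (b%:R - a%:R) < c%:R + s * (d%:R - c%:R).
Proof.
move=> /and5P[]; rewrite -!(ltr_nat R) -!(ler_nat R).
set x := a%:R; set y := b%:R; set z := c%:R; set w := d%:R.
move=> h1 h2 h3 h4 h5 /andP[t0 t1] /andP[s0 s1].
rewrite -subr_gt0.
have -> : z + s * (w - z) - (x + t * (y - x)) =
  (1 - t) * (1 - s) * (z - x) + (1 - t) * s * (w - x) + (t * (1 - s) * (z - y) + t * s * (w - y)) by ring.
have p1 : 0 < (1 - t) * (1 - s) by rewrite mulr_gt0 // subr_gt0.
have p2 : 0 < (1 - t) * s by rewrite mulr_gt0 // subr_gt0.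
have p3 : 0 < t * (1 - s) by rewrite mulr_gt0 // subr_gt0.
have p4 : 0 < t * s by rewrite mulr_gt0.
have g1 : 0 <= (1 - t) * (1 - s) * (z - x) by rewrite mulr_ge0 ?subr_ge0 // ltW.
have g2 : 0 <= (1 - t) * s * (w - x) by rewrite mulr_ge0 ?subr_ge0 // ltW.
have g3 : 0 <= t * (1 - s) * (z - y) by rewrite mulr_ge0 ?subr_ge0 // ltW.
have g4 : 0 <= t * s * (w - y) by rewrite mulr_ge0 ?subr_ge0 // ltW.
case/or4P: h5 => h5.
- by rewrite ltr_wpDr ?addr_ge0 // ltr_wpDr // mulr_gt0 // subr_gt0.
- by rewrite ltr_wpDr ?addr_ge0 // ltr_wpDl // mulr_gt0 // subr_gt0.
- by rewrite ltr_wpDl ?addr_ge0 // ltr_wpDr // mulr_gt0 // subr_gt0.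
- by rewrite ltr_wpDl ?addr_ge0 // ltr_wpDl // mulr_gt0 // subr_gt0.
Qed.

Lemma apart_lines A B C D j t s : apart A B C D -> 0 < t < 1 -> 0 < s < 1 ->
  along (grid_point j A) (grid_point j B) t <> along (grid_point j C) (grid_point j D) s.
Proof.
move=> ap t01 s01 [E1 E2].
have shift (x y e : R) : y + e - (x + e) = y - x by ring.
move: E2; rewrite !shift ![_ + (4 * j)%:R + _]addrAC => /addIr E2.
by case/or4P: ap => h; [have := apart1_lines h t01 s01|have := apart1_lines h s01 t01|
  have := apart1_lines h t01 s01|have := apart1_lines h s01 t01];
  rewrite ?E1 ?E2 ltxx.
Qed.

Definition ring_arc (js : nat * (nat * nat * nat)) t : R * R :=
  loop_map (along (grid_point js.1 (spot_pos js.2.1.1)) (grid_point js.1 (far_end js.2)) t).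

Lemma along1 j A B t : (along (grid_point j A) (grid_point j B) t).1 =
  (1 - t) * A.1%:R + t * B.1%:R.
Proof. by rewrite /along /grid_point; move: (4 * j)%N => e /=; ring. Qed.

Lemma along2 j A B t : (along (grid_point j A) (grid_point j B) t).2 =
  (4 * j)%:R + ((1 - t) * A.2%:R + t * B.2%:R).
Proof. by rewrite /along /grid_point; move: (4 * j)%N => e /=; ring. Qed.

Lemma along_strip j s t : s \in ring_edges -> 0 <= t < 1 ->
  0 < (along (grid_point j (spot_pos s.1.1)) (grid_point j (far_end s)) t).1 < 6 /\
  0 <= (along (grid_point j (spot_pos s.1.1)) (grid_point j (far_end s)) t).2.
Proof.
move=> /ring_edges_strip /and5P[h1 h2 h3 _ _] /andP[t0 t1]; rewrite along1 along2.
move: (spot_pos s.1.1) (far_end s) h1 h2 h3 => [x y2] [x' y3] /=.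
rewrite -!(ltr_nat R) -!(ler_nat R) => h1 h2 h3.
have := ler0n R x'; have := ler0n R y2; have := ler0n R y3; have := ler0n R (4 * j).
move: x%:R x'%:R y2%:R y3%:R (4 * j)%:R h1 h2 h3 => {}x {}x' {}y2 {}y3 e h1 h2 h3 g1 g2 g3 g4.
split; last by rewrite addr_ge0 // addr_ge0 // mulr_ge0 // subr_ge0 ltW.
apply/andP; split.
  by rewrite ltr_wpDr ?mulr_ge0 // mulr_gt0 // subr_gt0.
by have : 0 < (1 - t) * (6 - x) by [rewrite mulr_gt0 // subr_gt0]; have : 0 <= t * (6 - x') by [rewrite mulr_ge0 // subr_ge0]; lra.
Qed.

Lemma convex_gt0 (a b t : R) : 0 <= a -> 0 <= b -> 0 < a + b -> 0 < t < 1 ->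
  0 < (1 - t) * a + t * b.
Proof.
move=> a0 b0 ab /andP[t0 t1]; have t'0 : 0 < 1 - t by rewrite subr_gt0.
move: a0; rewrite le_eqVlt => /orP[/eqP E'|a0].
  by rewrite -E' add0r in ab; rewrite -E' mulr0 add0r mulr_gt0.
by rewrite ltr_wpDr ?mulr_gt0 // mulr_ge0 // ltW.
Qed.

Lemma along_inside j s t : s \in ring_edges -> 0 < t < 1 ->
  (4 * j)%:R < (along (grid_point j (spot_pos s.1.1)) (grid_point j (far_end s)) t).2 < (4 * j.+1)%:R.
Proof.
move=> /ring_edges_strip /and5P[_ _ _ h4 /and4P[h5 h6 h7 _]] /andP[t0 t1]; rewrite along2.
rewrite mulnS natrD [4%:R + _]addrC ltrDl ltrD2l.
move: (spot_pos s.1.1).2 (far_end s).2 h4 h5 h6 h7 => y z.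
rewrite -!(ltr_nat R) -!(ler_nat R) natrD.
have := ler0n R y; have := ler0n R z.
move: y%:R z%:R => {}y {}z z0 y0 y4 z4 yz yz8.
have t01 : 0 < t < 1 by rewrite t0.
rewrite convex_gt0 //=.
have : 0 < (1 - t) * (4 - y) + t * (4 - z) by apply: convex_gt0 => //; rewrite ?subr_ge0 //; lra.
by lra.
Qed.

Lemma along_inj (a b : R * R) t t' : a != b -> along a b t = along a b t' -> t = t'.
Proof.
move=> ab [/addrI e1 /addrI e2].
have [d1|d1] := eqVneq (b.1 - a.1) 0; last exact: mulIf e1.
have [d2|d2] := eqVneq (b.2 - a.2) 0; last exact: mulIf e2.
move: ab; rewrite [a]surjective_pairing [b]surjective_pairing xpair_eqE.
by rewrite -(subr_eq0 a.1) -(subr_eq0 a.2) -(opprB b.1) -(opprB b.2) d1 d2 oppr0 eqxx.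
Qed.

Lemma grid_point_inj j A B : grid_point j A = grid_point j B -> A = B.
Proof.
case: A B => a1 a2 [b1 b2] [/eqP + /addIr/eqP]; rewrite !eqr_nat.
by move=> /eqP -> /eqP ->.
Qed.

Lemma ring_arc_continuous js : continuous (ring_arc js).
Proof.
move=> t; rewrite /ring_arc /loop_map /along.
set a := grid_point _ _; set b := grid_point _ _.
have c1 : continuous (fun t : R => a.1 + t * (b.1 - a.1)).
  by move=> u; apply: cvgD; [exact: cvg_cst|apply: cvgM; [exact: cvg_id|exact: cvg_cst]].
have c2 : continuous (fun t : R => a.2 + t * (b.2 - a.2)).
  by move=> u; apply: cvgD; [exact: cvg_cst|apply: cvgM; [exact: cvg_id|exact: cvg_cst]].
have c3 : continuous (fun t : R => (a.1 + t * (b.1 - a.1)) * (6 - (a.1 + t * (b.1 - a.1))) *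
    (a.2 + t * (b.2 - a.2) + 1)).
  move=> u; apply: cvgM; last by apply: cvgD; [exact: c2|exact: cvg_cst].
  by apply: cvgM; [exact: c1|apply: cvgB; [exact: cvg_cst|exact: c1]].
have c4 : continuous (fun t : R => (a.1 + t * (b.1 - a.1)) * (6 - (a.1 + t * (b.1 - a.1))) *
    (a.2 + t * (b.2 - a.2) + 1) * (a.1 + t * (b.1 - a.1))).
  by move=> u; apply: cvgM; [exact: c3|exact: c1].
exact: (cvg_pair (c3 t) (c4 t)).
Qed.

Definition vertex_pos (v : nat) : R * R :=
  if v is u.+1 then loop_map (grid_point (u %/ 10) (spot_pos (u %% 10))) else (0, 0).

Lemma spot_vertex_pos j s : (s < 11)%N -> vertex_pos (spot j s) = loop_map (grid_point j (spot_pos s)).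
Proof.
move=> s11; rewrite /spot (ltn_eqF s11) /vertex_pos.
have [s10|->] : (s < 10)%N \/ s = 10%N by lia.
  have -> : ((10 * j + s) %/ 10 = j)%N by lia.
  by have -> : ((10 * j + s) %% 10 = s)%N by lia.
have -> : ((10 * j + 10) %/ 10 = j.+1)%N by lia.
have -> : ((10 * j + 10) %% 10 = 0)%N by lia.
by rewrite /grid_point /= mulnS natrD add0r addrC.
Qed.

(** The end shared with the next ring is at the bottom of the latter, so spots at
    height at most 3 in their ring determine the ring. *)
Lemma vertex_pos_inj v v' : vertex_pos v = vertex_pos v' -> v = v'.
Proof.
have pos u : 0 < (vertex_pos u.+1).1.
  rewrite /vertex_pos; apply: loop_map_gt0; rewrite /grid_point /=.
    have /and3P[h1 h2 _] := spot_pos_strip (ltn_pmod u (isT : 0 < 10)%N).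
    by rewrite -(ltr_nat R) in h1; rewrite -(ltr_nat R) in h2; rewrite h1.
  by rewrite addr_ge0.
case: v v' => [|v] [|v'] // E'; [by have := pos v'; rewrite -E' ltxx|by have := pos v; rewrite E' ltxx|].
have m10 u : (u %% 10 < 10)%N by rewrite ltn_mod.
have strip u : 0 < (grid_point (u %/ 10) (spot_pos (u %% 10))).1 < 6 /\
    0 <= (grid_point (u %/ 10) (spot_pos (u %% 10))).2.
  have /and3P[h1 h2 _] := spot_pos_strip (m10 u).
  rewrite -(ltr_nat R) in h1; rewrite -(ltr_nat R) in h2.
  by rewrite /grid_point /= h1 h2 addr_ge0.
have [s1 s2] := strip v; have [s3 s4] := strip v'.
have [/eqP e1 /eqP e2] := loop_map_inj s1 s2 s3 s4 E'.
rewrite -!natrD !eqr_nat in e1 e2.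
have /and3P[_ _ h] := spot_pos_strip (m10 v); have /and3P[_ _ h'] := spot_pos_strip (m10 v').
have jj : (v %/ 10 = v' %/ 10)%N by move: e2 h h'; clear; lia.
have ss : (v %% 10 = v' %% 10)%N.
  apply: spot_pos_inj => //; move: e1 e2; rewrite jj eqn_add2r => /eqP e1 /eqP e2.
  by rewrite [LHS]surjective_pairing [RHS]surjective_pairing e1 e2.
by rewrite (divn_eq v 10) (divn_eq v' 10) jj ss.
Qed.

End Plane.

(** * Copies of small graphs *)

Section Copies.
Local Open Scope nat_scope.
Local Close Scope classical_set_scope.

Lemma mem_edges_of_rel (T : finType) (r : rel T) (x y : T) :
  ([set x; y]%SET \in edges_of_rel r) = (x != y) && (r x y || r y x).
Proof.
rewrite inE; apply/existsP/andP => [[a /existsP[b /and3P[ab rab /eqP e]]]|[xy]].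
  have : ([set x; y] == [set a; b])%SET by rewrite e.
  by rewrite set2_eq => /orP[] /andP[/eqP -> /eqP ->]; rewrite rab ?orbT ?ab // eq_sym ab.
case/orP=> h; first by exists x; apply/existsP; exists y; rewrite xy h eqxx.
by exists y; apply/existsP; exists x; rewrite eq_sym xy h finset.setUC eqxx.
Qed.

Lemma imset_pair (S T : finType) (f : S -> T) x y : (f @: [set x; y] = [set f x; f y])%SET.
Proof. by rewrite imsetU !imset_set1. Qed.

Lemma edges_two (T : finType) (G : graph T) e : e \in edges G -> #|e| = 2.
Proof. by move=> eG; have /forall_inP/(_ e eG)/eqP : simple_edges (edges G) := valP G. Qed.

Lemma contains_rel (S T : finType) (r : rel S) (G : graph T) (f : S -> T) : injective f ->
  (forall x y, x != y -> r x y -> [set f x; f y]%SET \in edges G) ->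
  contains_copy (graph_of_rel r) G.
Proof.
move=> finj H; exists f; split=> // e; rewrite inE => /existsP[x /existsP[y /and3P[xy rxy /eqP ->]]].
by rewrite imset_pair; exact: H.
Qed.

Lemma free_K4_theta (T : finType) (G : graph T) : free_of K4_theta62 G ->
  K4_free (edges G) /\ theta_free (edges G).
Proof.
move=> free.
have S (x y : T) : [set x; y]%SET \in edges G -> [set y; x]%SET \in edges G by rewrite finset.setUC.
have N (x y : T) : [set x; y]%SET \in edges G -> x != y.
  by move/edges_two; rewrite cards2; case: (x != y).
split=> [a b c d ab ac ad bc bd cd|a b c d e f U ab bc cd de ef fa ac].
  apply: (free (Tagged (fun m => graph 'I_m) (complete_graph 4))); first by left.
  pose g (i : 'I_4) := nth a [:: a; b; c; d] i.
  have U : uniq [:: a; b; c; d].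
    by rewrite /= !inE !negb_or !N.
  apply: (@contains_rel _ _ _ _ g).
    by move=> i j /eqP; rewrite nth_uniq // => /eqP/val_inj.
  by case=> [[|[|[|[|]]]] //= i4] [[|[|[|[|]]]] //= j4] // _ _; rewrite /g //=; exact: S.
apply: (free (Tagged (fun m => graph 'I_m) theta62)); first by right.
pose g (i : 'I_6) := nth a [:: a; b; c; d; e; f] i.
apply: (@contains_rel _ _ _ _ g).
  by move=> i j /eqP; rewrite nth_uniq // => /eqP/val_inj.
case=> [[|[|[|[|[|[|]]]]]] //= i6] [[|[|[|[|[|[|]]]]]] //= j6] // _; rewrite /g //=.
Qed.

Lemma copy_K4_theta (T : finType) (G : graph T) : K4_free (edges G) -> theta_free (edges G) ->
  free_of K4_theta62 G.
Proof.
move=> K Th H [] -> [f [finj H']].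
  have h x y : x != y -> [set f x; f y]%SET \in edges G.
    by move=> xy; rewrite -imset_pair; apply: H'; rewrite mem_edges_of_rel xy.
  pose i (m : nat) (h : m < 4) : 'I_4 := Ordinal h.
  by apply: (K (f (@i 0 isT)) (f (@i 1 isT)) (f (@i 2 isT)) (f (@i 3 isT))); apply: h.
pose i (m : nat) (h : m < 6) : 'I_6 := Ordinal h.
have h x y : x != y -> (y == ordS x) || ((x == 0 :> nat) && (y == 2 :> nat)) ->
    [set f x; f y]%SET \in edges G.
  by move=> xy r; rewrite -imset_pair; apply: H'; rewrite mem_edges_of_rel xy /= r.
apply: (Th (f (@i 0 isT)) (f (@i 1 isT)) (f (@i 2 isT)) (f (@i 3 isT)) (f (@i 4 isT)) (f (@i 5 isT)));
  try exact: h.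
by rewrite /= !inE !(inj_eq finj).
Qed.

(** * The extremal graphs *)

Definition ring_graph (k : nat) : graph 'I_(10 * k).+2 :=
  graph_of_rel (fun u v : 'I_(10 * k).+2 => [exists j : 'I_k,
    has (fun s => (u == spot j s.1.1 :> nat) && (v == spot j s.1.2 :> nat)) ring_edges]).

Definition ring_edge (k : nat) (js : nat * (nat * nat * nat)) : {set 'I_(10 * k).+2} :=
  [set inord (spot js.1 js.2.1.1); inord (spot js.1 js.2.1.2)]%SET.

Lemma spot_lt k j s : j < k -> s <= 11 -> spot j s < (10 * k).+2.
Proof. by rewrite /spot; case: eqP => //; lia. Qed.

Lemma ring_edge_vals k j s : j < k -> s \in ring_edges ->
  (inord (spot j s.1.1) : 'I_(10 * k).+2) = spot j s.1.1 :> nat /\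
  (inord (spot j s.1.2) : 'I_(10 * k).+2) = spot j s.1.2 :> nat.
Proof.
move=> jk /ring_edges_bounds /andP[/andP[b1 b2] b3].
by rewrite !inordK // spot_lt //; lia.
Qed.

Lemma spot_neq j s : s \in ring_edges -> spot j s.1.1 != spot j s.1.2.
Proof.
move=> /ring_edges_bounds /andP[/andP[b1 b2] b3]; rewrite /spot.
by case: (eqVneq s.1.1 11) => h1; case: (eqVneq s.1.2 11) => h2; lia.
Qed.

Lemma mem_ring_graph k e : e \in edges (ring_graph k) <->
  exists js, [/\ js.1 < k, js.2 \in ring_edges & e = ring_edge k js].
Proof.
split.
  rewrite inE => /existsP[x /existsP[y /and3P[xy /existsP[j /hasP[s sE /andP[/eqP ex /eqP ey]]] /eqP ->]]].
  exists (nat_of_ord j, s); split=> //=; rewrite /ring_edge /=.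
  have [h1 h2] := ring_edge_vals (ltn_ord j) sE.
  have -> : x = inord (spot j s.1.1) by apply: val_inj; rewrite /= h1.
  by have -> : y = inord (spot j s.1.2) by apply: val_inj; rewrite /= h2.
case=> -[j s] [jk sE ->]; rewrite mem_edges_of_rel.
have [h1 h2] := ring_edge_vals jk sE.
rewrite -(inj_eq val_inj) [val _]h1 [val _]h2 spot_neq //; apply/orP; left.
by apply/existsP; exists (Ordinal jk); apply/hasP; exists s => //; rewrite h1 h2 !eqxx.
Qed.

Lemma ring_graph_joined k (x y : 'I_(10 * k).+2) : [set x; y]%SET \in edges (ring_graph k) -> joined x y.
Proof.
move=> /mem_ring_graph [[j s] [/= jk sE /eqP]]; have [h1 h2] := ring_edge_vals jk sE.
rewrite set2_eq => h; exists j, s.2, s => //; split=> //.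
by case/orP: h => /andP[/eqP -> /eqP ->]; rewrite h1 h2; [left|right].
Qed.

Lemma ring_graph_free k : free_of K4_theta62 (ring_graph k).
Proof.
apply: copy_K4_theta.
  move=> a b c d /ring_graph_joined h1 /ring_graph_joined h2 /ring_graph_joined h3
    /ring_graph_joined h4 /ring_graph_joined h5 /ring_graph_joined h6.
  exact: joined_K4_free h1 h2 h3 h4 h5 h6.
move=> a b c d e f U /ring_graph_joined h1 /ring_graph_joined h2 /ring_graph_joined h3
    /ring_graph_joined h4 /ring_graph_joined h5 /ring_graph_joined h6 /ring_graph_joined h7.
apply: (joined_theta_free _ h1 h2 h3 h4 h5 h6 h7).
by rewrite -(map_inj_uniq val_inj) in U.
Qed.

Lemma ring_edge_inj k j j' s s' : j < k -> j' < k -> s \in ring_edges -> s' \in ring_edges ->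
  ring_edge k (j, s) = ring_edge k (j', s') -> j = j' /\ s = s'.
Proof.
move=> jk jk' sE sE' /eqP; rewrite set2_eq /= -!(inj_eq val_inj) /=.
have [-> ->] := ring_edge_vals jk sE; have [-> ->] := ring_edge_vals jk' sE'.
by move=> h; apply: spot_edge_inj => //; case/orP: h => /andP[/eqP -> /eqP ->]; [left|right].
Qed.

Lemma ring_graph_size k : 24 * k <= #|edges (ring_graph k)|.
Proof.
pose s0 := (0, 0, 0).
pose f (ji : 'I_k * 'I_24) := ring_edge k (nat_of_ord ji.1, nth s0 ring_edges ji.2).
have mem (i : 'I_24) : nth s0 ring_edges i \in ring_edges by apply: mem_nth.
have finj : injective f.
  move=> [j i] [j' i'] /= /ring_edge_inj; case=> //= jj /eqP.
  by rewrite nth_uniq // => /eqP/val_inj ->; rewrite (val_inj jj).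
have <- : #|{: 'I_k * 'I_24}| = 24 * k by rewrite card_prod !card_ord mulnC.
rewrite -(card_imset _ finj); apply: subset_leq_card.
apply/fintype.subsetP => _ /imsetP[[j i] _ ->]; apply/mem_ring_graph.
by exists (nat_of_ord j, nth s0 ring_edges i); split=> //=; exact: mem.
Qed.

End Copies.

(** ** The arcs of a ring graph *)

Section RingDrawing.
Variables (R : realType) (k : nat).

Lemma ring_arc0 j s : s \in ring_edges -> @ring_arc R (j, s) 0 = vertex_pos R (spot j s.1.1).
Proof.
move=> sE; rewrite spot_vertex_pos; last by have := ring_edges_bounds sE; lia.
by rewrite /ring_arc /along /= !mul0r !addr0.
Qed.

Lemma ring_arc1 j s : s \in ring_edges -> @ring_arc R (j, s) 1 = vertex_pos R (spot j s.1.2).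
Proof.
move=> sE; have bd := ring_edges_bounds sE.
rewrite /ring_arc /along /= !mul1r ![_ + (_ - _)]addrC !subrK /far_end.
case: (eqVneq s.1.2 11%N) => [->|n11]; last first.
  have q11 : (s.1.2 < 11)%N by lia.
  by rewrite spot_vertex_pos.
by rewrite loop_map_border //=; case: ifP; [right|left].
Qed.

Lemma ring_arc_inj j s : s \in ring_edges -> {in `[0, 1] &, injective (@ring_arc R (j, s))}.
Proof.
move=> sE; have bd := ring_edges_bounds sE.
have before t t' : 0 <= t < 1 -> 0 <= t' < 1 -> @ring_arc R (j, s) t = @ring_arc R (j, s) t' -> t = t'.
  move=> h h'; have [s1 s2] := along_strip j sE h; have [s3 s4] := along_strip j sE h'.
  move=> /(loop_map_inj s1 s2 s3 s4); apply: along_inj.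
  apply/eqP => /grid_point_inj /eqP e.
  by have /and5P[_ _ _ _ /and4P[_ _ _ /negP]] := ring_edges_strip sE.
have last_ t : 0 <= t < 1 -> @ring_arc R (j, s) t = @ring_arc R (j, s) 1 -> False.
  move=> h; have [s1 s2] := along_strip j sE h.
  case: (eqVneq s.1.2 11%N) => n11.
    rewrite ring_arc1 // n11 => e; have := loop_map_gt0 s1 s2.
    by move: e; rewrite /ring_arc => ->; rewrite /= ltxx.
  have q11 : (s.1.2 < 11)%N by lia.
  rewrite ring_arc1 // spot_vertex_pos // => e.
  have q10 : (s.1.2 < 10)%N \/ s.1.2 = 10%N by lia.
  have [g1 g2] : 0 < (grid_point R j (spot_pos s.1.2)).1 < 6 /\
      0 <= (grid_point R j (spot_pos s.1.2)).2.
    split; last by rewrite addr_ge0.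
    case: q10 => [h10|->]; rewrite /grid_point /=; last by rewrite ltr0n ltr_nat.
    by have /and3P[p1 p2 _] := spot_pos_strip h10; rewrite ltr0n ltr_nat p1.
  have := loop_map_inj s1 s2 g1 g2 e.
  have -> : grid_point R j (spot_pos s.1.2) =
      along (grid_point R j (spot_pos s.1.1)) (grid_point R j (far_end s)) 1.
    rewrite /along !mul1r ![_ + (_ - _)]addrC !subrK /far_end (negbTE n11).
    by case: (grid_point _ _ _).
  move=> /along_inj t1; have : t = 1.
    apply: t1; apply/eqP => /grid_point_inj /eqP e'.
    by have /and5P[_ _ _ _ /and4P[_ _ _ /negP]] := ring_edges_strip sE.
  by move: h => /[swap] ->; rewrite ltxx andbF.
move=> t t'; rewrite !in_itv /= => /andP[t0 t1] /andP[t'0 t'1] e.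
move: t1 t'1; rewrite !le_eqVlt => /orP[/eqP t1|t1] /orP[/eqP t'1|t'1].
- by rewrite t1 t'1.
- by subst t; case: (last_ t'); rewrite ?t'0.
- by subst t'; case: (last_ t); rewrite ?t0.
by apply: before; rewrite ?t0 ?t'0.
Qed.

Lemma open_unit (t : R) : t \in `]0, 1[ -> 0 < t < 1 /\ 0 <= t < 1.
Proof. by rewrite in_itv /= => /andP[t0 t1]; rewrite t0 t1 ltW. Qed.

(** An inner point of an edge lies strictly between the heights that bound its ring,
    so it can meet only things of the same ring. *)
Lemma strip_index (i j : nat) (y : R) : (4 * i)%:R < y < (4 * i.+1)%:R ->
  (4 * j)%:R <= y -> y < (4 * j.+1)%:R -> i = j.
Proof.
move=> /andP[a b] c d; have := lt_trans a d; have := le_lt_trans c b.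
by rewrite !ltr_nat; lia.
Qed.

Lemma ring_arc_vertex j s v t : s \in ring_edges -> 0 < t < 1 -> 0 <= t < 1 ->
  @ring_arc R (j, s) t <> vertex_pos R v.
Proof.
move=> sE t01 t01'; have [s1 s2] := along_strip j sE t01'; case: v => [|v] e.
  by have := loop_map_gt0 s1 s2; move: e; rewrite /ring_arc => ->; rewrite /= ltxx.
have m10 : (v %% 10 < 10)%N by rewrite ltn_mod.
have /and3P[p1 p2 p3] := spot_pos_strip m10.
have [g1 g2] : 0 < (grid_point R (v %/ 10) (spot_pos (v %% 10))).1 < 6 /\
    0 <= (grid_point R (v %/ 10) (spot_pos (v %% 10))).2.
  by split; [rewrite /grid_point /= ltr0n ltr_nat p1|rewrite addr_ge0].
have E1 := loop_map_inj s1 s2 g1 g2 e.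
have jv : j = (v %/ 10)%N.
  apply: (strip_index (along_inside j sE t01)); rewrite E1 /grid_point /=.
    by rewrite lerDr.
  by rewrite mulnS natrD ltrD2r ltr_nat.
have half : 0 < (2^-1 : R) < 1 by rewrite invr_gt0 ltr0n invf_lt1 // ltr1n.
apply: (apart_lines (j := j) (ring_edges_spot_apart sE m10) t01 half).
rewrite [LHS]E1 -jv /along !subrr !mulr0 !addr0.
by case: (grid_point _ _ _).
Qed.

Lemma ring_arc_disjoint j j' s s' t t' : s \in ring_edges -> s' \in ring_edges ->
  (j, s) <> (j', s') -> 0 < t < 1 -> 0 <= t < 1 -> 0 < t' < 1 -> 0 <= t' < 1 ->
  @ring_arc R (j, s) t <> @ring_arc R (j', s') t'.
Proof.
move=> sE sE' ne t1 t1' t2 t2' e.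
have [s1 s2] := along_strip j sE t1'; have [s3 s4] := along_strip j' sE' t2'.
have E1 := loop_map_inj s1 s2 s3 s4 e.
have jj : j = j'.
  apply: (strip_index (along_inside j sE t1)); rewrite E1;
  by have /andP[a b] := along_inside j' sE' t2; rewrite ?b // ltW.
subst j'; apply: (apart_lines (j := j) (ring_edges_apart sE sE' _) t1 t2 E1).
by apply/eqP => ss; apply: ne; rewrite ss.
Qed.

Lemma ring_graph_planar : planar R (ring_graph k).
Proof.
have /choice[code codeP] : forall e, exists js : nat * (nat * nat * nat),
    e \in edges (ring_graph k) -> [/\ (js.1 < k)%N, js.2 \in ring_edges & e = ring_edge k js].
  move=> e; case: (boolP (e \in edges (ring_graph k))) => [/mem_ring_graph [js h]|_].
    by exists js.
  by exists (0, (0, 0, 0))%N.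
exists (fun v : 'I_(10 * k).+2 => vertex_pos R v), (fun e => @ring_arc R (code e)); split.
- by move=> u v /vertex_pos_inj /val_inj.
- move=> e /codeP; case: (code e) => j s [/= jk sE ->]; split.
  + exact/continuous_subspaceT/ring_arc_continuous.
  + exact: ring_arc_inj.
  exists (inord (spot j s.1.1)), (inord (spot j s.1.2)).
  have [-> ->] := ring_edge_vals jk sE.
  by rewrite ring_arc0 // ring_arc1.
- move=> e v /codeP; case: (code e) => j s [/= jk sE _] t /open_unit [t1 t2].
  exact: ring_arc_vertex.
move=> e f /codeP + /codeP; case: (code e) => j s [/= jk sE eE].
case: (code f) => j' s' [/= jk' sE' fE] ef t t' /open_unit [t1 t2] /open_unit [t1' t2'].
by apply: ring_arc_disjoint => // h; apply: ef; rewrite eE fE h.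
Qed.

End RingDrawing.

(** * The extremal number *)

Lemma planar_K4_theta_bound (R : realType) n (G : graph 'I_n) : (6 <= n)%N ->
  planar R G -> free_of K4_theta62 G -> (5 * #|edges G| + 24 <= 12 * n)%N.
Proof.
move=> n6 [p [c draw]] /free_K4_theta [K Th].
have dual : forall E : {set {set 'I_n}}, E \subset edges G -> has_dual E.
  by move=> E; exact: drawing_has_dual draw E.
have := @dual_edge_bound _ (edges G) dual K Th [set: 'I_n]%SET (edges G).
rewrite cardsT card_ord; apply => //.
by move=> e /edges_two ->; rewrite finset.subsetT.
Qed.

Theorem theorem1p7 (R : realType) (n : nat) (hn : (6 <= n)%N) :
  ((planar_turan R n K4_theta62)%:R <= 12 / 5 * (n%:R - 2) :> R) /\
  ((12 <= n)%N -> (n = 2 %[mod 10])%N ->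
   (planar_turan R n K4_theta62)%:R = 12 / 5 * (n%:R - 2) :> R).
Proof.
have up : (5 * planar_turan R n K4_theta62 + 24 <= 12 * n)%N.
  have : (planar_turan R n K4_theta62 <= (12 * n - 24) %/ 5)%N.
    apply/bigmax_leqP => G /asboolP [pl fr].
    by have := planar_K4_theta_bound hn pl fr; rewrite leq_divRL //; lia.
  by rewrite leq_divRL //; lia.
have upR : (planar_turan R n K4_theta62)%:R <= 12 / 5 * (n%:R - 2) :> R.
  by move: up; rewrite -(ler_nat R) natrD !natrM; lra.
split=> // n12 nmod; apply/eqP; rewrite eq_le upR /=.
have [k nk] : exists k, n = (10 * k).+2.
  by exists (n %/ 10)%N; move: nmod; rewrite (modn_small (isT : 2 < 10)%N); lia.
subst n.
have low : (24 * k <= planar_turan R (10 * k).+2 K4_theta62)%N.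
  apply: leq_trans (ring_graph_size k) _.
  rewrite /planar_turan; apply: leq_bigmax_cond.
  by apply/asboolP; split; [exact: ring_graph_planar|exact: ring_graph_free].
have lowR : 24 * k%:R <= (planar_turan R (10 * k).+2 K4_theta62)%:R :> R.
  by rewrite -natrM ler_nat.
have -> : (10 * k).+2%:R = 10 * k%:R + 2 :> R by rewrite -addn2 natrD natrM.
by move: lowR; lra.
Qed.
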